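(* Let $J$ be the real James space and let $\ell^2(J)$ be the $\ell^2$-sum of countably many copies of $J$. Under the isometric identification of $\ell^2(J)^{**}/\ell^2(J)$ with real $\ell^2$ described in the context, the map $S+W(\ell^2(J))\mapsto R(S)$ is an algebra isometry of the weak Calkin algebra $\mathcal{W}(\ell^2(J))=L(\ell^2(J))/W(\ell^2(J))$ onto $(\mathrm{Reg}(\ell^2),\|\cdot\|_r)$; in particular $$\|S\|_w=\|R(S)\|_r\qquad\text{for all } S\in L(\ell^2(J)).$$ Moreover, $\mathrm{Im}(R)=\{R(S):S\in L(\ell^2(J))\}$ is not closed in $L(\ell^2)$ (with respect to the operator norm).
   Context: For Banach spaces $E,F$, $L(E,F)$ denotes the bounded linear operators and $W(E,F)$ the weakly compact ones; $L(E)=L(E,E)$, $W(E)=W(E,E)$. Every Banach space is regarded as canonically embedded in its bidual. For $S\in L(E,F)$, $\|S\|_w=\mathrm{dist}(S,W(E,F))$ is the quotient norm on $L(E,F)/W(E,F)$, and $R(S)\in L(E^{**}/E,F^{**}/F)$ is defined by $R(S)(x^{**}+E)=S^{**}x^{**}+F$. One has $R(S)=0$ iff $S\in W(E,F)$, so $R$ is well defined and injective on $L(E,F)/W(E,F)$. The James space $J$ is the space of real sequences $x=(x_k)$ with $\lim_k x_k=0$ and $$\|x\|=\sup_{i_1<\dots<i_{n+1}}\Big(\sum_{k=1}^n|x_{i_{k+1}}-x_{i_k}|^2\Big)^{1/2}<\infty,$$ the supremum being over all $n\in\mathbb{N}$ and all increasing finite sequences $1\le i_1<\dots<i_{n+1}$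 of natural numbers. An element $x^{**}\in J^{**}$ is identified with the scalar sequence $(x^{**}(e_j^* ))_j$, where $e_j^*\in J^*$ is the $j$-th coordinate functional; then $J^{**}=J\oplus\mathbb{R}f$ with $f=(1,1,\dots)$, and each such sequence has a limit. One has $\ell^2(J)^{**}=\ell^2(J^{**})$, and $\ell^2(J)^{**}/\ell^2(J)$ is identified isometrically with $\ell^2$ through $(x_k)+\ell^2(J)\mapsto(w_1,w_2,\dots)$, where $w_k=\lim_{j\to\infty}x^{(k)}_j$ for $x_k=(x^{(k)}_j)_{j}\in J^{**}$. $\mathrm{Reg}(\ell^2)$ is the algebra of lattice regular operators: all $A=(a_{ij})\in L(\ell^2)$ (matrix with respect to the unit vector basis) such that $|A|=(|a_{ij}|)$ defines a bounded operator on $\ell^2$; its norm is $\|A\|_r=\|\,|A|\,\|$ (operator norm of $|A|$). *)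

(* Defs.v *)
From HB Require Import structures.
From mathcomp Require Import all_boot all_order all_algebra.
From mathcomp Require Import generic_quotient ring_quotient.
From mathcomp Require Import mathcomp_extra boolp classical_sets functions.
From mathcomp Require Import reals topology normedtype sequences.
From mathcomp Require Import lra.

Set Implicit Arguments.
Unset Strict Implicit.
Unset Printing Implicit Defensive.

Import Order.TTheory GRing.Theory Num.Theory.
Import numFieldNormedType.Exports.

Local Open Scope classical_set_scope.
Local Open Scope ring_scope.

Section BoundedOperators.
Context {R : realType}.

Definition bounded_linear (E F : normedModType R) : {pred E -> F} :=
  [pred f | `[< linear f /\ exists M, forall x, `|f x| <= M * `|x| >]].
Arguments bounded_linear : clear implicits.

Record bop (E F : normedModType R) := BOp {
  bop_fun :> E -> F;
  bop_funP : bop_fun \in bounded_linear E F }.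

Section Theory.
Context {E F : normedModType R}.

HB.instance Definition _ := [isSub for @bop_fun E F].
HB.instance Definition _ := [Choice of bop E F by <:].

Lemma bopP (S T : bop E F) : S = T <-> forall x, S x = T x.
Proof. by split=> [->//|ST]; exact/val_inj/funext. Qed.

Lemma bounded_linearP (f : E -> F) : reflect
  (linear f /\ exists M, forall x, `|f x| <= M * `|x|) (f \in bounded_linear E F).
Proof. exact: asboolP. Qed.

Lemma bounded_linear_submod : submod_closed (bounded_linear E F).
Proof.
split.
  apply/bounded_linearP; split=> [a x y|]; first by rewrite scaler0 addr0.
  by exists 0 => x; rewrite normr0 mul0r.
move=> a f g /bounded_linearP[lf [M fM]] /bounded_linearP[lg [N gN]].
apply/bounded_linearP; split=> [b x y|].
  rewrite !fctE lf lg !scalerDr !scalerA (mulrC a b).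
  by rewrite -!addrA; congr (_ + _); rewrite addrCA.
exists (`|a| * M + N) => x; rewrite (le_trans (ler_normD _ _))//.
by rewrite mulrDl lerD// normrZ -mulrA ler_wpM2l.
Qed.

HB.instance Definition _ := GRing.isSubmodClosed.Build R (E -> F)
  (bounded_linear E F) bounded_linear_submod.
HB.instance Definition _ := [SubChoice_isSubLmodule of bop E F by <:].

Lemma bop_linear (S : bop E F) : linear S.
Proof. by have /bounded_linearP[] := bop_funP S. Qed.

HB.instance Definition _ (S : bop E F) :=
  GRing.isLinear.Build R E F _ S (bop_linear S).

Lemma bop_bounded (S : bop E F) : exists M, forall x, `|S x| <= M * `|x|.
Proof. by have /bounded_linearP[] := bop_funP S. Qed.

Definition op_norm (S : bop E F) : R :=
  sup [set `|S x| | x in [set x : E | `|x| <= 1]].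

Lemma op_norm_ub (S : bop E F) M :
  (forall x, `|x| <= 1 -> `|S x| <= M) -> op_norm S <= M.
Proof.
move=> SM; apply: ge_sup; last by move=> _ [x /= x1 <-]; exact: SM.
by exists `|S 0|, 0 => //=; rewrite normr0.
Qed.

Lemma op_norm_has_ub (S : bop E F) :
  has_ubound [set `|S x| | x in [set x : E | `|x| <= 1]].
Proof.
have [M SM] := bop_bounded S; exists (Num.max M 0) => _ [x /= x1 <-].
rewrite (le_trans (SM x))// (@le_trans _ _ (Num.max M 0 * `|x|))//.
  by rewrite ler_wpM2r// le_max lexx.
by rewrite ler_piMr// le_max lexx orbT.
Qed.

Lemma op_norm_le1 (S : bop E F) x : `|x| <= 1 -> `|S x| <= op_norm S.
Proof. by move=> x1; apply: ub_le_sup; [exact: op_norm_has_ub|exists x]. Qed.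

Lemma op_norm_ge0 (S : bop E F) : 0 <= op_norm S.
Proof. by have := @op_norm_le1 S 0; rewrite linear0 !normr0; apply. Qed.

Lemma op_norm_le (S : bop E F) x : `|S x| <= op_norm S * `|x|.
Proof.
have [->|x0] := eqVneq x 0; first by rewrite linear0 !normr0 mulr0.
have nx : 0 < `|x| by rewrite normr_gt0.
rewrite -ler_pdivrMr// mulrC.
have -> : `|x|^-1 * `|S x| = `|S (`|x|^-1 *: x)|.
  by rewrite linearZ normrZ gtr0_norm// invr_gt0.
by apply: op_norm_le1; rewrite normrZ gtr0_norm ?invr_gt0// mulVf ?gt_eqF.
Qed.

Lemma op_normD (S T : bop E F) : op_norm (S + T) <= op_norm S + op_norm T.
Proof.
apply: op_norm_ub => x x1.
by rewrite (le_trans (ler_normD _ _))// lerD// op_norm_le1.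
Qed.

Lemma op_normZ a (S : bop E F) : op_norm (a *: S) = `|a| * op_norm S.
Proof.
have H b (T : bop E F) : op_norm (b *: T) <= `|b| * op_norm T.
  apply: op_norm_ub => x x1.
  by rewrite normrZ ler_wpM2l// op_norm_le1.
apply/eqP; rewrite eq_le H /=.
have [->|a0] := eqVneq a 0; first by rewrite normr0 mul0r op_norm_ge0.
rewrite -{1}[S]scale1r -(mulVf a0) -scalerA mulrC -ler_pdivlMr ?normr_gt0//.
by rewrite mulrC -normfV.
Qed.

Lemma op_norm_eq0 (S : bop E F) : op_norm S = 0 -> S = 0.
Proof.
move=> S0; apply/bopP => x; apply/normr0_eq0/eqP; rewrite eq_le normr_ge0.
by have := op_norm_le S x; rewrite S0 mul0r => ->.
Qed.

HB.instance Definition _ :=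
  Lmodule_isNormed.Build R (bop E F) op_normD op_normZ op_norm_eq0.

Lemma bop_normE (S : bop E F) :
  `|S| = sup [set `|S x| | x in [set x : E | `|x| <= 1]].
Proof. by []. Qed.

Lemma bop_norm_le (S : bop E F) x : `|S x| <= `|S| * `|x|.
Proof. exact: op_norm_le. Qed.

End Theory.

Definition mkbop (E F : normedModType R) (f : E -> F) (lf : linear f)
    (M : R) (fM : forall x, `|f x| <= M * `|x|) : bop E F :=
  BOp (introT (bounded_linearP f) (conj lf (ex_intro _ M fM))).

Section Composition.
Context {E F G : normedModType R}.
Variables (T : bop F G) (S : bop E F).

Let comp_linear : linear (T \o S).
Proof. by move=> a x y /=; rewrite !linearP. Qed.

Let comp_bound x : `|(T \o S) x| <= `|T| * `|S| * `|x|.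
Proof.
by rewrite /= (le_trans (bop_norm_le T _))// -mulrA ler_wpM2l// bop_norm_le.
Qed.

Definition bop_comp : bop E G := mkbop comp_linear comp_bound.

End Composition.

Section Identity.
Variable E : normedModType R.

Let id_linear : linear (@idfun E). Proof. by []. Qed.
Let id_bound (x : E) : `|idfun x| <= 1 * `|x|. Proof. by rewrite mul1r. Qed.

Definition bop_id : bop E E := mkbop id_linear id_bound.

End Identity.

Section OperatorAlgebra.
Variable E : normedModType R.

Let compA : associative (@bop_comp E E E).
Proof. by move=> S T U; apply/bopP. Qed.
Let comp1l : left_id (bop_id E) (@bop_comp E E E).
Proof. by move=> S; apply/bopP. Qed.
Let comp1r : right_id (bop_id E) (@bop_comp E E E).
Proof. by move=> S; apply/bopP. Qed.
Let compDl : left_distributive (@bop_comp E E E) +%R.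
Proof. by move=> S T U; apply/bopP. Qed.
Let compDr : right_distributive (@bop_comp E E E) +%R.
Proof. by move=> S T U; apply/bopP => x /=; rewrite linearD. Qed.

HB.instance Definition _ := GRing.Zmodule_isPzRing.Build (bop E E)
  compA comp1l comp1r compDl compDr.

End OperatorAlgebra.

Definition dual_space (E : normedModType R) := bop E R^o.
Definition bidual (E : normedModType R) := dual_space (dual_space E).
HB.instance Definition _ E := NormedModule.on (dual_space E).
HB.instance Definition _ E := NormedModule.on (bidual E).
End BoundedOperators.
Arguments bounded_linear {R} E F.

Section QuotientSpace.
Context {R : pzRingType} {V : lmodType R}.
Variable U : submodClosed V.
Local Open Scope quotient_scope.

Let submod_oppr : oppr_closed U.
Proof. by move=> x Ux; rewrite -scaleN1r rpredZ. Qed.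

(* ring_quotient takes quotients by a zmodClosed predicate; a submodClosed one
   over a ring of scalars is closed under opposites through the scalar -1. *)
Let subgroup : zmodClosed V :=
  HB.pack (U : {pred V}) (GRing.SubmodClosed.class U)
    (GRing.isOppClosed.Build V U submod_oppr).

Definition quot_space := Quotient.quot subgroup.
Local Notation Q := quot_space.
HB.instance Definition _ := GRing.Zmodule.on quot_space.

Let quot_eqE x y : (x == y %[mod Q]) = (x - y \in U).
Proof. by rewrite -Quotient.idealrBE. Qed.

Let pi_quotD : {morph \pi_Q : x y / x + y}.
Proof. exact: (Quotient.pi_add subgroup). Qed.

Definition quot_scale (a : R) := lift_op1 Q ( *:%R a).

Lemma pi_quot_scale a : {morph \pi_Q : x / a *: x >-> quot_scale a x}.
Proof.
move=> x; unlock quot_scale; apply/eqP; rewrite quot_eqE -scalerBr.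
by rewrite rpredZ// -quot_eqE reprK.
Qed.

Let scaleA a b (q : Q) : quot_scale a (quot_scale b q) = quot_scale (a * b) q.
Proof. by rewrite -[q]reprK -!pi_quot_scale scalerA. Qed.
Let scale1 : left_id 1 quot_scale.
Proof. by move=> q; rewrite -[q]reprK -pi_quot_scale scale1r. Qed.
Let scaleDr : right_distributive quot_scale +%R.
Proof.
move=> a p q; rewrite -[p]reprK -[q]reprK -!pi_quot_scale.
by rewrite -!pi_quotD -pi_quot_scale scalerDr.
Qed.
Let scaleDl q : {morph quot_scale^~ q : a b / a + b}.
Proof.
move=> a b; rewrite -[q]reprK -!pi_quot_scale.
by rewrite -pi_quotD scalerDl.
Qed.

HB.instance Definition _ := GRing.Zmodule_isLmodule.Build R quot_space
  scaleA scale1 scaleDr scaleDl.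

Definition quot_pi (x : V) : Q := \pi_Q x.

Lemma quot_pi_eq (x y : V) : (quot_pi x == quot_pi y) = (x - y \in U).
Proof. exact: quot_eqE. Qed.

Lemma quot_pi_linear : linear quot_pi.
Proof. by move=> a x y; rewrite /quot_pi pi_quotD pi_quot_scale. Qed.
HB.instance Definition _ := GRing.isLinear.Build R V Q _ quot_pi quot_pi_linear.

Lemma quot_piK (q : Q) : quot_pi (repr q) = q.
Proof. exact: reprK. Qed.

End QuotientSpace.

Section QuotientNorm.
Context {R : realType} {V : normedModType R}.
Variable U : submodClosed V.

Definition quot_norm (q : quot_space U) : R :=
  inf [set `|x| | x in [set x : V | quot_pi U x = q]].

Definition dist_to (x : V) : R := inf [set `|x - u| | u in [set u | u \in U]].

Lemma quot_norm_pi x : quot_norm (quot_pi U x) = dist_to x.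
Proof.
congr inf; apply/seteqP; split=> _ [y /= Hy <-].
  exists (x - y); last by rewrite opprB addrC subrK.
  by move/esym/eqP: Hy; rewrite quot_pi_eq.
by exists (x - y) => //=; apply/eqP; rewrite quot_pi_eq addrAC subrr add0r -scaleN1r rpredZ.
Qed.

End QuotientNorm.

Section Bidual.
Context {R : realType}.
Implicit Types E F : normedModType R.

Section Embedding.
Context {E : normedModType R}.

Let ev_linear (x : E) : linear ((fun f => f x) : dual_space E -> R^o).
Proof. by []. Qed.
Let ev_bound (x : E) (f : dual_space E) : `|f x| <= `|x| * `|f|.
Proof. by rewrite mulrC bop_norm_le. Qed.

Definition bidual_embed (x : E) : bidual E := mkbop (ev_linear x) (ev_bound x).

Lemma bidual_embed_linear : linear bidual_embed.
Proof. by move=> a x y; apply/bopP => f /=; rewrite linearP. Qed.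
HB.instance Definition _ := GRing.isLinear.Build R E (bidual E) _ bidual_embed bidual_embed_linear.

End Embedding.

Section Adjoint.
Context {E F : normedModType R}.
Variable S : bop E F.

Let pre_linear : linear ((fun g => bop_comp g S) : dual_space F -> dual_space E).
Proof. by move=> a f g; apply/bopP. Qed.
Let pre_bound (g : dual_space F) : `|(bop_comp g S : dual_space E)| <= `|S| * `|g|.
Proof.
apply: op_norm_ub => x x1; rewrite /= (le_trans (bop_norm_le g _))// mulrC.
rewrite ler_wpM2r// (le_trans (bop_norm_le S _))//.
by rewrite ler_piMr.
Qed.

Definition adjoint : bop (dual_space F) (dual_space E) := mkbop pre_linear pre_bound.

End Adjoint.

Definition biadjoint E F (S : bop E F) : bop (bidual E) (bidual F) :=
  adjoint (adjoint S).

Lemma biadjoint_embed E F (S : bop E F) (x : E) :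
  biadjoint S (bidual_embed x) = bidual_embed (S x).
Proof. exact/bopP. Qed.

Definition embed_image E : {pred bidual E} :=
  [pred xi | `[< exists x : E, xi = bidual_embed x >]].
Arguments embed_image : clear implicits.

Lemma embed_imageP E (xi : bidual E) :
  reflect (exists x : E, xi = bidual_embed x) (xi \in embed_image E).
Proof. exact: asboolP. Qed.

Lemma embed_image_submod E : submod_closed (embed_image E).
Proof.
split; first by apply/embed_imageP; exists 0; rewrite linear0.
move=> a _ _ /embed_imageP[x ->] /embed_imageP[y ->].
by apply/embed_imageP; exists (a *: x + y); rewrite linearP.
Qed.
HB.instance Definition _ E := GRing.isSubmodClosed.Build R (bidual E)
  (embed_image E) (embed_image_submod E).

Definition bidual_quot E := quot_space (embed_image E).
HB.instance Definition _ E := GRing.Lmodule.on (bidual_quot E).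

Section ResidualMap.
Context {E F : normedModType R}.
Variable S : bop E F.

(* The class of xi is sent to the class of [biadjoint S xi], whatever the
   representative xi: see RmapE. *)
Definition Rmap (q : bidual_quot E) : bidual_quot F :=
  quot_pi (embed_image F) (biadjoint S (repr q)).

Lemma RmapE (xi : bidual E) :
  Rmap (quot_pi (embed_image E) xi) = quot_pi (embed_image F) (biadjoint S xi).
Proof.
apply/eqP; rewrite quot_pi_eq -linearB.
have : repr (quot_pi (embed_image E) xi) - xi \in embed_image E.
  by rewrite -quot_pi_eq quot_piK.
move=> /embed_imageP[x ->]; apply/embed_imageP; exists (S x). exact: biadjoint_embed.
Qed.

Lemma Rmap_linear : linear Rmap.
Proof.
move=> a p q; rewrite -[p]quot_piK -[q]quot_piK -linearP !RmapE.
by rewrite [biadjoint S _]linearP linearP.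
Qed.
HB.instance Definition _ :=
  GRing.isLinear.Build R (bidual_quot E) (bidual_quot F) _ Rmap Rmap_linear.

End ResidualMap.
End Bidual.
Arguments embed_image {R} E.

Section Ultrafilters.

Lemma fmap_ultra (T U : Type) (f : T -> U) (G : set_system T) :
  UltraFilter G -> UltraFilter (f @ G).
Proof.
move=> GU; split; first exact: fmap_proper_filter.
move=> H PH GH; apply/seteqP; split=> // A HA.
have [//|GA] := in_ultra_setVsetC (f @^-1` A) GU.
have HA' : H (~` A) by exact: GH.
by have [x []] := filter_ex (filterI HA HA').
Qed.

Lemma initial_cvgP (S : choiceType) (T : topologicalType) (f : S -> T)
    (G : set_system S) (s : S) : Filter G ->
  G --> (s : initial_topology f) <-> f @ G --> f s.
Proof.
move=> FG; split=> [Gs|Gs A].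
  exact: (cvg_comp _ _ Gs (@initial_continuous _ _ f s)).
rewrite nbhsE => -[_ [[B oB <-] Bs] BA]; apply: filterS BA _.
by apply: Gs; apply: open_nbhs_nbhs.
Qed.

Lemma ultra_cvg_precompact (T : uniformType) (A : set T) :
  (forall G : set_system T, UltraFilter G -> G A -> exists p : T, G --> p) ->
  precompact A.
Proof.
move=> Acvg; rewrite precompactE => F PF FA.
pose F' := filter_from (fun O => open O /\ F O) (fun O => A `&` O).
have PF' : ProperFilter F'.
  apply: filter_from_proper; last first.
    move=> O [oO FO]; have [y [Oy cAy]] := filter_ex (filterI FO FA).
    by apply: cAy; apply: open_nbhs_nbhs.
  apply: filter_from_filter; first by exists setT; split;
    [exact: openT|exact: filterT].
  move=> O1 O2 [o1 F1] [o2 F2]; exists (O1 `&` O2).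
    by split; [exact: openI|exact: filterI].
  by rewrite setIACA setIid.
have [G [UG F'G]] := ultraFilterLemma PF'.
have GA : G A.
  by apply: F'G; exists setT; [split; [exact: openT|exact: filterT]|rewrite setIT].
have [p Gp] := Acvg G UG GA.
exists p; split; first by move=> N /Gp GN; exact: filter_ex (filterI GA GN).
move=> B N FB Np; apply: contrapT => BN0.
have [N' Np' N'N] := uniform_regular Np.
have GO : G (A `&` ~` closure N').
  apply: F'G; exists (~` closure N') => //.
  split; first exact: closed_openC (@closed_closure _ _).
  apply: filterS FB => b Bb cb; apply: BN0; exists b; split => //.
  exact: N'N.
have [x [xN' [_ xO]]] := filter_ex (filterI (Gp _ Np') GO).
by apply: xO; exact: subset_closure.
Qed.

End Ultrafilters.

Section WeaklyCompactOperators.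
Context {R : realType}.
Implicit Types E F : normedModType R.

Definition weak_top F :=
  initial_topology ((fun x f => f x) : F -> {ptws dual_space F -> R^o}).
HB.instance Definition _ F := Uniform.on (weak_top F).

(* [precompact A] in the library means that the closure of A is compact. *)
Definition wcompact E F : {pred bop E F} := [pred S : bop E F |
  `[< precompact (S @` [set x | `|x| <= 1] : set (weak_top F)) >]].
Arguments wcompact : clear implicits.

Lemma weak_cvgP F (G : set_system F) (y : F) : Filter G ->
  G --> (y : weak_top F) <-> forall f : dual_space F, f z @[z --> G] --> f y.
Proof.
by move=> FG; rewrite initial_cvgP pointwise_cvgP.
Qed.

Lemma wcompactP E F (S : bop E F) : S \in wcompact E F <->
  forall G : set_system E, UltraFilter G -> G [set x | `|x| <= 1] ->
  exists y : F, forall f : dual_space F, f (S x) @[x --> G] --> f y.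
Proof.
split=> [/asboolP[K SK [cK _]] G UG G1|H].
  have UH := fmap_ultra S UG.
  move: cK; rewrite compact_ultra => /(_ (S @ G : set_system (weak_top F)) UH).
  case=> [|y [_ /= Hy]].
    apply: (@filterS _ G _ _ (S @^-1` K) _ G1) => x x1.
    by apply: SK; exists x.
  by exists y; move/weak_cvgP: Hy.
apply/asboolP; apply: ultra_cvg_precompact => G UG GS.
pose B := [set x : E | `|x| <= 1].
pose F' := filter_from G (fun O => B `&` S @^-1` O).
have PF' : ProperFilter F'.
  apply: filter_from_proper; last first.
    move=> O GO; have [y [Oy [x Bx xy]]] := filter_ex (filterI GO GS).
    by exists x; split=> //=; rewrite /preimage/= xy.
  apply: filter_from_filter; first by exists setT; exact: filterT.
  move=> O1 O2 G1 G2; exists (O1 `&` O2); first exact: filterI.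
  by rewrite setIACA setIid.
have [G' [UG' F'G']] := ultraFilterLemma PF'.
have [|y Hy] := H G' UG'.
  by apply: F'G'; exists setT; [exact: filterT|move=> x []].
exists y; apply/weak_cvgP => f.
suff <- : S @ G' = G by exact: Hy.
case: UG => _; apply.
by move=> O GO; apply: F'G'; exists O => // x [].
Qed.

Lemma wcompact_submod E F : submod_closed (wcompact E F).
Proof.
split.
  apply/wcompactP => G UG _; exists 0 => f.
  rewrite (_ : (fun x => _) = cst (f 0)); first exact: cvg_cst.
  by apply/funext.
move=> a S T /wcompactP HS /wcompactP HT; apply/wcompactP => G UG G1.
have [y Hy] := HS G UG G1; have [z Hz] := HT G UG G1.
exists (a *: y + z) => f; rewrite linearP.
rewrite (_ : (fun x => _) = (fun x => a *: f (S x) + f (T x))); last first.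
  by apply/funext => x; rewrite -linearP.
by apply: cvgD; [apply: cvgZ; [exact: cvg_cst|exact: Hy]|exact: Hz].
Qed.
HB.instance Definition _ E F := GRing.isSubmodClosed.Build R (bop E F)
  (wcompact E F) (@wcompact_submod E F).

Lemma wcompact_compl E F H (T : bop F H) (S : bop E F) :
  S \in wcompact E F -> bop_comp T S \in wcompact E H.
Proof.
move=> /wcompactP HS; apply/wcompactP => G UG G1.
have [y Hy] := HS G UG G1.
by exists (T y) => f; exact: (Hy (adjoint T f)).
Qed.

Lemma wcompact_compr E F H (T : bop F H) (S : bop E F) :
  T \in wcompact F H -> bop_comp T S \in wcompact E H.
Proof.
move=> /wcompactP HT; apply/wcompactP => G UG G1.
pose c := `|S| + 1.
have c0 : 0 < c by rewrite ltr_wpDl.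
pose g x := c^-1 *: S x.
have [|y Hy] := HT (g @ G) (fmap_ultra g UG).
  apply: (@filterS _ G _ _ (g @^-1` _) _ G1) => x /= x1; rewrite /g normrZ gtr0_norm ?invr_gt0//.
  rewrite mulrC ler_pdivrMr// mul1r (le_trans (bop_norm_le S x))//.
  by rewrite (@le_trans _ _ `|S|) ?lerDl// ler_piMr.
exists (c *: y) => f.
have := Hy f; rewrite /g => {}Hy.
rewrite linearZ.
rewrite (_ : (fun x => f (bop_comp T S x)) = fun x => c *: (f (T (c^-1 *: S x)) : R^o)).
  by apply: cvgZ => //; exact: cvg_cst.
apply/funext => x.
have -> : bop_comp T S x = c *: T (c^-1 *: S x).
  by rewrite -linearZ scalerA divff ?gt_eqF// scale1r.
exact: linearZ.
Qed.

Definition weak_calkin E := quot_space (wcompact E E).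
HB.instance Definition _ E := GRing.Lmodule.on (weak_calkin E).

Definition weak_calkin_pi E (S : bop E E) : weak_calkin E :=
  quot_pi (wcompact E E) S.

Section CalkinAlgebra.
Variable E : normedModType R.
Local Notation pi := (quot_pi (wcompact E E)).

Definition calkin_mul (a b : weak_calkin E) : weak_calkin E :=
  pi (repr a * repr b).

Lemma calkin_mulE (S T : bop E E) : calkin_mul (pi S) (pi T) = pi (S * T).
Proof.
apply/eqP; rewrite quot_pi_eq.
set S' := repr _; set T' := repr _.
have -> : S' * T' - S * T = S' * (T' - T) + (S' - S) * T.
  by rewrite mulrBr mulrBl addrA subrK.
rewrite rpredD//; [apply: wcompact_compl|apply: wcompact_compr];
  by rewrite -quot_pi_eq quot_piK.
Qed.

Let mulA : associative calkin_mul.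
Proof.
move=> a b c; rewrite -[a]quot_piK -[b]quot_piK -[c]quot_piK.
by rewrite !calkin_mulE mulrA.
Qed.
Let mul1l : left_id (pi 1) calkin_mul.
Proof. by move=> a; rewrite -[a]quot_piK calkin_mulE mul1r. Qed.
Let mul1r : right_id (pi 1) calkin_mul.
Proof. by move=> a; rewrite -[a]quot_piK calkin_mulE mulr1. Qed.
Let mulDl : left_distributive calkin_mul +%R.
Proof.
move=> a b c; rewrite -[a]quot_piK -[b]quot_piK -[c]quot_piK.
by rewrite -linearD !calkin_mulE -linearD mulrDl.
Qed.
Let mulDr : right_distributive calkin_mul +%R.
Proof.
move=> a b c; rewrite -[a]quot_piK -[b]quot_piK -[c]quot_piK.
by rewrite -linearD !calkin_mulE -linearD mulrDr.
Qed.

HB.instance Definition _ := GRing.Zmodule_isPzRing.Build (weak_calkin E)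
  mulA mul1l mul1r mulDl mulDr.

End CalkinAlgebra.

Definition w_norm E F (S : bop E F) : R := dist_to (wcompact E F) S.
End WeaklyCompactOperators.
Arguments wcompact {R} E F.

Section FiniteSquareSums.
Context {R : realType} {I : Type}.
Implicit Types (r : seq I) (a b : I -> R).

Lemma sqr_sum_ge0 r a : 0 <= \sum_(i <- r) a i ^+ 2.
Proof. by apply: sumr_ge0 => i _; rewrite sqr_ge0. Qed.

Lemma cauchy_schwarz_sum r a b : (\sum_(i <- r) a i * b i) ^+ 2 <=
  (\sum_(i <- r) a i ^+ 2) * (\sum_(i <- r) b i ^+ 2).
Proof.
elim: r => [|i r IHr]; first by rewrite !big_nil expr0n mul0r.
rewrite !big_cons; move: IHr (sqr_sum_ge0 r a) (sqr_sum_ge0 r b).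
set S := \sum_(i <- r) _; set A := \sum_(i <- r) _; set B := \sum_(i <- r) _.
move: (a i) (b i) => x y SAB A0 B0.
have h : (2 * (x * y * S)) ^+ 2 <= (x ^+ 2 * B + y ^+ 2 * A) ^+ 2.
  have := sqr_ge0 (x ^+ 2 * B - y ^+ 2 * A).
  have := ler_wpM2l (sqr_ge0 (x * y)) SAB.
  nra.
have : 2 * (x * y * S) <= x ^+ 2 * B + y ^+ 2 * A.
  rewrite (le_trans (ler_norm _))// -ler_sqr ?nnegrE ?normr_ge0//.
    by rewrite real_normK ?num_real.
  by rewrite addr_ge0// mulr_ge0// sqr_ge0.
nra.
Qed.

Lemma minkowski_sum r a b :
  Num.sqrt (\sum_(i <- r) (a i + b i) ^+ 2) <=
  Num.sqrt (\sum_(i <- r) a i ^+ 2) + Num.sqrt (\sum_(i <- r) b i ^+ 2).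
Proof.
have A0 := sqr_sum_ge0 r a; have B0 := sqr_sum_ge0 r b.
rewrite -ler_sqr ?nnegrE ?addr_ge0 ?sqrtr_ge0// sqr_sqrtr; last exact: sqr_sum_ge0.
rewrite sqrrD !sqr_sqrtr// -sqrtrM//.
have -> : \sum_(i <- r) (a i + b i) ^+ 2 = \sum_(i <- r) a i ^+ 2 +
    (\sum_(i <- r) a i * b i) *+ 2 + \sum_(i <- r) b i ^+ 2.
  by rewrite -sumrMnl -!big_split /=; apply: eq_bigr => i _; rewrite sqrrD.
rewrite !lerD2r lerD2l lerMn2r/= (le_trans (ler_norm _))// -sqrtr_sqr.
by rewrite ler_wsqrtr// cauchy_schwarz_sum.
Qed.

Lemma sqrt_sumZ r c a : Num.sqrt (\sum_(i <- r) (c * a i) ^+ 2) =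
  `|c| * Num.sqrt (\sum_(i <- r) a i ^+ 2).
Proof.
rewrite -[`|c|]sqrtr_sqr -sqrtrM ?sqr_ge0//; congr Num.sqrt.
by rewrite mulr_sumr; apply: eq_bigr => i _; rewrite exprMn.
Qed.

Lemma ler_sqrt_sum r a b : (forall i, 0 <= a i <= b i) ->
  Num.sqrt (\sum_(i <- r) a i ^+ 2) <= Num.sqrt (\sum_(i <- r) b i ^+ 2).
Proof.
move=> ab; rewrite ler_wsqrtr// ler_sum// => i _.
by have /andP[a0 abi] := ab i; rewrite ler_sqr ?nnegrE// (le_trans a0).
Qed.

Lemma norm_sumM_le r a b : `|\sum_(i <- r) a i * b i| <=
  Num.sqrt (\sum_(i <- r) a i ^+ 2) * Num.sqrt (\sum_(i <- r) b i ^+ 2).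
Proof.
rewrite -sqrtrM ?sqr_sum_ge0// -sqrtr_sqr.
by rewrite ler_wsqrtr// cauchy_schwarz_sum.
Qed.

End FiniteSquareSums.

Section L2Sum.
Context {R : realType}.

Definition square_summable (E : normedModType R) : {pred nat -> E} :=
  [pred x | `[< cvgn (series (fun k => `|x k| ^+ 2 : R)) >]].
Arguments square_summable : clear implicits.

Record l2sum (E : normedModType R) := L2Sum {
  l2sum_seq :> nat -> E;
  l2sum_seqP : l2sum_seq \in square_summable E }.

Context {E : normedModType R}.

HB.instance Definition _ := [isSub for @l2sum_seq E].
HB.instance Definition _ := [Choice of l2sum E by <:].

(* Square root of a partial sum of squared norms: [square_summableP] and
   [l2_norm_le] express the l2-norm as the supremum of these. *)
Definition partial_norm (x : nat -> E) n : R :=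
  Num.sqrt (\sum_(0 <= k < n) `|x k| ^+ 2).

Let series_nd (x : nat -> E) :
  nondecreasing_seq (series (fun k => `|x k| ^+ 2 : R)).
Proof. by apply: nondecreasing_series => k _ _; rewrite sqr_ge0. Qed.

Lemma square_summableP (x : nat -> E) : x \in square_summable E <->
  exists M, forall n, partial_norm x n <= M.
Proof.
split=> [/asboolP cx|[M xM]].
  exists (Num.sqrt (limn (series (fun k => `|x k| ^+ 2 : R)))) => n.
  by rewrite ler_wsqrtr// nondecreasing_cvgn_le.
apply/asboolP; apply: nondecreasing_is_cvgn; first exact: series_nd.
exists (M ^+ 2) => _ [n _ <-].
rewrite /series /= -[leLHS]sqr_sqrtr ?sqr_sum_ge0//.
have xnM := xM n.
by rewrite ler_sqr// nnegrE ?sqrtr_ge0// (le_trans _ xnM) ?sqrtr_ge0.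
Qed.

Lemma partial_normD (x y : nat -> E) n :
  partial_norm (x + y) n <= partial_norm x n + partial_norm y n.
Proof.
rewrite /partial_norm (le_trans _ (minkowski_sum _ _ _))//.
by apply: ler_sqrt_sum => i; rewrite normr_ge0 ler_normD.
Qed.

Lemma partial_normZ a (x : nat -> E) n :
  partial_norm (a *: x) n = `|a| * partial_norm x n.
Proof.
rewrite /partial_norm -[`|a|]normr_id -sqrt_sumZ.
by congr Num.sqrt; apply: eq_bigr => k _; rewrite normrZ.
Qed.

Lemma square_summable_submod : submod_closed (square_summable E).
Proof.
split.
  apply/square_summableP; exists 0 => n.
  by rewrite /partial_norm big1 ?sqrtr0// => k _; rewrite normr0 expr0n.
move=> a x y /square_summableP[M xM] /square_summableP[N yN].
apply/square_summableP; exists (`|a| * M + N) => n.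
rewrite (le_trans (partial_normD _ _ _))// lerD//.
by rewrite partial_normZ ler_wpM2l.
Qed.
HB.instance Definition _ := GRing.isSubmodClosed.Build R (nat -> E)
  (square_summable E) square_summable_submod.
HB.instance Definition _ := [SubChoice_isSubLmodule of l2sum E by <:].

Lemma l2sumP (x y : l2sum E) : x = y <-> forall k, x k = y k.
Proof. by split=> [->//|xy]; exact/val_inj/funext. Qed.

Definition l2_norm (x : l2sum E) : R :=
  Num.sqrt (limn (series (fun k => `|x k| ^+ 2 : R))).

Lemma partial_norm_le (x : l2sum E) n : partial_norm x n <= l2_norm x.
Proof.
by rewrite ler_wsqrtr// nondecreasing_cvgn_le//; exact/asboolP/l2sum_seqP.
Qed.

Lemma l2_norm_le (x : l2sum E) M :
  (forall n, partial_norm x n <= M) -> l2_norm x <= M.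
Proof.
move=> xM; have M0 : 0 <= M by rewrite (le_trans _ (xM 0)) ?sqrtr_ge0.
rewrite -[M]ger0_norm// -sqrtr_sqr ler_wsqrtr//.
apply: limr_le; first exact/asboolP/l2sum_seqP.
near=> n; rewrite /series /= -[leLHS]sqr_sqrtr ?sqr_sum_ge0//.
by rewrite ler_sqr ?nnegrE ?sqrtr_ge0//; exact: xM.
Unshelve. all: by end_near. Qed.

Lemma l2_normD (x y : l2sum E) : l2_norm (x + y) <= l2_norm x + l2_norm y.
Proof.
apply: l2_norm_le => n; rewrite (le_trans (partial_normD _ _ _))//.
by rewrite lerD// partial_norm_le.
Qed.

Lemma l2_normZ a (x : l2sum E) : l2_norm (a *: x) = `|a| * l2_norm x.
Proof.
have H b (y : l2sum E) : l2_norm (b *: y) <= `|b| * l2_norm y.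
  by apply: l2_norm_le => n; rewrite partial_normZ ler_wpM2l// partial_norm_le.
apply/eqP; rewrite eq_le H /=.
have [->|a0] := eqVneq a 0; first by rewrite normr0 mul0r sqrtr_ge0.
rewrite -{1}[x]scale1r -(mulVf a0) -scalerA mulrC -ler_pdivlMr ?normr_gt0//.
by rewrite mulrC -normfV.
Qed.

Lemma l2_coord_le (x : l2sum E) k : `|x k| <= l2_norm x.
Proof.
rewrite (le_trans _ (partial_norm_le x k.+1))// /partial_norm.
rewrite -[leLHS]ger0_norm// -sqrtr_sqr ler_wsqrtr// big_nat_recr//= lerDr.
exact: (sqr_sum_ge0 _ (fun i => `|x i|)).
Qed.

Lemma l2_norm_eq0 (x : l2sum E) : l2_norm x = 0 -> x = 0.
Proof.
move=> x0; apply/l2sumP => k; apply/normr0_eq0/eqP.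
by rewrite eq_le normr_ge0 andbT -[leRHS]x0 l2_coord_le.
Qed.

HB.instance Definition _ :=
  Lmodule_isNormed.Build R (l2sum E) l2_normD l2_normZ l2_norm_eq0.

Section Projection.
Variable k : nat.
Let proj_linear : linear ((fun x => x k) : l2sum E -> E).
Proof. by []. Qed.
Let proj_bound (x : l2sum E) : `|x k| <= 1 * `|x|.
Proof. by rewrite mul1r l2_coord_le. Qed.
Definition l2proj : bop (l2sum E) E := mkbop proj_linear proj_bound.
End Projection.

End L2Sum.
Arguments square_summable {R} E.

Section JamesSpace.
Context {R : realType}.

Definition james_variation (x : nat -> R) (s : seq nat) : R :=
  Num.sqrt (\sum_(0 <= k < (size s).-1)
    `|x (nth 0%N s k.+1) - x (nth 0%N s k)| ^+ 2).

(* Lists i_1 < ... < i_(n+1) of indices with n >= 1. *)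
Definition increasing_indices : set (seq nat) :=
  [set s | (1 < size s)%N && sorted ltn s].

Definition james_seq : {pred nat -> R^o} := [pred x |
  `[< x k @[k --> \oo] --> (0 : R^o) /\
      has_ubound [set james_variation x s | s in increasing_indices] >]].

Record james := James {
  james_fun :> nat -> R^o;
  james_funP : james_fun \in james_seq }.

HB.instance Definition _ := [isSub for james_fun].
HB.instance Definition _ := [Choice of james by <:].

Lemma james_seqP (x : nat -> R^o) : x \in james_seq <->
  x k @[k --> \oo] --> (0 : R^o) /\
  exists M, forall s, increasing_indices s -> james_variation x s <= M.
Proof.
split=> [/asboolP[x0 [M xM]]|[x0 [M xM]]].
  by split=> //; exists M => s Is; apply: xM; exists s.
by apply/asboolP; split=> //; exists M => _ [s Is <-]; exact: xM.
Qed.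

Lemma james_variationD (x y : nat -> R^o) s :
  james_variation (x + y) s <= james_variation x s + james_variation y s.
Proof.
rewrite (le_trans _ (minkowski_sum _ _ _))//; apply: ler_sqrt_sum => k.
by rewrite normr_ge0 /= opprD addrACA ler_normD.
Qed.

Lemma james_variationZ a (x : nat -> R^o) s :
  james_variation (a *: x) s = `|a| * james_variation x s.
Proof.
rewrite /james_variation -[`|a|]normr_id -sqrt_sumZ.
by congr Num.sqrt; apply: eq_bigr => k _; rewrite -normrM mulrBr.
Qed.

Lemma james_submod : submod_closed james_seq.
Proof.
split.
  apply/james_seqP; split; first exact: cvg_cst.
  exists 0 => s _; rewrite /james_variation big1 ?sqrtr0// => k _.
  by rewrite subrr normr0 expr0n.
move=> a x y /james_seqP[x0 [M xM]] /james_seqP[y0 [N yN]].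
apply/james_seqP; split.
  rewrite -[0](addr0 (0 : R^o)) -{1}[0](scaler0 _ a).
  by apply: cvgD => //; apply: cvgZ => //; exact: cvg_cst.
exists (`|a| * M + N) => s Is; rewrite (le_trans (james_variationD _ _ _))//.
by rewrite lerD ?yN// james_variationZ ler_wpM2l ?xM.
Qed.
HB.instance Definition _ := GRing.isSubmodClosed.Build R (nat -> R^o)
  james_seq james_submod.
HB.instance Definition _ := [SubChoice_isSubLmodule of james by <:].

Lemma jamesP (x y : james) : x = y <-> forall k, x k = y k.
Proof. by split=> [->//|xy]; exact/val_inj/funext. Qed.

Definition james_norm (x : james) : R :=
  sup [set james_variation x s | s in increasing_indices].

Let increasing01 : increasing_indices [:: 0; 1]%N.
Proof. by []. Qed.

Lemma james_variation_le (x : james) s : increasing_indices s -> james_variation x s <= james_norm x.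
Proof.
move=> Is; apply: ub_le_sup; last by exists s.
by have /asboolP[_] := james_funP x.
Qed.

Lemma james_norm_le (x : james) M :
  (forall s, increasing_indices s -> james_variation x s <= M) -> james_norm x <= M.
Proof.
move=> xM; apply: ge_sup; last by move=> _ [s Is <-]; exact: xM.
by exists (james_variation x [:: 0; 1]%N), [:: 0; 1]%N.
Qed.

Lemma james_norm_ge0 (x : james) : 0 <= james_norm x.
Proof. by rewrite (le_trans _ (james_variation_le x increasing01))// sqrtr_ge0. Qed.

Lemma james_normD (x y : james) :
  james_norm (x + y) <= james_norm x + james_norm y.
Proof.
apply: james_norm_le => s Is; rewrite (le_trans (james_variationD _ _ _))//.
by rewrite lerD// james_variation_le.
Qed.

Lemma james_normZ a (x : james) : james_norm (a *: x) = `|a| * james_norm x.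
Proof.
have H b (y : james) : james_norm (b *: y) <= `|b| * james_norm y.
  by apply: james_norm_le => s Is; rewrite james_variationZ ler_wpM2l// james_variation_le.
apply/eqP; rewrite eq_le H /=.
have [->|a0] := eqVneq a 0; first by rewrite normr0 mul0r james_norm_ge0.
rewrite -{1}[x]scale1r -(mulVf a0) -scalerA mulrC -ler_pdivlMr ?normr_gt0//.
by rewrite mulrC -normfV.
Qed.

Lemma james_coord_le (x : james) j : `|x j| <= james_norm x.
Proof.
have [x0 _] := (james_seqP _).1 (james_funP x).
have xj : `|x j - x k| @[k --> \oo] --> `|x j|.
  apply: cvg_norm; rewrite -[X in _ --> X]subr0.
  by apply: cvgB => //; exact: cvg_cst.
rewrite -(cvg_lim _ xj)//; apply: limr_le; first by apply/cvg_ex; exists `|x j|.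
near=> k.
have jk : (j < k)%N by near: k; exact: nbhs_infty_gt.
have Ijk : increasing_indices [:: j; k] by rewrite /increasing_indices/= jk.
rewrite (le_trans _ (james_variation_le x Ijk))// /james_variation /= big_nat1 /=.
by rewrite sqrtr_sqr normr_id distrC.
Unshelve. all: by end_near. Qed.

Lemma james_norm_eq0 (x : james) : james_norm x = 0 -> x = 0.
Proof.
move=> x0; apply/jamesP => j; apply/normr0_eq0/eqP.
by rewrite eq_le normr_ge0 andbT -[leRHS]x0 james_coord_le.
Qed.

HB.instance Definition _ :=
  Lmodule_isNormed.Build R james james_normD james_normZ james_norm_eq0.

Section Coordinate.
Variable j : nat.
Let coord_linear : linear ((fun x => x j) : james -> R^o).
Proof. by []. Qed.
Let coord_bound (x : james) : `|x j| <= 1 * `|x|.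
Proof. by rewrite mul1r james_coord_le. Qed.
Definition james_coord : dual_space james := mkbop coord_linear coord_bound.
End Coordinate.

End JamesSpace.
Arguments james : clear implicits.

Notation ell2 R := (l2sum (R^o)).
Notation ell2J R := (l2sum (james R)).

Section BidualIdentification.
Context {R : realType}.

Lemma james_variation_cvg (a : nat -> R) M :
  (forall s, increasing_indices s -> james_variation a s <= M) -> cvgn a.
Proof.
move=> aM; apply/cauchy_cvgP/cauchyP => e e0; apply: contrapT => nball.
have /choice[f fP] N : exists k, (N < k)%N && (e <= `|a k - a N|).
  apply: contrapT => nk; apply: nball; exists (a N).
  suff : \forall k \near \oo, ball (a N) e (a k) by [].
  near=> k; rewrite -ball_normE /= ltNge; apply/negP => eNk.
  apply: nk; exists k; rewrite distrC eNk andbT.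
  by near: k; exact: nbhs_infty_gt.
pose s m := traject f 0%N m.+2.
have sI m : increasing_indices (s m).
  rewrite /increasing_indices /s /mkset size_traject /=.
  have : fpath f 0%N (traject f (f 0%N) m.+1) by exact: fpath_traject.
  by apply: sub_path => i j /eqP <-; have /andP[] := fP i.
have nths m k : (k < m.+2)%N -> nth 0%N (s m) k = iter k f 0%N.
  by move=> km; rewrite nth_traject.
have [m Hm] : exists m : nat, M ^+ 2 < m.+1%:R * e ^+ 2.
  exists (Num.truncn (M ^+ 2 / e ^+ 2)).
  by rewrite -ltr_pdivrMr ?exprn_gt0// truncnS_gt.
have := aM _ (sI m); apply/negP; rewrite -ltNge.
have He : 0 < m.+1%:R * e ^+ 2 by rewrite mulr_gt0 ?exprn_gt0.
rewrite (le_lt_trans (ler_norm M))// -sqrtr_sqr.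
apply: (@lt_le_trans _ _ (Num.sqrt (m.+1%:R * e ^+ 2))).
  by rewrite ltr_sqrt.
rewrite /james_variation (size_traject f 0%N m.+2) -[m.+2.-1]/(m.+1).
rewrite ler_wsqrtr// big_mkord.
have -> : m.+1%:R * e ^+ 2 = \sum_(k < m.+1) e ^+ 2.
  by rewrite sumr_const card_ord mulr_natl.
apply: ler_sum => k _.
rewrite !nths; [|exact: ltnW (ltn_ord k : (k.+1 <= m.+1)%N)|exact: ltn_ord k].
by rewrite ler_sqr ?nnegrE ?(ltW e0)//; have /andP[] := fP (iter k f 0%N).
Unshelve. all: by end_near. Qed.

Lemma bop_sumE (E F : normedModType R) (I : Type) (r : seq I)
    (S : I -> bop E F) x : (\sum_(i <- r) S i) x = \sum_(i <- r) S i x.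
Proof. by elim/big_ind2 : _ => // T1 y1 T2 y2 <- <-. Qed.

(* The k-th component in the bidual of J of xi is the image of xi under the
   biadjoint of the k-th projection; its j-th term as a scalar sequence is its
   value at the j-th coordinate functional. *)
Definition bidual_entry (xi : bidual (ell2J R)) k j : R :=
  biadjoint (l2proj k) xi (james_coord j).

Lemma bidual_entryE xi k j :
  bidual_entry xi k j = xi (bop_comp (james_coord j) (l2proj k)).
Proof. by []. Qed.

Lemma bidual_entry_cvg xi k : cvgn (bidual_entry xi k).
Proof.
pose eta : bidual (james R) := biadjoint (l2proj k) xi.
apply: (@james_variation_cvg _ `|eta|) => s Is.
set V := james_variation _ _.
have [->//|V0] := eqVneq V 0.
have Vgt0 : 0 < V by rewrite lt_neqAle eq_sym V0 sqrtr_ge0.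
pose d i := bidual_entry xi k (nth 0%N s i.+1) - bidual_entry xi k (nth 0%N s i).
pose g i : dual_space (james R) :=
  james_coord (nth 0%N s i.+1) - james_coord (nth 0%N s i).
pose f := \sum_(0 <= i < (size s).-1) d i *: g i.
have Ef : eta f = V ^+ 2.
  rewrite /V sqr_sqrtr; last by apply: sumr_ge0 => i _; rewrite sqr_ge0.
  rewrite linear_sum; apply: eq_bigr => i _.
  by rewrite linearZ linearB real_normK ?num_real// expr2.
have nf : `|f| <= V.
  apply: op_norm_ub => x x1; rewrite bop_sumE.
  rewrite (le_trans (norm_sumM_le _ d (fun i => g i x)))//.
  have -> : Num.sqrt (\sum_(0 <= i < (size s).-1) d i ^+ 2) = V.
    by congr Num.sqrt; apply: eq_bigr => i _; rewrite real_normK ?num_real.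
  rewrite ler_piMr ?sqrtr_ge0// (le_trans _ x1)//.
  rewrite (le_trans _ (james_variation_le x Is))// ler_wsqrtr//.
  by apply: ler_sum => i _; rewrite real_normK ?num_real.
rewrite -(ler_pM2r Vgt0) -expr2 -Ef (le_trans (ler_norm _))//.
by rewrite (le_trans (bop_norm_le eta f))// ler_wpM2l.
Qed.

Definition bidual_limits (xi : bidual (ell2J R)) : nat -> R^o :=
  fun k => limn (bidual_entry xi k).

Lemma bidual_limits_summable xi : bidual_limits xi \in square_summable R^o.
Proof.
apply/square_summableP; exists `|xi| => n.
have H j : \sum_(0 <= k < n) bidual_entry xi k j ^+ 2 <= `|xi| ^+ 2.
  set c := fun k => bidual_entry xi k j.
  pose g k : dual_space (ell2J R) := bop_comp (james_coord j) (l2proj k).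
  pose f := \sum_(0 <= k < n) c k *: g k.
  pose V := Num.sqrt (\sum_(0 <= k < n) c k ^+ 2).
  have VE : V ^+ 2 = \sum_(0 <= k < n) c k ^+ 2.
    by rewrite sqr_sqrtr// sqr_sum_ge0.
  have Ef : xi f = V ^+ 2.
    by rewrite VE linear_sum; apply: eq_bigr => k _; rewrite linearZ expr2.
  have nf : `|f| <= V.
    apply: op_norm_ub => x x1; rewrite bop_sumE.
    rewrite (le_trans (norm_sumM_le _ c (fun k => g k x)))//.
    rewrite ler_piMr ?sqrtr_ge0// (le_trans _ x1)//.
    rewrite (le_trans _ (partial_norm_le x n))//.
    rewrite ler_wsqrtr// ler_sum// => k _.
    rewrite -[leLHS]real_normK ?num_real// ler_sqr ?nnegrE//.
    exact: james_coord_le.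
  rewrite -VE ler_sqr ?nnegrE ?sqrtr_ge0//.
  have [->//|V0] := eqVneq V 0.
  have Vgt0 : 0 < V by rewrite lt_neqAle eq_sym V0 sqrtr_ge0.
  rewrite -(ler_pM2r Vgt0) -expr2 -Ef (le_trans (ler_norm _))//.
  by rewrite (le_trans (bop_norm_le xi f))// ler_wpM2l.
rewrite -[leRHS]normr_id -sqrtr_sqr ler_wsqrtr//.
have cv : \sum_(0 <= k < n) bidual_entry xi k j ^+ 2 @[j --> \oo] -->
    \sum_(0 <= k < n) `|bidual_limits xi k| ^+ 2.
  apply: cvg_big => [|k _]; first exact: add_continuous.
  rewrite real_normK ?num_real//.
  by rewrite !expr2; apply: cvgM; exact: bidual_entry_cvg.
rewrite -(cvg_lim _ cv)//; apply: limr_le.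
  by apply/cvg_ex; eexists; exact: cv.
exact: nearW.
Qed.

Definition bidual_to_l2 (xi : bidual (ell2J R)) : ell2 R :=
  L2Sum (bidual_limits_summable xi).

Lemma bidual_to_l2_linear : linear bidual_to_l2.
Proof.
move=> a xi eta; apply/l2sumP => k.
have H : bidual_entry (a *: xi + eta) k =
    (fun j => a * bidual_entry xi k j + bidual_entry eta k j) by [].
rewrite /= /bidual_limits H; apply: cvg_lim => //.
apply: cvgD; last exact: bidual_entry_cvg.
by apply: cvgM; [exact: cvg_cst|exact: bidual_entry_cvg].
Qed.
HB.instance Definition _ :=
  GRing.isLinear.Build R (bidual (ell2J R)) (ell2 R) _ bidual_to_l2 bidual_to_l2_linear.

Lemma bidual_to_l2_embed (x : ell2J R) : bidual_to_l2 (bidual_embed x) = 0.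
Proof.
apply/l2sumP => k; apply: cvg_lim => //.
by have [] := (james_seqP _).1 (james_funP (x k)).
Qed.

Definition l2_ident (q : bidual_quot (ell2J R)) : ell2 R :=
  bidual_to_l2 (repr q).

Lemma l2_identE (xi : bidual (ell2J R)) :
  l2_ident (quot_pi (embed_image (ell2J R)) xi) = bidual_to_l2 xi.
Proof.
apply/eqP; rewrite -subr_eq0 -linearB /=.
have : repr (quot_pi (embed_image (ell2J R)) xi) - xi \in embed_image (ell2J R).
  by rewrite -quot_pi_eq quot_piK.
by move=> /embed_imageP[x ->]; apply/eqP; exact: bidual_to_l2_embed.
Qed.

Lemma l2_ident_linear : linear l2_ident.
Proof.
move=> a p q; rewrite -[p]quot_piK -[q]quot_piK -linearP !l2_identE.
exact: linearP.
Qed.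
HB.instance Definition _ :=
  GRing.isLinear.Build R (bidual_quot (ell2J R)) (ell2 R) _ l2_ident l2_ident_linear.

End BidualIdentification.

Section RegularOperators.
Context {R : realType}.

Definition unit_seq (j : nat) : nat -> R^o := fun k => (k == j)%:R.

Lemma unit_seq_summable j : unit_seq j \in square_summable R^o.
Proof.
apply/square_summableP; exists 1 => n; rewrite -[leRHS]sqrtr1 ler_wsqrtr//.
rewrite big_mkord; case: (ltnP j n) => jn.
  rewrite (bigD1 (Ordinal jn))//= big1 => [|i ij].
    by rewrite /unit_seq eqxx normr1 expr1n addr0.
  rewrite /unit_seq (_ : (_ == j) = false) ?normr0 ?expr0n//.
  by apply: contraNF ij => /eqP ij; apply/eqP/val_inj.
rewrite big1// => i _; rewrite /unit_seq (_ : (_ == j) = false) ?normr0 ?expr0n//.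
by apply/negbTE; rewrite neq_ltn (leq_trans (ltn_ord i) jn).
Qed.

Definition l2_unit (j : nat) : ell2 R := L2Sum (unit_seq_summable j).

Definition l2_entry (A : bop (ell2 R) (ell2 R)) (i j : nat) : R := A (l2_unit j) i.

(* A bounded operator on l2 is determined by its matrix, so there is at most one
   B with [is_modulus A B]; [op_modulus A] is the junk value 0 when A is not
   regular. *)
Definition is_modulus (A B : bop (ell2 R) (ell2 R)) :=
  forall i j, l2_entry B i j = `|l2_entry A i j|.

Definition Reg : set (bop (ell2 R) (ell2 R)) :=
  [set A | exists B, is_modulus A B].

Definition op_modulus (A : bop (ell2 R) (ell2 R)) : bop (ell2 R) (ell2 R) :=
  xget 0 [set B | is_modulus A B].

Definition reg_norm (A : bop (ell2 R) (ell2 R)) : R := `|op_modulus A|.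

End RegularOperators.

(* Main.v *)
Require Import Defs.
From HB Require Import structures.
From mathcomp Require Import all_boot all_order all_algebra.
From mathcomp Require Import boolp classical_sets functions.
From mathcomp Require Import reals topology normedtype sequences.
From mathcomp Require Import ring lra zify.

Set Implicit Arguments.
Unset Strict Implicit.
Unset Printing Implicit Defensive.

Import Order.TTheory GRing.Theory Num.Theory.
Import numFieldNormedType.Exports.
Local Open Scope classical_set_scope.
Local Open Scope ring_scope.

(* Write f_n for the n-th step 1_{j < n} in J and w (x) y for (w_k y)_k. The
   coordinate functionals of l2(J) have dense span in the dual (the basis is
   shrinking), so an element of the bidual whose scalar sequences all have limit 0
   lies in l2(J), and w |-> lim_n w (x) f_n is an isometric lifting of l2 to the
   bidual. Thus R(S) is the matrix a_ij = lim_r lim_n (S (e_j (x) f_n))_i(r), and by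
   ultrafilter limits it vanishes exactly for weakly compact S.

   A regular A is the image of A (x) id, whose norm is at most that of |A|.

   Conversely || |R(S)| || <= ||S||, because J contains almost isometric copies of
   l_oo^N: N zigzags h_t of amplitudes m^-(t+1), run at the speed that makes them
   1/2-Hoelder with constant 1, satisfy ||sum_t +-h_t|| <= 1 + N^2/m, while the path
   through the turning points of h_i gives h_i variation 1 and each other h_t at
   most 1/m. The vector x_j = |w_j| sum_t sgn(a_tj) h_t, spread over sparse indices
   on which S acts like the scalar matrix a, then has norm about ||w||, and row i of
   S x has norm about sum_j |a_ij| |w_j|.

   Finally, the operator carrying (2/3)^k times the 2^k x 2^k Walsh matrix on the
   k-th dyadic block is a norm limit of regular operators, as these blocks have norm
   (8/9)^(k/2), but it is not regular, as their moduli have norm (4/3)^k. *)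

(** * James space: quadratic variation and truncations *)

Section QuadraticVariation.
Context {R : realType}.
Implicit Types (x y : nat -> R) (a b : nat) (s t : seq nat).

(** The square of the variation along [a :: s]. Keeping the starting index apart makes concatenation
    additive and matches the shape of [path ltn a s]. *)
Fixpoint qvar x a s : R :=
  if s is b :: s' then (x b - x a) ^+ 2 + qvar x b s' else 0.

Lemma qvar_ge0 x a s : 0 <= qvar x a s.
Proof. by elim: s a => //= b s IH a; rewrite addr_ge0 ?sqr_ge0. Qed.

Lemma qvar_cat x a s t : qvar x a (s ++ t) = qvar x a s + qvar x (last a s) t.
Proof. by elim: s a => [|b s IH] a /=; rewrite ?add0r// IH addrA. Qed.

Lemma qvar_sum x a s : qvar x a s = \sum_(0 <= k < size s)
  `|x (nth 0%N (a :: s) k.+1) - x (nth 0%N (a :: s) k)| ^+ 2.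
Proof.
elim: s a => [|b s IH] a /=; first by rewrite big_nil.
by rewrite big_nat_recl//= real_normK ?num_real// IH.
Qed.

Lemma eq_qvar x y a s : {in a :: s, x =1 y} -> qvar x a s = qvar y a s.
Proof.
elim: s a => //= b s IH a xy; rewrite IH => [|c cs]; last by rewrite xy// inE cs orbT.
by rewrite !xy// !inE eqxx ?orbT.
Qed.

Lemma qvar_eq0 x a s : {in a :: s, x =1 (fun=> 0)} -> qvar x a s = 0.
Proof.
move=> x0; rewrite (@eq_qvar _ (fun=> 0))//.
by elim: s a {x0} => //= b s IH a; rewrite IH subrr expr0n addr0.
Qed.

Lemma james_variation_cons x a s : james_variation x (a :: s) = Num.sqrt (qvar x a s).
Proof. by rewrite qvar_sum. Qed.

Lemma qvar_triangle x y a s : Num.sqrt (qvar (x \+ y) a s) <=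
  Num.sqrt (qvar x a s) + Num.sqrt (qvar y a s).
Proof. by rewrite -!james_variation_cons; exact: james_variationD. Qed.

Lemma qvarZ c x a s : qvar (fun j => c * x j) a s = c ^+ 2 * qvar x a s.
Proof.
elim: s a => [|b s IH] a /=; first by rewrite mulr0.
by rewrite IH mulrDr -exprMn mulrBr.
Qed.

Lemma qvar_sum_le (I : Type) (r : seq I) (f : I -> nat -> R) a s :
  Num.sqrt (qvar (fun j => \sum_(i <- r) f i j) a s) <=
  \sum_(i <- r) Num.sqrt (qvar (f i) a s).
Proof.
elim: r => [|i r IH].
  by rewrite big_nil qvar_eq0 ?sqrtr0// => j _; rewrite big_nil.
rewrite big_cons (le_trans _ (lerD (lexx _) IH))// (le_trans _ (qvar_triangle _ _ _ _))//.
by rewrite (@eq_qvar _ (f i \+ fun j => \sum_(i <- r) f i j))// => j _; rewrite big_cons.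
Qed.

(** A sequence that is 1/2-Hoelder with respect to a clock [tau] has quadratic variation bounded by
    the elapsed time, as the increments of [tau] telescope along the path. *)
Lemma qvar_holder x (tau : nat -> R) K :
  (forall a b, (a < b)%N -> (x b - x a) ^+ 2 <= K * (tau b - tau a)) ->
  forall a s, path ltn a s -> qvar x a s <= K * (tau (last a s) - tau a).
Proof.
move=> H a s; elim: s a => [|b s IH] a /=; first by rewrite subrr mulr0.
move=> /andP[ab bs]; rewrite (le_trans (lerD (H _ _ ab) (IH _ bs)))// -mulrDr.
by rewrite addrC addrA subrK.
Qed.

(** Cutting a path at level [M] lets the variation of a truncation or of a sum of two blocks be
    estimated on each side, leaving a single increment that crosses [M]. *)
Lemma path_split a s M : path ltn a s -> (a < M)%N ->
  exists s1 s2, [/\ s = s1 ++ s2, path ltn a s1, all (fun i => i < M)%N (a :: s1) &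
    (if s2 is b :: s2' then [/\ (M <= b)%N, path ltn b s2', all (fun i => M <= i)%N s2' &
     (last a s1 < b)%N] else True)].
Proof.
elim: s a => [|b s IH] a /=; first by move=> _ aM; exists [::], [::]; rewrite /= aM.
move=> /andP[ab bs] aM; case: (ltnP b M) => bM.
  have [s1 [s2 [-> p1 a1 H]]] := IH _ bs bM.
  by exists (b :: s1), s2; split=> //; rewrite /= ?ab ?aM.
exists [::], (b :: s); split=> //; first by rewrite /= aM.
split=> //; elim: s b {ab IH} bs bM => //= c s IH b /andP[bc cs] bM.
by rewrite (leq_trans bM (ltnW bc)) (IH _ cs)// (leq_trans bM (ltnW bc)).
Qed.

Lemma path_all_ge a s : path ltn a s -> all (fun i => a <= i)%N (a :: s).
Proof.
move=> as_; rewrite /= leqnn /=; apply: sub_all (order_path_min ltn_trans as_).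
by move=> i /ltnW.
Qed.

End QuadraticVariation.

Section James.
Context {R : realType}.
Implicit Types (x y : james R) (a b : nat) (s t : seq nat).

Lemma qvar_le x a s : path ltn a s -> qvar x a s <= `|x| ^+ 2.
Proof.
case: s => [|b s] as_; first by rewrite /= sqr_ge0.
rewrite -[leLHS]sqr_sqrtr ?qvar_ge0// ler_sqr ?nnegrE ?sqrtr_ge0//.
rewrite -james_variation_cons; apply: james_variation_le.
by rewrite /increasing_indices /mkset.
Qed.

Lemma james_cvg0 x : x k @[k --> \oo] --> (0 : R^o).
Proof. by have /asboolP[] := james_funP x. Qed.

Lemma norm_james_le x (M : R) : 0 <= M ->
  (forall a s, path ltn a s -> qvar x a s <= M ^+ 2) -> `|x| <= M.
Proof.
move=> M0 xM; apply: james_norm_le => -[//|a s] /andP[_ as_].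
rewrite james_variation_cons -[leRHS]ger0_norm// -sqrtr_sqr ler_wsqrtr//.
exact: xM.
Qed.

Lemma james_of_qvar (x : nat -> R^o) (M : R) : 0 <= M -> x k @[k --> \oo] --> (0 : R^o) ->
  (forall a s, path ltn a s -> qvar x a s <= M ^+ 2) -> x \in james_seq.
Proof.
move=> M0 x0 xM; apply/james_seqP; split=> //; exists M => -[//|a s] /andP[_ as_].
rewrite james_variation_cons -[leRHS]ger0_norm// -sqrtr_sqr ler_wsqrtr//.
exact: xM.
Qed.

(** Append to the path an index tending to infinity: since [x] tends to 0, the square of the last
    increment tends to that of the last value. *)
Lemma qvar_end_le x a s : path ltn a s ->
  qvar x a s + x (last a s) ^+ 2 <= `|x| ^+ 2.
Proof.
move=> as_.
have cv : qvar x a s + (x k - x (last a s)) ^+ 2 @[k --> \oo] -->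
    qvar x a s + (0 - x (last a s)) ^+ 2.
  apply: cvgD; first exact: cvg_cst.
  have := james_cvg0 x; move: (last a s) => l x0.
  have h : (fun k => x k - x l : R^o) @ \oo --> (0 - x l : R^o).
    by apply: cvgB => //; exact: cvg_cst.
  rewrite expr2; under eq_cvg do rewrite expr2.
  exact: cvgM.
have <- : (0 - x (last a s)) ^+ 2 = x (last a s) ^+ 2 by rewrite sub0r sqrrN.
rewrite -(cvg_lim _ cv)//; apply: limr_le; first by apply/cvg_ex; eexists; exact: cv.
near=> k; have lk : (last a s < k)%N by near: k; exact: nbhs_infty_gt.
have := @qvar_le x a (s ++ [:: k]); rewrite qvar_cat /= addr0; apply.
by rewrite cat_path as_ /= lk.
Unshelve. all: by end_near. Qed.

(** Along a path the truncation follows [x] and then drops to 0 once; [qvar_end_le] already pays for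
    this drop, so truncating does not increase the norm. *)
Lemma jtrunc_subproof n x : (fun j => if (j < n)%N then x j else 0 : R^o) \in james_seq /\
  forall a s, path ltn a s ->
    qvar (fun j => if (j < n)%N then x j else 0 : R^o) a s <= `|x| ^+ 2.
Proof.
have H a s : path ltn a s ->
    qvar (fun j => if (j < n)%N then x j else 0 : R^o) a s <= `|x| ^+ 2.
  move=> as_; case: (ltnP a n) => an; last first.
    rewrite qvar_eq0 ?sqr_ge0// => j js; rewrite ltnNge (leq_trans an)//.
    by have /allP := path_all_ge as_; exact.
  have [s1 [s2 [-> p1 a1 H]]] := path_split as_ an.
  rewrite qvar_cat (@eq_qvar _ _ x a s1) => [|j js]; last by have /allP -> := a1.
  rewrite (le_trans _ (qvar_end_le x p1))// lerD2l.
  case: s2 H {as_} => [|b s2] /= => [_|[nb pb ab lb]]; first exact: sqr_ge0.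
  rewrite qvar_eq0 ?addr0 => [|j]; last first.
    by rewrite inE ltnNge => /orP[/eqP ->|js2]; rewrite ?nb//; have /allP -> := ab.
  have /allP/(_ _ (mem_last _ _)) -> := a1.
  by rewrite ltnNge nb /= sub0r sqrrN.
split=> //; apply: (@james_of_qvar _ `|x|) => //.
apply: cvg_near_cst; near=> k; rewrite ltnNge.
by suff -> : (n <= k)%N by []; near: k; exact: nbhs_infty_ge.
Unshelve. all: by end_near. Qed.

Definition jtrunc n x : james R := James (jtrunc_subproof n x).1.

Lemma jtruncE n x j : jtrunc n x j = if (j < n)%N then x j else 0.
Proof. by []. Qed.

Lemma jtrunc_le n x : `|jtrunc n x| <= `|x|.
Proof. by apply: norm_james_le => // a s /(jtrunc_subproof n x).2. Qed.

Lemma james_norm_approx x d : 0 < d ->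
  exists a s, path ltn a s /\ `|x| ^+ 2 - d < qvar x a s.
Proof.
move=> d0; apply: contrapT => H.
have xd b t : path ltn b t -> qvar x b t <= `|x| ^+ 2 - d.
  by move=> bt; rewrite leNgt; apply/negP => ?; apply: H; exists b, t.
have Hd : 0 <= `|x| ^+ 2 - d by apply: (xd 0%N [::]).
have : `|x| <= Num.sqrt (`|x| ^+ 2 - d).
  by apply: norm_james_le; [exact: sqrtr_ge0|rewrite sqr_sqrtr].
by rewrite -(ler_sqr) ?nnegrE ?sqrtr_ge0// sqr_sqrtr//; lra.
Qed.

(** A path that nearly attains the norm leaves little variation for the indices after it, and the
    truncation error lives there. *)
Lemma jtrunc_cvg x : `|x - jtrunc n x| @[n --> \oo] --> (0 : R).
Proof.
apply/cvgrPdist_lt => e e0.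
pose d := e ^+ 2 / 8.
have d0 : 0 < d by rewrite divr_gt0 ?exprn_gt0.
have [a [s [as_ xas]]] := james_norm_approx x d0.
near=> n; rewrite sub0r normrN normr_id.
have ln : (last a s < n)%N by near: n; exact: nbhs_infty_gt.
suff : `|x - jtrunc n x| <= e / 2 by move=> /le_lt_trans; apply; lra.
(* Both bounds prolong the nearly norming path, by [b] and then to infinity, or by [b :: t]. The
   crossing increment and the rest cost [d] each, and [2 * d] is [(e / 2) ^+ 2]. *)
have beyond b t : (n <= b)%N -> path ltn b t -> (x b) ^+ 2 <= d /\ qvar x b t <= d.
  move=> nb bt; have lb : (last a s < b)%N by exact: leq_trans nb.
  split.
    have := @qvar_end_le x a (s ++ [:: b]).
    rewrite cat_path as_ /= lb last_cat /= qvar_cat /= => /(_ isT).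
    have := sqr_ge0 (x b - x (last a s)); lra.
  have := @qvar_le x a (s ++ b :: t).
  rewrite cat_path as_ /= lb bt qvar_cat /= => /(_ isT).
  have := sqr_ge0 (x b - x (last a s)); lra.
have yE : x - jtrunc n x = (fun j => if (j < n)%N then 0 else x j) :> (nat -> R).
  apply/funext => j /=; rewrite -[LHS]/(x j - jtrunc n x j) jtruncE.
  by case: ifP; rewrite ?subrr ?subr0.
apply: norm_james_le => [|b t bt]; first by lra.
rewrite yE; have -> : (e / 2) ^+ 2 = 2 * d by rewrite /d; field.
case: (leqP n b) => nb.
  rewrite (@eq_qvar _ _ x) => [|j jt]; first by have [_ ?] := beyond _ _ nb bt; lra.
  by rewrite ltnNge (leq_trans nb)//; have /allP := path_all_ge bt; exact.
have [t1 [t2 [-> p1 a1 H]]] := path_split bt nb.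
rewrite qvar_cat qvar_eq0 ?add0r => [|j js]; last by have /allP -> := a1.
case: t2 H {bt} => [|c t2] /= => [_|[nc pc ac lc]]; first by lra.
rewrite (@eq_qvar _ _ x) => [|j]; last first.
  by rewrite inE ltnNge => /orP[/eqP ->|js2]; rewrite ?nc//; have /allP -> := ac.
have /allP/(_ _ (mem_last _ _)) -> := a1.
rewrite ltnNge nc /= subr0; have [] := beyond _ _ nc pc; lra.
Unshelve. all: by end_near. Qed.

(** Only the increment crossing [M] involves both [u] and [v]; its square is at most twice the sum
    of the squares of the two values. The first of these is absorbed by [qvar_end_le] for [u]. *)
Lemma james_block_le (u v : james R) M : (forall j, (M <= j)%N -> u j = 0) ->
  (forall j, (j < M)%N -> v j = 0) ->
  `|u + v| ^+ 2 <= 2 * `|u| ^+ 2 + 3 / 2 * `|v| ^+ 2.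
Proof.
move=> u0 v0; set C := leRHS.
have [nu nv] := (sqr_ge0 `|u|, sqr_ge0 `|v|).
have C0 : 0 <= C by rewrite /C; lra.
suff H (w : nat -> R) a s : (forall j, w j = u j + v j) ->
    path ltn a s -> qvar w a s <= C.
  have : `|u + v| <= Num.sqrt C.
    apply: norm_james_le => [|a s]; rewrite ?sqrtr_ge0// sqr_sqrtr//.
    exact: H.
  by move=> h; rewrite -[leRHS]sqr_sqrtr// ler_sqr ?nnegrE ?sqrtr_ge0.
move=> uvE as_.
case: (leqP M a) => aM.
  rewrite (@eq_qvar _ w v) => [|j jt].
    by have := qvar_le v as_; rewrite /C; lra.
  rewrite uvE u0 ?add0r// (leq_trans aM)//.
  by have /allP := path_all_ge as_; exact.
have [t1 [t2 [-> p1 a1 H]]] := path_split as_ aM.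
rewrite qvar_cat (@eq_qvar _ w u) => [|j jt]; last first.
  by rewrite uvE v0 ?addr0//; have /allP/(_ _ jt) := a1.
have lM : (last a t1 < M)%N by have /allP/(_ _ (mem_last _ _)) := a1.
have hu := qvar_end_le u p1; have := qvar_ge0 u a t1.
case: t2 H {as_} => [|c t2] /= => [_|[nc pc ac lc]].
  by move: hu (sqr_ge0 (u (last a t1))); rewrite /C; lra.
rewrite (@eq_qvar _ w v) => [|j]; last first.
  rewrite inE uvE => /orP[/eqP ->|js2]; rewrite u0 ?add0r//.
  by have /allP -> := ac.
rewrite !uvE (v0 _ lM) (u0 _ nc) add0r addr0.
(* As [v] vanishes at [M.-1], starting there adds the square of [v c] to the variation ([pM]), and
   going up to [c] and back to 0 at infinity gives [2 * v c ^+ 2 <= |v| ^+ 2] ([pMc]). Together they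
   yield the factor 3/2. *)
have pM : path ltn M.-1 (c :: t2) by rewrite /= pc andbT prednK// (leq_ltn_trans _ lM).
have pMc : path ltn M.-1 [:: c] by rewrite /= andbT prednK// (leq_ltn_trans _ lM).
have vM : v M.-1 = 0 by rewrite v0// prednK// (leq_ltn_trans _ lM).
have := qvar_le v pM; have := qvar_end_le v pMc.
rewrite /= !vM subr0 addr0 /C.
move: (u _) (v c) hu => p q; have := sqr_ge0 (p + q); nra.
Qed.

End James.

(** * The l2-sum and its shrinking basis *)

Section BopEvaluation.
Context {R : realType}.
Implicit Types E F : normedModType R.

Lemma bopD E F (S : bop E F) x y : S (x + y) = S x + S y.
Proof. exact: linearD. Qed.

Lemma bopB E F (S : bop E F) x y : S (x - y) = S x - S y.
Proof. exact: linearB. Qed.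

Lemma bopZ E F (S : bop E F) a x : S (a *: x) = a *: S x.
Proof. exact: linearZ. Qed.

Lemma dualZ E (f : dual_space E) (a : R) x : f (a *: x) = a * f x.
Proof. exact: linearZ. Qed.

Lemma bop_sum E F (S : bop E F) (I : Type) (r : seq I) (x : I -> E) :
  S (\sum_(i <- r) x i) = \sum_(i <- r) S (x i).
Proof. exact: linear_sum. Qed.

Lemma bop_addE E F (S T : bop E F) x : (S + T) x = S x + T x.
Proof. by []. Qed.

Lemma bop_subE E F (S T : bop E F) x : (S - T) x = S x - T x.
Proof. by []. Qed.

Lemma bop_scaleE E F a (S : bop E F) x : (a *: S) x = a *: S x.
Proof. by []. Qed.

Lemma bop_mulE E (S T : bop E E) x : (S * T) x = S (T x).
Proof. by []. Qed.

End BopEvaluation.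

Section SquareSummable.
Context {R : realType}.

Lemma cvg_sum_seq (T I : Type) (F : set_system T) (FF : Filter F) (r : seq I)
    (f : I -> T -> R) (l : I -> R) : (forall i, f i x @[x --> F] --> l i) ->
  \sum_(i <- r) f i x @[x --> F] --> \sum_(i <- r) l i.
Proof.
move=> fl; elim: r => [|i r IH].
  by rewrite big_nil; under eq_cvg do rewrite big_nil; exact: cvg_cst.
by rewrite big_cons; under eq_cvg do rewrite big_cons; exact: cvgD.
Qed.

Lemma cvg_lincomb (T : Type) (F : set_system T) (FF : Filter F) (a : R)
    (u v : T -> R) (l m : R) : u x @[x --> F] --> l -> v x @[x --> F] --> m ->
  a * u x + v x @[x --> F] --> a * l + m.
Proof. by move=> ul vm; apply: cvgD => //; apply: cvgM => //; exact: cvg_cst. Qed.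

Lemma partial_norm_dom (E F : normedModType R) (x : nat -> E) (y : nat -> F) (C : R) n :
  0 <= C -> (forall k, `|y k| <= C * `|x k|) ->
  partial_norm y n <= C * partial_norm x n.
Proof.
move=> C0 H; rewrite /partial_norm -[C]ger0_norm// -sqrt_sumZ.
by apply: ler_sqrt_sum => k; rewrite normr_ge0 H.
Qed.

Lemma l2_dom_summable (E F : normedModType R) (x : l2sum E) (y : nat -> F) (C : R) :
  0 <= C -> (forall k, `|y k| <= C * `|x k|) -> y \in square_summable F.
Proof.
move=> C0 H; apply/square_summableP; exists (C * `|x|) => n.
by rewrite (le_trans (partial_norm_dom _ C0 H))// ler_wpM2l// partial_norm_le.
Qed.

Lemma l2_dom_le (E F : normedModType R) (x : l2sum E) (y : l2sum F) (C : R) :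
  0 <= C -> (forall k, `|y k| <= C * `|x k|) -> `|y| <= C * `|x|.
Proof.
move=> C0 H; apply: l2_norm_le => n.
by rewrite (le_trans (partial_norm_dom _ C0 H))// ler_wpM2l// partial_norm_le.
Qed.

Lemma l2_coord_norm_le (E : normedModType R) (x : l2sum E) k : `|x k| <= `|x|.
Proof. exact: l2_coord_le. Qed.

Lemma partial_norm_sqr (E : normedModType R) (x : nat -> E) n :
  partial_norm x n ^+ 2 = \sum_(0 <= k < n) `|x k| ^+ 2.
Proof. by rewrite sqr_sqrtr// sqr_sum_ge0. Qed.

Lemma l2_sum_le (E : normedModType R) (x : l2sum E) n :
  \sum_(0 <= k < n) `|x k| ^+ 2 <= `|x| ^+ 2.
Proof.
rewrite -partial_norm_sqr ler_sqr ?nnegrE ?sqrtr_ge0//; exact: partial_norm_le.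
Qed.

Lemma l2_norm_leP (E : normedModType R) (x : l2sum E) (M : R) : 0 <= M ->
  (forall n, \sum_(0 <= k < n) `|x k| ^+ 2 <= M ^+ 2) -> `|x| <= M.
Proof.
move=> M0 H; apply: l2_norm_le => n.
by rewrite -ler_sqr ?nnegrE ?sqrtr_ge0// partial_norm_sqr.
Qed.

Lemma l2_sqnorm_leP (E : normedModType R) (x : l2sum E) (M : R) : 0 <= M ->
  (forall n, \sum_(0 <= k < n) `|x k| ^+ 2 <= M) -> `|x| ^+ 2 <= M.
Proof.
move=> M0 H; rewrite -[leRHS]sqr_sqrtr// ler_sqr ?nnegrE ?sqrtr_ge0//.
by apply: l2_norm_leP; rewrite ?sqrtr_ge0// sqr_sqrtr.
Qed.

Lemma l2_tail (E : normedModType R) (x : l2sum E) (e : R) : 0 < e ->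
  exists M, forall n, (M <= n)%N -> \sum_(M <= k < n) `|x k| ^+ 2 <= e.
Proof.
move=> e0; pose u := series (fun k => `|x k| ^+ 2 : R).
have cu : cvgn u by apply/asboolP/l2sum_seqP.
have ndu : nondecreasing_seq u by apply: nondecreasing_series => k _ _; rewrite sqr_ge0.
have /cvgrPdist_lt/(_ e e0)[M _ HM] := cu.
exists M => n Mn; have := HM M (leqnn M).
have un : u n <= limn u by exact: nondecreasing_cvgn_le.
have -> : \sum_(M <= k < n) `|x k| ^+ 2 = u n - u M.
  by rewrite /u sub_series_geq.
have := ler_norm (limn u - u M); rewrite -/u; lra.
Qed.

(** Dominated convergence: the tail of [x] controls the tails of all [y n] at once, and the finitely
    many other coordinates tend to 0. *)
Lemma l2_dominated_cvg (E F : normedModType R) (x : l2sum E) (y : nat -> l2sum F)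
    (C : R) : 0 <= C -> (forall n k, `|y n k| <= C * `|x k|) ->
  (forall k, `|y n k| @[n --> \oo] --> (0 : R)) ->
  `|y n| @[n --> \oo] --> (0 : R).
Proof.
move=> C0 yC y0; apply/cvgrPdist_lt => e e0.
(* Chosen so that the two contributions [d] and [C ^+ 2 * d] add up to [(e / 2) ^+ 2]. *)
pose d := e ^+ 2 / (4 * (1 + C ^+ 2)).
have C1 : 0 < 1 + C ^+ 2 by rewrite ltr_pwDl ?sqr_ge0.
have d0 : 0 < d by rewrite divr_gt0 ?exprn_gt0// mulr_gt0.
have [M xM] := l2_tail x d0.
have fin : (\sum_(0 <= k < M) `|y n k| ^+ 2) @[n --> \oo] -->
    \sum_(0 <= k < M) (0 : R).
  apply: cvg_sum_seq => k.
  under eq_cvg do rewrite expr2.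
  have h := cvgM (y0 k) (y0 k); rewrite mulr0 in h; exact: h.
rewrite big1_eq in fin.
near=> n; rewrite sub0r normrN normr_id.
suff : `|y n| <= e / 2 by move=> /le_lt_trans; apply; lra.
apply: l2_norm_leP => [|m]; first lra.
have -> : (e / 2) ^+ 2 = d + C ^+ 2 * d by rewrite /d; field; rewrite gt_eqF.
apply: (@le_trans _ _ (\sum_(0 <= k < maxn m M) `|y n k| ^+ 2)).
  rewrite [leRHS](big_cat_nat (n := m))//= ?leq_maxl// lerDl.
  by apply: sumr_ge0 => k _; rewrite sqr_ge0.
rewrite [leLHS](big_cat_nat (n := M))//= ?leq_maxr// lerD//.
  rewrite (le_trans (ler_norm _))// -normrN -sub0r ltW//.
  by near: n; move/cvgrPdist_lt: fin => /(_ _ d0).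
apply: (@le_trans _ _ (\sum_(M <= k < maxn m M) C ^+ 2 * `|x k| ^+ 2)).
  by apply: ler_sum => k _; rewrite -exprMn ler_sqr ?nnegrE ?mulr_ge0.
by rewrite -mulr_sumr ler_wpM2l ?sqr_ge0// xM// leq_maxr.
Unshelve. all: by end_near. Qed.

Lemma l2sum_sumE (E : normedModType R) (I : Type) (r : seq I) (x : I -> l2sum E) k :
  (\sum_(i <- r) x i) k = \sum_(i <- r) x i k.
Proof. exact: (linear_sum (l2proj k)). Qed.

Lemma l2sumDE (E : normedModType R) (x y : l2sum E) k : (x + y) k = x k + y k.
Proof. by []. Qed.

Lemma l2sumBE (E : normedModType R) (x y : l2sum E) k : (x - y) k = x k - y k.
Proof. by []. Qed.

Lemma jamesDE (x y : james R) k : (x + y) k = x k + y k.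
Proof. by []. Qed.

Lemma jamesBE (x y : james R) k : (x - y) k = x k - y k.
Proof. by []. Qed.

Lemma l2sumZE (E : normedModType R) a (x : l2sum E) k : (a *: x) k = a *: x k.
Proof. by []. Qed.

Lemma jamesZE a (x : james R) k : (a *: x) k = a * x k.
Proof. by []. Qed.

Lemma james_sumE (I : Type) (r : seq I) (x : I -> james R) k :
  (\sum_(i <- r) x i) k = \sum_(i <- r) x i k.
Proof. exact: (linear_sum (james_coord k)). Qed.

End SquareSummable.

Section L2James.
Context {R : realType}.

(* The contradiction closing [l2J_shrinking]: [2 * 97 / 103 > sqrt (2 + 3 / 2)]. *)
Let shrinking_arith (L a b u v : R) : 0 < L -> 2 * (97 / 100 * L) < b ->
  b <= 103 / 100 * L * a -> a ^+ 2 <= 2 * u ^+ 2 + 3 / 2 * v ^+ 2 ->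
  0 <= u -> u <= 1 -> 0 <= v -> v <= 1 -> False.
Proof.
move=> Lpos h1 h2 h3 u0 u1 v0 v1.
have h6 : u ^+ 2 <= 1 by rewrite expr_le1.
have h7 : v ^+ 2 <= 1 by rewrite expr_le1.
have h5 : 194 < 103 * a by rewrite -(ltr_pM2r Lpos); lra.
have : (194 / 103) ^+ 2 < a ^+ 2 by rewrite ltr_sqr ?nnegrE; lra.
lra.
Qed.

Implicit Types (x y : ell2J R) (N M : nat).

Lemma l2Jtrunc_summable N x :
  (fun k => if (k < N)%N then jtrunc N (x k) else 0) \in square_summable (james R).
Proof.
apply: (@l2_dom_summable R _ _ x _ 1) => // k; rewrite mul1r.
by case: ifP => _; [exact: jtrunc_le|rewrite normr0].
Qed.

Definition l2Jtrunc N x : ell2J R := L2Sum (l2Jtrunc_summable N x).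

Definition l2Jtail N x := forall k j, (k < N)%N -> (j < N)%N -> x k j = 0.

Lemma l2Jtrunc_le N x : `|l2Jtrunc N x| <= `|x|.
Proof.
rewrite -[leRHS]mul1r; apply: l2_dom_le => // k; rewrite mul1r /=.
by case: ifP => _; [exact: jtrunc_le|rewrite normr0].
Qed.

Lemma l2Jtrunc_tail N x : l2Jtail N (x - l2Jtrunc N x).
Proof.
move=> k j kN jN.
by rewrite l2sumBE jamesBE /= kN jtruncE jN subrr.
Qed.

Lemma l2Jtail_trunc N M x : l2Jtail N x -> l2Jtail N (l2Jtrunc M x).
Proof. by move=> xN k j kN jN /=; case: ifP => //; rewrite jtruncE xN// if_same. Qed.

Lemma l2Jtrunc_cvg x : `|x - l2Jtrunc n x| @[n --> \oo] --> (0 : R).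
Proof.
apply: (@l2_dominated_cvg _ _ _ x _ 2) => // [n k|k].
  rewrite l2sumBE /=.
  have /= := jtrunc_le n (x k); have := ler_normB (x k) (jtrunc n (x k)).
  by case: ifP => _; rewrite ?subr0; have := normr_ge0 (x k); lra.
apply: cvg_trans (jtrunc_cvg (x k)); apply: near_eq_cvg; near=> n.
rewrite l2sumBE /=.
by have -> : (k < n)%N by near: n; exact: nbhs_infty_gt.
Unshelve. all: by end_near. Qed.

Lemma l2J_block_le M x y : l2Jtail M y ->
  `|l2Jtrunc M x + y| ^+ 2 <= 2 * `|l2Jtrunc M x| ^+ 2 + 3 / 2 * `|y| ^+ 2.
Proof.
move=> yM; set u := l2Jtrunc M x.
apply: l2_sqnorm_leP => [|n].
  by rewrite addr_ge0// mulr_ge0// ?sqr_ge0// divr_ge0.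
apply: (@le_trans _ _ (\sum_(0 <= k < n) (2 * `|u k| ^+ 2 + 3 / 2 * `|y k| ^+ 2))).
  apply: ler_sum => k _; rewrite l2sumDE.
  case: (ltnP k M) => kM.
    apply: (@james_block_le _ _ _ M) => j jM; last exact: yM.
    by rewrite /= kM jtruncE ltnNge jM.
  have -> : u k = 0 by rewrite /= ltnNge kM.
  by rewrite add0r normr0; have := sqr_ge0 `|y k|; nra.
by rewrite big_split -!mulr_sumr lerD// ler_wpM2l ?l2_sum_le//; lra.
Qed.

(* If [phi] has norm at least L > 0 on every tail, it is nearly L on two unit
   vectors u and v of a tail with v beyond the support of u, hence nearly 2 L on
   u + v, whose norm is at most sqrt (7 / 2) < 2. *)
Lemma l2J_shrinking (phi : dual_space (ell2J R)) (e : R) : 0 < e ->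
  exists N, forall x, l2Jtail N x -> `|phi x| <= e * `|x|.
Proof.
move=> e0.
pose C := [set c : R | 0 <= c /\ exists N, forall x, l2Jtail N x -> `|phi x| <= c * `|x|].
have C0 : C !=set0.
  by exists `|phi|; split=> //; exists 0%N => x _; exact: bop_norm_le.
have lbC : lbound C 0 by move=> c [].
(* The limit of the norms of [phi] on the tails, which decrease with [N]. *)
pose L := inf C.
have L0 : 0 <= L by exact: lb_le_inf.
have CL c : L < c -> exists N, forall x, l2Jtail N x -> `|phi x| <= c * `|x|.
  move=> Lc; have [c' [c'0 [N HN]] c'c] := inf_lt C0 Lc.
  by exists N => x /HN /le_trans; apply; rewrite ler_wpM2r// ltW.
have [L00|Lpos] := eqVneq L 0; first by apply: CL; rewrite L00.
exfalso.
have {Lpos} Lpos : 0 < L by rewrite lt_neqAle eq_sym Lpos.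
have [N HN] := CL (103 / 100 * L) ltac:(lra).
pose d := 97 / 100 * L.
have dL : d < L by rewrite /d; lra.
have dpos : 0 < d by rewrite /d; lra.
(* Since [d < L], the constant [d] bounds [phi] on no tail; normalising a witness and fixing its
   sign gives the vector. *)
have pick M : exists x, [/\ l2Jtail M x, `|x| <= 1 & d < phi x].
  apply: contrapT => H.
  suff : C d by move=> Cd; have := ge_inf (ex_intro _ 0 lbC) Cd; rewrite -/L leNgt dL.
  split; first exact: ltW.
  exists M => x xM.
  have [->|x0] := eqVneq x 0; first by rewrite linear0 !normr0 mulr0.
  have nx : 0 < `|x| by rewrite normr_gt0.
  rewrite leNgt; apply/negP => dx; apply: H.
  pose s := Num.sg (phi x).
  exists ((s / `|x|) *: x); split.
  - move=> k j kM jM; rewrite l2sumZE jamesZE.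
    by rewrite (xM _ _ kM jM) mulr0.
  - rewrite normrZ normrM normfV normr_id mulfVK ?gt_eqF// normr_sg.
    by case: (_ != _).
  - have -> : phi ((s / `|x|) *: x) = s / `|x| * phi x by exact: linearZ.
    rewrite mulrAC ltr_pdivlMr//.
    by rewrite -normrEsg.
have [u [uN u1 du]] := pick N.
(* Cutting [u] at a large [M] keeps [phi] above [d] and leaves room for [v] beyond the cut. *)
have [M [NM dM]] : exists M, (N <= M)%N /\ d < phi (l2Jtrunc M u).
  have /cvgrPdist_lt := l2Jtrunc_cvg u.
  pose r := (phi u - d) / (`|phi| + 1).
  have r0 : 0 < r by rewrite divr_gt0 ?subr_gt0// ltr_wpDl.
  move=> /(_ r r0)[M _ HM]; exists (maxn N M); split; first exact: leq_maxl.
  set M' := maxn N M; have := HM M' (leq_maxr _ _).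
  rewrite sub0r normrN normr_id => hu.
  suff : phi u - phi (l2Jtrunc M' u) < phi u - d by rewrite ltrD2l ltrN2.
  rewrite -linearB (le_lt_trans (ler_norm _))// (le_lt_trans (bop_norm_le _ _))//.
  apply: (@le_lt_trans _ _ ((`|phi| + 1) * `|u - l2Jtrunc M' u|)).
    by rewrite ler_wpM2r// lerDl.
  by rewrite mulrC -ltr_pdivlMr// ltr_wpDl.
have [v [vM v1 dv]] := pick M.
have h3 := l2J_block_le u vM.
have nu := le_trans (l2Jtrunc_le M u) u1.
have t : l2Jtail N (l2Jtrunc M u + v).
  move=> k j kN jN; rewrite l2sumDE jamesDE.
  by rewrite (l2Jtail_trunc _ uN)// vM ?addr0// (leq_trans _ NM).
have := HN _ t; rewrite linearD.
have := ler_norm (phi (l2Jtrunc M u) + phi v).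
move=> h1 h2; apply: (shrinking_arith Lpos _ (le_trans h1 h2) h3 _ nu _ v1).
- by rewrite mulr_natl mulr2n ltrD.
- exact: normr_ge0.
- exact: normr_ge0.
Qed.

End L2James.

(** * The bidual of l2(J) *)

Section Lift.
Context {R : realType}.
Implicit Types (w : ell2 R) (y : james R) (x : ell2J R).

(** An increasing path meets the jump at most once. The clock for [qvar_holder] is the indicator of
    [n <= j]. *)
Lemma jstep_subproof n : (fun j => (j < n)%:R : R^o) \in james_seq /\
  forall a s, path ltn a s -> qvar (fun j => (j < n)%:R : R) a s <= 1.
Proof.
have H a s : path ltn a s -> qvar (fun j => (j < n)%:R : R) a s <= 1.
  move=> as_; apply: le_trans (@qvar_holder _ _ (fun j => (n <= j)%:R) 1 _ a s as_) _ => [b c bc|].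
    case: (ltnP b n) => bn; case: (ltnP c n) => cn; rewrite /= ?subrr ?expr0n ?mulr0//.
      by rewrite subr0 sub0r sqrrN expr1n mulr1.
    by have := ltn_trans (leq_trans cn bn) bc; rewrite ltnn.
  by rewrite mul1r; case: (n <= _)%N; case: (n <= _)%N => /=; lra.
split=> //; apply: (@james_of_qvar _ _ 1) => //; last by rewrite expr1n.
apply: cvg_near_cst; near=> k; rewrite ltnNge.
by suff -> : (n <= k)%N by []; near: k; exact: nbhs_infty_ge.
Unshelve. all: by end_near. Qed.

Definition jstep n : james R := James (jstep_subproof n).1.

Lemma jstepE n j : jstep n j = (j < n)%:R.
Proof. by []. Qed.

Lemma jstep_le1 n : `|jstep n| <= 1.
Proof. by apply: norm_james_le => // a s; rewrite expr1n; exact: (jstep_subproof n).2. Qed.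

Lemma l2tensor_dom w y k : `|w k *: y| <= `|y| * `|w k|.
Proof. by rewrite normrZ mulrC. Qed.

Definition l2tensor w y : ell2J R := L2Sum (l2_dom_summable (normr_ge0 y) (l2tensor_dom w y)).

Lemma l2tensorE w y k j : l2tensor w y k j = w k * y j.
Proof. by []. Qed.

Lemma l2tensor_le w y : `|l2tensor w y| <= `|w| * `|y|.
Proof. by rewrite mulrC; apply: l2_dom_le => // k; exact: l2tensor_dom. Qed.

Lemma l2tensorPl a w w' y : l2tensor (a *: w + w') y = a *: l2tensor w y + l2tensor w' y.
Proof. by apply/l2sumP => k; rewrite l2sumDE l2sumZE /= scalerDl scalerA. Qed.

Lemma l2tensorBr w y y' : l2tensor w (y - y') = l2tensor w y - l2tensor w y'.
Proof. by apply/l2sumP => k; rewrite l2sumBE /= scalerBr. Qed.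

(** Two late steps agree on a large initial segment, so the difference of the tensors lies in a
    tail, where [l2J_shrinking] makes [phi] small. The sequence is therefore Cauchy. *)
Lemma l2lift_is_cvg w (phi : dual_space (ell2J R)) :
  cvgn (fun n => phi (l2tensor w (jstep n)) : R^o).
Proof.
apply/cauchy_cvgP/cauchyP => e e0.
pose d := e / (2 * (`|w| + 1)).
have w1 : 0 < `|w| + 1 by rewrite ltr_wpDl.
have d0 : 0 < d by rewrite divr_gt0// mulr_gt0.
have [N HN] := l2J_shrinking phi d0.
exists (phi (l2tensor w (jstep N))).
suff : \forall n \near \oo,
  ball (phi (l2tensor w (jstep N)) : R^o) e (phi (l2tensor w (jstep n))) by [].
near=> n; have Nn : (N <= n)%N by near: n; exact: nbhs_infty_ge.
rewrite -ball_normE /= -linearB -l2tensorBr.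
apply: le_lt_trans (HN _ _) _.
  move=> k j _ jN; rewrite l2tensorE jamesBE /= jN (leq_trans jN Nn).
  by rewrite subrr mulr0.
apply: (@le_lt_trans _ _ (d * (`|w| * 2))).
  rewrite ler_wpM2l ?(ltW d0)// (le_trans (l2tensor_le _ _))// ler_wpM2l//.
  rewrite (le_trans (ler_normB _ _))//.
  by have := jstep_le1 N; have := jstep_le1 n; lra.
have -> : e = d * ((`|w| + 1) * 2) by rewrite /d; field; rewrite gt_eqF.
by rewrite ltr_pM2l// ltr_pM2r// ltrDl.
Unshelve. all: by end_near. Qed.

Let l2lift_linear w :
  linear ((fun phi => limn (fun n => phi (l2tensor w (jstep n)) : R^o))
    : dual_space (ell2J R) -> R^o).
Proof.
move=> a phi psi; apply: cvg_lim => //.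
exact: (cvg_lincomb (a := a) _ (@l2lift_is_cvg w phi) (@l2lift_is_cvg w psi)).
Qed.

Let l2lift_bound w (phi : dual_space (ell2J R)) :
  `|limn (fun n => phi (l2tensor w (jstep n)) : R^o)| <= `|w| * `|phi|.
Proof.
have cv : `|phi (l2tensor w (jstep n)) : R^o| @[n --> \oo] -->
    `|limn (fun n => phi (l2tensor w (jstep n)) : R^o)|.
  by apply: cvg_norm; exact: l2lift_is_cvg.
rewrite -(cvg_lim _ cv)//; apply: limr_le; first by apply/cvg_ex; eexists; exact: cv.
near=> n; rewrite (le_trans (bop_norm_le _ _))// mulrC ler_wpM2r//.
rewrite (le_trans (l2tensor_le _ _))// -[leRHS]mulr1 ler_wpM2l//.
exact: jstep_le1.
Unshelve. all: by end_near. Qed.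

(* The element [w (x) (1, 1, ...)] of the bidual. *)
Definition l2lift w : bidual (ell2J R) := mkbop (l2lift_linear w) (l2lift_bound w).

Lemma l2lift_cvg w (phi : dual_space (ell2J R)) :
  phi (l2tensor w (jstep n)) @[n --> \oo] --> (l2lift w phi : R^o).
Proof. exact: l2lift_is_cvg. Qed.

Lemma l2lift_le w : `|l2lift w| <= `|w|.
Proof.
apply: op_norm_ub => phi phi1; rewrite (le_trans (l2lift_bound w phi))//.
by rewrite ler_piMr.
Qed.

Lemma l2lift_linear_arg : linear l2lift.
Proof.
move=> a w w'; apply/bopP => phi; apply: cvg_lim => //.
under eq_cvg do rewrite l2tensorPl linearD linearZ.
exact: (cvg_lincomb (a := a) _ (@l2lift_is_cvg w phi) (@l2lift_is_cvg w' phi)).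
Qed.

Lemma bidual_entry_lift w k j : bidual_entry (l2lift w) k j = w k.
Proof.
apply: cvg_lim => //; apply: cvg_near_cst; near=> n.
rewrite -[LHS]/(l2tensor w (jstep n) k j) l2tensorE jstepE.
by rewrite (_ : (j < n)%N) ?mulr1//; near: n; exact: nbhs_infty_gt.
Unshelve. all: by end_near. Qed.

Lemma bidual_to_l2_lift w : bidual_to_l2 (l2lift w) = w.
Proof.
apply/l2sumP => k; apply: cvg_lim => //; apply: cvg_near_cst; near=> j.
exact: bidual_entry_lift.
Unshelve. all: by end_near. Qed.

End Lift.

Section Kernel.
Context {R : realType}.
Implicit Types (x : ell2J R) (xi : bidual (ell2J R)).

Definition l2J_coord k j : dual_space (ell2J R) := bop_comp (james_coord j) (l2proj k).

Lemma l2J_coordE k j x : l2J_coord k j x = x k j.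
Proof. by []. Qed.

(** Test [xi] on the combination of the [j]-th coordinates of the first [n] components with the
    limits as coefficients, whose norm is at most [V], and let [j] tend to infinity. *)
Lemma bidual_to_l2_le xi : `|bidual_to_l2 xi| <= `|xi|.
Proof.
apply: l2_norm_le => n; set w := bidual_to_l2 xi; set V := partial_norm _ _.
have V0 : 0 <= V by exact: sqrtr_ge0.
have VE : V ^+ 2 = \sum_(0 <= k < n) w k * w k.
  rewrite partial_norm_sqr; apply: eq_bigr => k _.
  by rewrite real_normK ?num_real// expr2.
pose f j : dual_space (ell2J R) := \sum_(0 <= k < n) (w k : R) *: l2J_coord k j.
have nf j : `|f j| <= V.
  apply: op_norm_ub => x x1; rewrite bop_sumE.
  under eq_bigr do rewrite bop_scaleE l2J_coordE.
  rewrite (le_trans (norm_sumM_le _ _ _))//.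
  have -> : Num.sqrt (\sum_(0 <= k < n) w k ^+ 2) = V.
    by congr Num.sqrt; apply: eq_bigr => k _; rewrite real_normK ?num_real.
  rewrite ler_piMr// (le_trans _ x1)// (le_trans _ (partial_norm_le x n))//.
  rewrite ler_wsqrtr// ler_sum// => k _.
  rewrite -[leLHS]real_normK ?num_real// ler_sqr ?nnegrE//.
  exact: james_coord_le.
have cv : \sum_(0 <= k < n) w k * bidual_entry xi k j @[j --> \oo] --> V ^+ 2.
  rewrite VE; apply: cvg_sum_seq => k.
  by apply: cvgM; [exact: cvg_cst|exact: bidual_entry_cvg].
have Vxi : V ^+ 2 <= `|xi| * V.
  rewrite -(cvg_lim _ cv)//; apply: limr_le; first by apply/cvg_ex; eexists; exact: cv.
  near=> j; have -> : \sum_(0 <= k < n) w k * bidual_entry xi k j = xi (f j).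
    by rewrite bop_sum; apply: eq_bigr => k _; rewrite dualZ.
  rewrite (le_trans (ler_norm _))// (le_trans (bop_norm_le _ _))//.
  by rewrite ler_wpM2l.
have [->//|Vn0] := eqVneq V 0.
by rewrite -(ler_pM2r (_ : 0 < V)) -?expr2// lt_neqAle eq_sym Vn0.
Unshelve. all: by end_near. Qed.

(** The polar form of [qvar]: pairs the increments of [y] along the path with those of the [k]-th
    component. *)
Fixpoint qdual k (y : nat -> R) a s : dual_space (ell2J R) :=
  if s is b :: s' then (y b - y a) *: (l2J_coord k b - l2J_coord k a) + qdual k y b s'
  else 0.

Lemma qdual_bidual xi k a s :
  xi (qdual k (bidual_entry xi k) a s) = qvar (bidual_entry xi k) a s.
Proof.
elim: s a => [|b s IH] a /=; first by rewrite linear0.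
by rewrite bopD IH dualZ bopB expr2.
Qed.

(** Each increment contributes a square [(u - c * v) ^+ 2 >= 0]. In this quadratic form the estimate
    can be summed over components without square roots. *)
Lemma qdual_le k (y : nat -> R) a s (c : R) x :
  2 * c * qdual k y a s x <= qvar y a s + c ^+ 2 * qvar (x k) a s.
Proof.
elim: s a => [|b s IH] a; first by rewrite -[qdual _ _ _ _ x]/(0 : R) /= !mulr0 addr0.
rewrite -[qdual _ _ _ _ x]/((y b - y a) * (x k b - x k a) + qdual k y b s x).
rewrite -[qvar y a _]/((y b - y a) ^+ 2 + qvar y b s).
rewrite -[qvar (x k) a _]/((x k b - x k a) ^+ 2 + qvar (x k) b s).
have := IH b; move: (qdual _ _ _ _ _) (qvar y b s) (qvar _ b s) => p q r.
move: (y b - y a) (x k b - x k a : R) => u v.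
have := sqr_ge0 (u - c * v); nra.
Qed.

(* Tests xi on the functional whose coefficients are the increments themselves. *)
Lemma bidual_entry_qvar xi (a : nat -> nat) (s : nat -> seq nat) n :
  (forall k, path ltn (a k) (s k)) ->
  \sum_(0 <= k < n) qvar (bidual_entry xi k) (a k) (s k) <= `|xi| ^+ 2.
Proof.
move=> as_; set V2 := \sum_(_ <= _ < _) _.
have V20 : 0 <= V2 by apply: sumr_ge0 => k _; exact: qvar_ge0.
pose V := Num.sqrt V2.
have VE : V ^+ 2 = V2 by rewrite sqr_sqrtr.
have [V0|V0] := eqVneq V 0; first by rewrite -VE V0 expr0n sqr_ge0.
have Vpos : 0 < V by rewrite lt_neqAle eq_sym V0 sqrtr_ge0.
pose f : dual_space (ell2J R) :=
  \sum_(0 <= k < n) qdual k (bidual_entry xi k) (a k) (s k).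
have xif : xi f = V ^+ 2.
  by rewrite bop_sum VE; apply: eq_bigr => k _; exact: qdual_bidual.
have fb x : `|x| <= 1 -> 2 * V * f x <= V ^+ 2 + V ^+ 2.
  move=> x1; rewrite bop_sumE mulr_sumr.
  apply: (@le_trans _ _ (\sum_(0 <= k < n) (qvar (bidual_entry xi k) (a k) (s k) +
    V ^+ 2 * `|x k| ^+ 2))).
    apply: ler_sum => k _; rewrite (le_trans (qdual_le _ _ _ _ _ _))// lerD2l.
    by rewrite ler_wpM2l ?sqr_ge0// qvar_le.
  rewrite big_split -mulr_sumr -/V2 VE lerD2l ler_piMr//.
  by rewrite (le_trans (l2_sum_le _ _))// expr_le1.
have nf : `|f| <= V.
  apply: op_norm_ub => x x1.
  have f1 : f x <= V.
    have h := fb x x1; rewrite -(ler_pM2l Vpos) -expr2.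
    by move: (f x) h => p h; lra.
  have f2 : - V <= f x.
    have h := fb (- x); rewrite normrN -scaleN1r dualZ mulN1r in h.
    rewrite lerNl -(ler_pM2l Vpos) -expr2.
    by move: (f x) (h x1) => p {}h; lra.
  by rewrite ler_norml f1 f2.
rewrite -VE ler_sqr ?nnegrE ?(ltW Vpos)//.
rewrite -(ler_pM2r Vpos) -expr2 -xif (le_trans (ler_norm _))//.
by rewrite (le_trans (bop_norm_le xi f))// ler_wpM2l.
Qed.

Lemma bidual_entry_james xi k : bidual_to_l2 xi = 0 ->
  bidual_entry xi k \in (james_seq : {pred nat -> R^o}).
Proof.
move=> xi0; apply: (@james_of_qvar _ _ `|xi|) => // [|a s as_].
  have l0 : limn (bidual_entry xi k) = 0 by have /l2sumP/(_ k) := xi0.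
  by rewrite -l0; exact: bidual_entry_cvg.
(* All components other than [k] receive the empty path. *)
have := @bidual_entry_qvar xi (fun=> a) (fun i => if i == k then s else [::]) k.+1.
move=> h; apply: le_trans (h _) => [|i]; last by case: ifP.
by rewrite big_nat_recr//= eqxx lerDr; apply: sumr_ge0 => i _; exact: qvar_ge0.
Qed.

(** Choose a nearly norming path in each of the first [n] components, losing at most [e] in total,
    and apply [bidual_entry_qvar] to all of them together. *)
Lemma bidual_entry_summable xi (xi0 : bidual_to_l2 xi = 0) :
  (fun k => James (bidual_entry_james k xi0)) \in square_summable (james R).
Proof.
set x := (fun k => _).
apply/square_summableP; exists `|xi| => n.
rewrite -ler_sqr ?nnegrE ?sqrtr_ge0// partial_norm_sqr.
apply/ler_addgt0Pr => e e0.
pose d := e / n.+1%:R.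
have d0 : 0 < d by rewrite divr_gt0.
have /choice[p Hp] k : exists p : nat * seq nat,
    path ltn p.1 p.2 /\ `|x k| ^+ 2 - d < qvar (x k) p.1 p.2.
  by have [a [s ?]] := james_norm_approx (x k) d0; exists (a, s).
have := @bidual_entry_qvar xi (fun k => (p k).1) (fun k => (p k).2) n (fun k => (Hp k).1).
move=> h; apply: le_trans (lerD h (lexx e)).
apply: (@le_trans _ _ (\sum_(0 <= k < n) (qvar (bidual_entry xi k) (p k).1 (p k).2 + d))).
  by apply: ler_sum => k _; have [_] := Hp k; rewrite ltrBlDr => /ltW.
rewrite big_split lerD2l /= sumr_const_nat subn0 -mulr_natr /d mulrAC -mulrA.
by rewrite ler_piMr ?(ltW e0)// ler_pdivrMr// mul1r ler_nat.
Qed.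

Definition junit j : james R := jstep j.+1 - jstep j.

Lemma junitE j i : junit j i = (i == j)%:R.
Proof.
rewrite jamesBE !jstepE ltnS leq_eqVlt.
by case: eqP => [->|_] /=; rewrite ?ltnn ?subr0 ?subrr.
Qed.

Lemma l2Jtrunc_sum N x : l2Jtrunc N x = \sum_(0 <= k < N) \sum_(0 <= j < N)
  x k j *: l2tensor (l2_unit k) (junit j).
Proof.
apply/l2sumP => k; apply/jamesP => j.
rewrite l2sum_sumE james_sumE; under eq_bigr do rewrite l2sum_sumE james_sumE.
under eq_bigr do under eq_bigr do rewrite l2sumZE jamesZE l2tensorE junitE.
rewrite /=; case: ifP => kN; rewrite ?jtruncE.
  rewrite (bigD1_seq k) ?mem_index_iota ?iota_uniq//= addrC big1 ?add0r => [|i ik].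
    case: ifP => jN.
      rewrite (bigD1_seq j) ?mem_index_iota ?iota_uniq//= addrC big1 ?add0r => [|i ij].
        by rewrite /unit_seq !eqxx !mulr1.
      by rewrite [j == i]eq_sym (negbTE ij) !mulr0.
    rewrite big_nat big1// => i /andP[_ iN].
    by case: eqP iN jN => [->->//|_ _ _]; rewrite !mulr0.
  by rewrite big1// => l _; rewrite /unit_seq eq_sym (negbTE ik) mul0r mulr0.
rewrite big_nat big1 => [//|i /andP[_ iN]]; rewrite big1// => l _.
rewrite /unit_seq; case: eqP iN kN => [->->//|_ _ _]; by rewrite mul0r mulr0.
Qed.

(** The entries of [xi] form a vector [x] of l2(J). It agrees with [xi] on combinations of
    coordinate functionals, and these approximate every [phi] in norm by [l2J_shrinking]. *)
Lemma bidual_kernel xi : bidual_to_l2 xi = 0 -> xi \in embed_image (ell2J R).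
Proof.
move=> xi0; pose x : ell2J R := L2Sum (bidual_entry_summable xi0).
apply/embed_imageP; exists x; apply/bopP => phi.
apply/eqP; rewrite -subr_eq0 -normr_le0; apply/ler_addgt0Pr => e e0; rewrite add0r.
have c0 : 0 < `|xi| + `|x| + 1 by rewrite ltr_wpDl// addr_ge0.
pose d := e / (2 * (`|xi| + `|x| + 1)).
have d0 : 0 < d by rewrite divr_gt0// mulr_gt0.
have [N HN] := l2J_shrinking phi d0.
(* This is [phi] composed with the truncation [l2Jtrunc N], written as a finite combination of
   coordinates. *)
pose psi : dual_space (ell2J R) := \sum_(0 <= k < N) \sum_(0 <= j < N)
  phi (l2tensor (l2_unit k) (junit j)) *: l2J_coord k j.
have psiE z : psi z = phi (l2Jtrunc N z).
  rewrite l2Jtrunc_sum bop_sum bop_sumE; apply: eq_bigr => k _.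
  rewrite bop_sum bop_sumE; apply: eq_bigr => j _.
  by rewrite dualZ bop_scaleE mulrC.
have xpsi : xi psi = psi x.
  rewrite bop_sumE bop_sum; apply: eq_bigr => k _.
  by rewrite bop_sumE bop_sum; apply: eq_bigr => j _; rewrite dualZ.
have pp : `|phi - psi| <= d * 2.
  apply: op_norm_ub => z z1; rewrite bop_subE psiE -bopB.
  rewrite (le_trans (HN _ (@l2Jtrunc_tail _ N z)))// ler_wpM2l ?(ltW d0)//.
  rewrite (le_trans (ler_normB _ _))//.
  have zN := le_trans (l2Jtrunc_le N z) z1; rewrite (natrD _ 1 1).
  exact: lerD z1 zN.
have -> : xi phi - bidual_embed x phi = xi (phi - psi) - (phi - psi) x.
  rewrite bopB xpsi bop_subE -[bidual_embed x phi]/(phi x).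
  by rewrite opprB addrA subrK.
rewrite (le_trans (ler_normB _ _))//.
rewrite (le_trans (lerD (bop_norm_le _ _) (bop_norm_le _ _)))//.
rewrite [`|phi - _| * _]mulrC -mulrDl.
apply: (@le_trans _ _ ((`|xi| + `|x| + 1) * (d * 2))).
  by rewrite ler_pM ?addr_ge0// lerDl.
rewrite le_eqVlt; apply/orP; left; apply/eqP; rewrite /d; field.
by rewrite gt_eqF.
Qed.

End Kernel.

(** * Weakly compact operators *)

Section UltrafilterLimits.
Context {R : realType} {E : normedModType R}.
Variable G : set_system E.
Hypotheses (GU : UltraFilter G) (G1 : G [set x | `|x| <= 1]).

(** On the unit ball [f] takes its values in a compact interval, where ultrafilters converge. *)
Lemma dual_ultra_cvg (f : dual_space E) : cvg (f x @[x --> G] : set_system R^o).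
Proof.
have UH := fmap_ultra (f : E -> R^o) GU.
have cS : compact (`[- `|f|, `|f|]%classic : set R^o) by exact: segment_compact.
move: cS; rewrite compact_ultra => /(_ _ UH)[|y [_ fy]]; last by apply/cvg_ex; exists y.
apply: (@filterS _ G _ _ (f @^-1` _) _ G1) => x /= x1.
rewrite in_itv /= -ler_norml (le_trans (bop_norm_le _ _))//.
by rewrite ler_piMr.
Qed.

Let ultra_linear : linear ((fun f => lim (f x @[x --> G])) : dual_space E -> R^o).
Proof.
move=> a f g; apply: cvg_lim => //.
exact: (cvg_lincomb (a := a) _ (@dual_ultra_cvg f) (@dual_ultra_cvg g)).
Qed.

Let ultra_bound (f : dual_space E) : `|lim (f x @[x --> G]) : R^o| <= 1 * `|f|.
Proof.
have cv : `|f x : R^o| @[x --> G] --> `|lim (f x @[x --> G]) : R^o|.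
  by apply: cvg_norm; exact: dual_ultra_cvg.
rewrite mul1r -(cvg_lim _ cv)//; apply: limr_le; first by apply/cvg_ex; eexists; exact: cv.
apply: filterS G1 => x /= x1.
by rewrite (le_trans (bop_norm_le _ _))// ler_piMr.
Qed.

(** The weak-star limit in the bidual of an ultrafilter that lives on the unit ball. *)
Definition ultra_limit : bidual E := mkbop ultra_linear ultra_bound.

Lemma ultra_limit_cvg (f : dual_space E) : f x @[x --> G] --> (ultra_limit f : R^o).
Proof. exact: dual_ultra_cvg. Qed.

End UltrafilterLimits.

(** * The operator induced on l2 by an operator on l2(J) *)

Section ResidualMatrix.
Context {R : realType}.
Local Notation E := (ell2J R).
Implicit Types (S T : bop E E) (w : ell2 R) (xi : bidual E).

Let resid_linear S : linear (fun w => bidual_to_l2 (biadjoint S (l2lift w))).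
Proof.
by move=> a w w'; rewrite l2lift_linear_arg bopD bopZ linearP.
Qed.

Let resid_bound S w : `|bidual_to_l2 (biadjoint S (l2lift w))| <= `|biadjoint S| * `|w|.
Proof.
rewrite (le_trans (bidual_to_l2_le _))// (le_trans (bop_norm_le _ _))//.
by rewrite ler_wpM2l// l2lift_le.
Qed.

(** R(S) read on l2, with the lift of [w] as representative of its class; [resid_bidual] shows that
    any other representative gives the same result. *)
Definition resid S : bop (ell2 R) (ell2 R) := mkbop (@resid_linear S) (@resid_bound S).

Lemma residE S w : resid S w = bidual_to_l2 (biadjoint S (l2lift w)).
Proof. by []. Qed.

Lemma bidual_decomp xi : exists x : E, xi = bidual_embed x + l2lift (bidual_to_l2 xi).
Proof.
have : bidual_to_l2 (xi - l2lift (bidual_to_l2 xi)) = 0.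
  by rewrite linearB /= bidual_to_l2_lift subrr.
by move=> /bidual_kernel/embed_imageP[x xE]; exists x; rewrite -xE subrK.
Qed.

(** An element of the bidual differs from the lift of its limits by a vector of l2(J), which the
    biadjoint keeps in l2(J), where all limits are 0. *)
Lemma resid_bidual S xi : bidual_to_l2 (biadjoint S xi) = resid S (bidual_to_l2 xi).
Proof.
have [x xE] := bidual_decomp xi.
by rewrite [in LHS]xE bopD biadjoint_embed linearD /= bidual_to_l2_embed add0r.
Qed.

Lemma resid_lincomb a S T : resid (a *: S + T) = a *: resid S + resid T.
Proof.
apply/bopP => w; rewrite bop_addE bop_scaleE !residE -linearP; congr bidual_to_l2.
apply/bopP => phi; rewrite bop_addE bop_scaleE.
rewrite -[LHS]/(l2lift w (bop_comp phi (a *: S + T))).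
have -> : (bop_comp phi (a *: S + T) : dual_space E) =
    a *: (bop_comp phi S : dual_space E) + (bop_comp phi T : dual_space E).
  by apply/bopP => x; exact: (linearP phi a (S x) (T x)).
by rewrite bopD dualZ.
Qed.

Lemma resid_mul S T : resid (S * T) = resid S * resid T.
Proof.
apply/bopP => w; rewrite bop_mulE [resid T w]residE -resid_bidual residE.
by congr bidual_to_l2; apply/bopP => phi; congr (l2lift w _); apply/bopP.
Qed.

Lemma resid1 : resid 1 = 1.
Proof.
apply/bopP => w; rewrite residE -[RHS]bidual_to_l2_lift; congr bidual_to_l2.
by apply/bopP => phi; congr (l2lift w _); apply/bopP.
Qed.

(** Along an ultrafilter of indices tending to infinity, the images of the bounded vectors
    [l2tensor u (jstep n)] converge weakly to some [y] in l2(J). The biadjoint then sends the lift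
    of [u] to [y], whose limits vanish. *)
Lemma resid_wcompact S : S \in wcompact E E -> resid S = 0.
Proof.
move=> /wcompactP HS; apply/bopP => w.
pose c := `|w| + 1; have c0 : 0 < c by rewrite ltr_wpDl.
pose u := c^-1 *: w.
have u1 : `|u| <= 1.
  by rewrite normrZ gtr0_norm ?invr_gt0// mulrC ler_pdivrMr// mul1r lerDl.
have -> : w = c *: u by rewrite scalerA divff ?gt_eqF// scale1r.
rewrite bopZ; suff -> : resid S u = 0 by rewrite scaler0.
have [F [FU Foo]] := @ultraFilterLemma nat \oo _.
pose g n := l2tensor u (jstep n).
have [|y Hy] := HS (g @ F) (fmap_ultra g FU).
  apply: (@filterS _ F _ setT) filterT => n _ /=.
  rewrite (le_trans (l2tensor_le _ _))//.
  by rewrite mulr_ile1//; exact: jstep_le1.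
rewrite residE; have -> : biadjoint S (l2lift u) = bidual_embed y.
  apply/bopP => f.
  have h1 : f (S (g n)) @[n --> F] --> (l2lift u (bop_comp f S) : R^o).
    by apply: cvg_trans (@l2lift_cvg R u (bop_comp f S)); exact: cvg_app Foo.
  exact: (cvg_unique _ h1 (Hy f)).
exact: bidual_to_l2_embed.
Qed.

(** An ultrafilter on the unit ball has a weak-star limit in the bidual. If [resid S] is 0, the
    biadjoint sends it into l2(J), by [bidual_kernel], and this image is the weak limit sought. *)
Lemma wcompact_resid S : resid S = 0 -> S \in wcompact E E.
Proof.
move=> S0; apply/wcompactP => G GU G1.
pose xi := ultra_limit GU G1.
have : bidual_to_l2 (biadjoint S xi) = 0 by rewrite resid_bidual S0.
move=> /bidual_kernel/embed_imageP[y yE]; exists y => f.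
have -> : f y = xi (bop_comp f S) by rewrite -[f y]/(bidual_embed y f) -yE.
exact: (@ultra_limit_cvg _ _ _ GU G1 (bop_comp f S)).
Qed.

Definition calkin_rep (a : weak_calkin E) : bop (ell2 R) (ell2 R) := resid (repr a).

Lemma resid_eq S T : (resid S == resid T) = (S - T \in wcompact E E).
Proof.
have H : resid (S - T) = resid S - resid T.
  by rewrite -[S - T]addrC -scaleN1r resid_lincomb scaleN1r addrC.
by apply/eqP/idP => [ST|/resid_wcompact/eqP]; [apply: wcompact_resid; rewrite H ST subrr|
  rewrite H subr_eq0 => /eqP].
Qed.

Lemma calkin_rep_pi S : calkin_rep (weak_calkin_pi S) = resid S.
Proof. by apply/eqP; rewrite resid_eq -quot_pi_eq quot_piK. Qed.

Lemma calkin_rep_linear : linear calkin_rep.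
Proof.
move=> k a b; rewrite -[a]quot_piK -[b]quot_piK -linearP.
by rewrite !calkin_rep_pi resid_lincomb.
Qed.
HB.instance Definition _ :=
  GRing.isLinear.Build R (weak_calkin E) (bop (ell2 R) (ell2 R)) _ calkin_rep calkin_rep_linear.

Lemma calkin_rep_mul a b : calkin_rep (a * b) = calkin_rep a * calkin_rep b.
Proof.
by rewrite -resid_mul -calkin_rep_pi.
Qed.

Lemma calkin_rep1 : calkin_rep 1 = 1.
Proof. by rewrite -[1]/(weak_calkin_pi 1) calkin_rep_pi resid1. Qed.

Lemma calkin_rep_inj : injective calkin_rep.
Proof.
move=> a b; rewrite -[a]quot_piK -[b]quot_piK !calkin_rep_pi => /eqP.
by rewrite resid_eq -quot_pi_eq => /eqP.
Qed.

Lemma l2_ident_Rmap S (q : bidual_quot E) :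
  calkin_rep (weak_calkin_pi S) (l2_ident q) = l2_ident (Rmap S q).
Proof.
by rewrite -[q]quot_piK calkin_rep_pi RmapE !l2_identE resid_bidual.
Qed.

Lemma l2_ident_bij : bijective (@l2_ident R).
Proof.
exists (fun w => quot_pi (embed_image E) (l2lift w)) => [q|w].
  rewrite -[q]quot_piK l2_identE; apply/eqP; rewrite quot_pi_eq.
  by apply: bidual_kernel; rewrite linearB /= bidual_to_l2_lift subrr.
by rewrite l2_identE bidual_to_l2_lift.
Qed.

(** Taking limits is a contraction on the bidual, and [l2lift] is a contractive section of it. *)
Lemma l2_ident_norm (q : bidual_quot E) : `|l2_ident q| = quot_norm q.
Proof.
have [inv Kinv invK] := l2_ident_bij.
apply/eqP; rewrite eq_le; apply/andP; split.
  apply: lb_le_inf; first by exists `|repr q|, (repr q) => //=; exact: quot_piK.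
  move=> _ [xi /= xiq <-]; rewrite -xiq l2_identE; exact: bidual_to_l2_le.
apply: le_trans (l2lift_le _); apply: ge_inf.
  by exists 0 => _ [xi _ <-].
exists (l2lift (l2_ident q)) => //=.
apply: (can_inj Kinv); by rewrite l2_identE bidual_to_l2_lift.
Qed.

End ResidualMatrix.

(** * Matrices of operators on l2 *)

Section L2Matrix.
Context {R : realType}.
Implicit Types (A B : bop (ell2 R) (ell2 R)) (w : ell2 R).

Lemma l2_unitE j i : l2_unit j i = (i == j)%:R :> R.
Proof. by []. Qed.

Lemma l2_unit_sumE w n i :
  (\sum_(0 <= j < n) (w j : R) *: l2_unit j) i = if (i < n)%N then w i else 0.
Proof.
rewrite l2sum_sumE; under eq_bigr do rewrite l2sumZE l2_unitE.
case: ifP => iN.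
  rewrite (bigD1_seq i) ?mem_index_iota ?iota_uniq//= eqxx addrC big1 ?add0r => [|j ji].
    exact: mulr1.
  by rewrite eq_sym (negbTE ji); exact: mulr0.
rewrite big_nat big1// => j /andP[_ jn].
by case: eqP jn iN => [->->//|_ _ _]; exact: mulr0.
Qed.

Lemma l2_unit_cvg w :
  `|w - \sum_(0 <= j < n) (w j : R) *: l2_unit j| @[n --> \oo] --> (0 : R).
Proof.
apply: (@l2_dominated_cvg _ _ _ w _ 1) => // [n k|k].
  rewrite l2sumBE l2_unit_sumE mul1r; case: ifP => _; last by rewrite subr0.
  by rewrite subrr normr0.
apply: cvg_near_cst; near=> n; rewrite l2sumBE l2_unit_sumE.
have -> : (k < n)%N by near: n; exact: nbhs_infty_gt.
by rewrite subrr normr0.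
Unshelve. all: by end_near. Qed.

Lemma l2_entry_cvg A w i :
  \sum_(0 <= j < n) l2_entry A i j * w j @[n --> \oo] --> (A w i : R).
Proof.
have H n : `|A w i - \sum_(0 <= j < n) l2_entry A i j * w j| <=
    `|A| * `|w - \sum_(0 <= j < n) (w j : R) *: l2_unit j|.
  rewrite (le_trans _ (bop_norm_le A _))//.
  have -> : \sum_(0 <= j < n) l2_entry A i j * w j =
      A (\sum_(0 <= j < n) (w j : R) *: l2_unit j) i.
    rewrite bop_sum l2sum_sumE; apply: eq_bigr => j _.
    by rewrite bopZ l2sumZE; exact: mulrC.
  rewrite bopB; exact: (l2_coord_norm_le (_ - _) i).
have h0 : `|A| * `|w - \sum_(0 <= j < n) (w j : R) *: l2_unit j| @[n --> \oo] -->
    `|A| * 0 by apply: cvgM; [exact: cvg_cst|exact: l2_unit_cvg].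
rewrite mulr0 in h0.
apply/cvgrPdist_lt => e e0; move/cvgrPdist_lt: h0 => /(_ e e0) h0.
near=> n; rewrite (le_lt_trans (H n))// (le_lt_trans (ler_norm _))//.
by rewrite -normrN -sub0r; near: n.
Unshelve. all: by end_near. Qed.

Lemma l2_entry_inj A B : (forall i j, l2_entry A i j = l2_entry B i j) -> A = B.
Proof.
move=> AB; apply/bopP => w; apply/l2sumP => i.
have h := @l2_entry_cvg A w i.
have e : (fun n => \sum_(0 <= j < n) l2_entry A i j * w j) =
    (fun n => \sum_(0 <= j < n) l2_entry B i j * w j).
  by apply/funext => n; apply: eq_bigr => j _; rewrite AB.
by rewrite e in h; exact: (cvg_unique _ h (@l2_entry_cvg B w i)).
Qed.

Lemma op_modulusE A B : is_modulus A B -> op_modulus A = B.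
Proof.
move=> AB; apply: xget_unique => // B' AB'.
by apply: l2_entry_inj => i j; rewrite AB AB'.
Qed.

(** The operator is the pointwise limit of the column sections. For a given number [n] of rows the
    bound is asked only for large [m], so that a block matrix may first complete its blocks. *)
Lemma matrix_op (b : nat -> nat -> R) (C : R) : 0 <= C ->
  (forall w i, cvgn (fun m => \sum_(0 <= j < m) b i j * w j)) ->
  (forall w n, \forall m \near \oo,
    \sum_(0 <= i < n) (\sum_(0 <= j < m) b i j * w j) ^+ 2 <= C ^+ 2 * `|w| ^+ 2) ->
  exists B, (forall i j, l2_entry B i j = b i j) /\ `|B| <= C.
Proof.
move=> C0 cb Cb.
pose f w i : R^o := limn (fun m => \sum_(0 <= j < m) b i j * w j).
have fle w n : \sum_(0 <= i < n) f w i ^+ 2 <= (C * `|w|) ^+ 2.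
  have cv : \sum_(0 <= i < n) (\sum_(0 <= j < m) b i j * w j) ^+ 2 @[m --> \oo] -->
      \sum_(0 <= i < n) f w i ^+ 2.
    apply: cvg_sum_seq => i; rewrite expr2; under eq_cvg do rewrite expr2.
    by apply: cvgM; exact: cb.
  by apply: (cvgr_to_le cv); rewrite exprMn.
have fs w : f w \in square_summable R^o.
  apply/square_summableP; exists (C * `|w|) => n.
  rewrite -ler_sqr ?nnegrE ?sqrtr_ge0 ?mulr_ge0// partial_norm_sqr.
  by under eq_bigr do rewrite real_normK ?num_real//.
pose F w : ell2 R := L2Sum (fs w).
have lF : linear F.
  move=> a w w'; apply/l2sumP => i; rewrite l2sumDE l2sumZE /=; apply: cvg_lim => //.
  have h := cvg_lincomb (a := a) _ (cb w i) (cb w' i).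
  apply: cvg_trans (h _); apply: near_eq_cvg; near=> m.
  rewrite mulr_sumr -big_split; apply: eq_bigr => j _.
  by rewrite l2sumDE l2sumZE /= mulrDr mulrCA.
have bF w : `|F w| <= C * `|w|.
  apply: l2_norm_leP => [|n]; first by rewrite mulr_ge0.
  by rewrite (le_trans _ (fle w n))// ler_sum// => i _; rewrite real_normK ?num_real.
exists (mkbop lF bF); split=> [i j|]; last first.
  by apply: op_norm_ub => w w1; rewrite (le_trans (bF w))// ler_piMr.
apply: cvg_lim => //; apply: cvg_near_cst; near=> m.
have jm : (j < m)%N by near: m; exact: nbhs_infty_gt.
rewrite (bigD1_seq j) ?mem_index_iota ?iota_uniq//= /unit_seq eqxx mulr1.
by rewrite addrC big1 ?add0r// => k kj; rewrite (negbTE kj) mulr0.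
Unshelve. all: by end_near. Qed.

End L2Matrix.

(** * Lifting a regular operator on l2 to l2(J) *)

Section TensorOperator.
Context {R : realType}.
Implicit Types (A B : bop (ell2 R) (ell2 R)) (x : ell2J R).

Lemma qvar_cvg (u : nat -> nat -> R) (v : nat -> R) a s :
  (forall j, u n j @[n --> \oo] --> v j) ->
  qvar (u n) a s @[n --> \oo] --> qvar v a s.
Proof.
move=> uv; elim: s a => [|b s IH] a /=; first exact: cvg_cst.
apply: cvgD => //; rewrite expr2; under eq_cvg do rewrite expr2.
by apply: cvgM; apply: cvgB.
Qed.

Lemma l2J_col_dom x l k : `|x k l : R^o| <= 1 * `|x k|.
Proof. by rewrite mul1r; exact: james_coord_le. Qed.

Definition l2J_col x l : ell2 R :=
  L2Sum (l2_dom_summable ler01 (l2J_col_dom x l)).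

Lemma l2J_norms_dom x k : `|(`|x k| : R^o)| <= 1 * `|x k|.
Proof. by rewrite mul1r normr_id. Qed.

Definition l2J_norms x : ell2 R := L2Sum (l2_dom_summable ler01 (l2J_norms_dom x)).

Lemma l2J_norms_le x : `|l2J_norms x| <= `|x|.
Proof. by have := @l2_dom_le _ _ _ x (l2J_norms x) 1 ler01 (l2J_norms_dom x); rewrite mul1r. Qed.

Lemma l2J_col_cvg x : `|l2J_col x l| @[l --> \oo] --> (0 : R).
Proof.
apply: (@l2_dominated_cvg _ _ _ x _ 1) => // [n k|k]; first exact: l2J_col_dom.
have h : `|x k l : R^o| @[l --> \oo] --> `|0 : R^o|.
  by apply: cvg_norm; exact: james_cvg0.
by rewrite normr0 in h; exact: h.
Qed.

Lemma l2J_col_linear a x y l : l2J_col (a *: x + y) l = a *: l2J_col x l + l2J_col y l.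
Proof.
apply/l2sumP => k; rewrite l2sumDE l2sumZE -[LHS]/((a *: x + y) k l).
by rewrite l2sumDE l2sumZE jamesDE jamesZE.
Qed.

Section Construction.
Variables (A B : bop (ell2 R) (ell2 R)).
Hypothesis AB : is_modulus A B.

(** The square root of [qvar] is a seminorm, so a finite combination of the components of [x] with
    coefficients from row [i] has variation at most the same combination of absolute values and
    norms. Both sides pass to the limit. *)
Lemma modulus_qvar x i a s : path ltn a s ->
  qvar (fun l => A (l2J_col x l) i : R) a s <= (B (l2J_norms x) i) ^+ 2.
Proof.
move=> as_.
pose u n l : R := \sum_(0 <= j < n) l2_entry A i j * x j l.
have cu : qvar (u n) a s @[n --> \oo] --> qvar (fun l => A (l2J_col x l) i : R) a s.
  apply: qvar_cvg => l; exact: l2_entry_cvg.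
have cB := @l2_entry_cvg R B (l2J_norms x) i.
have cB2 : (\sum_(0 <= j < n) l2_entry B i j * `|x j|) ^+ 2 @[n --> \oo] -->
    (B (l2J_norms x) i : R) ^+ 2.
  by rewrite expr2; under eq_cvg do rewrite expr2; exact: (cvgM cB cB).
apply: (ler_cvg_to cu cB2); near=> n.
rewrite -[leLHS]sqr_sqrtr ?qvar_ge0//.
rewrite ler_sqr ?nnegrE ?sqrtr_ge0//; last first.
  by apply: sumr_ge0 => j _; rewrite AB mulr_ge0.
rewrite (le_trans (qvar_sum_le _ _ _ _))//; apply: ler_sum => j _.
rewrite qvarZ sqrtrM ?sqr_ge0// sqrtr_sqr AB ler_wpM2l//.
by rewrite -[leRHS]ger0_norm// -sqrtr_sqr ler_wsqrtr// qvar_le.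
Unshelve. all: by end_near. Qed.

Lemma l2_modulus_ge0 x i : 0 <= B (l2J_norms x) i :> R.
Proof.
apply: (cvgr_to_ge (@l2_entry_cvg R B (l2J_norms x) i)); near=> n.
by apply: sumr_ge0 => j _; rewrite AB /= mulr_ge0.
Unshelve. all: by end_near. Qed.

Lemma tensor_op_james x i : (fun l => A (l2J_col x l) i) \in (james_seq : {pred nat -> R^o}).
Proof.
apply: (james_of_qvar (l2_modulus_ge0 x i)); last by move=> a s; exact: modulus_qvar.
have h0 : `|A| * `|l2J_col x l| @[l --> \oo] --> `|A| * 0.
  by apply: cvgM; [exact: cvg_cst|exact: l2J_col_cvg].
rewrite mulr0 in h0.
apply/cvgrPdist_lt => e e0; move/cvgrPdist_lt: h0 => /(_ e e0) h0.
near=> l; rewrite sub0r normrN (le_lt_trans (l2_coord_norm_le _ _))//.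
rewrite (le_lt_trans (bop_norm_le _ _))// (le_lt_trans (ler_norm _))//.
by rewrite -[`|_ * _|]normrN -[- (_ * _)]sub0r; near: l.
Unshelve. all: by end_near. Qed.

Definition tensor_op_coord x i : james R := James (tensor_op_james x i).

Lemma tensor_op_dom x i : `|tensor_op_coord x i| <= 1 * `|B (l2J_norms x) i|.
Proof.
rewrite mul1r ger0_norm ?l2_modulus_ge0//.
apply: norm_james_le; first exact: l2_modulus_ge0.
by move=> a s; exact: modulus_qvar.
Qed.

Definition tensor_op_fun x : ell2J R := L2Sum (l2_dom_summable ler01 (tensor_op_dom x)).

Let tensor_op_linear : linear tensor_op_fun.
Proof.
move=> a x y; apply/l2sumP => i; apply/jamesP => l.
rewrite l2sumDE l2sumZE jamesDE jamesZE /=.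
by rewrite l2J_col_linear bopD bopZ.
Qed.

Let tensor_op_bound x : `|tensor_op_fun x| <= `|B| * `|x|.
Proof.
have h : `|tensor_op_fun x| <= 1 * `|B (l2J_norms x)|.
  by apply: l2_dom_le => // i; exact: tensor_op_dom.
rewrite (le_trans h)// mul1r (le_trans (bop_norm_le _ _))// ler_wpM2l//.
exact: l2J_norms_le.
Qed.

(* The operator [A (x) id] on the l2-sum. *)
Definition tensor_op : bop (ell2J R) (ell2J R) := mkbop tensor_op_linear tensor_op_bound.

Lemma tensor_op_le : `|tensor_op| <= `|B|.
Proof.
apply: op_norm_ub => x x1; rewrite (le_trans (tensor_op_bound x))//.
by rewrite ler_piMr.
Qed.

Lemma tensor_opE w n : tensor_op (l2tensor w (jstep n)) = l2tensor (A w) (jstep n).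
Proof.
apply/l2sumP => i; apply/jamesP => l; rewrite l2tensorE.
rewrite -[LHS]/(A (l2J_col (l2tensor w (jstep n)) l) i).
have -> : l2J_col (l2tensor w (jstep n)) l = (jstep n l : R) *: w.
  apply/l2sumP => k; rewrite l2sumZE -[LHS]/(l2tensor w (jstep n) k l) l2tensorE.
  exact: mulrC.
by rewrite bopZ l2sumZE; exact: mulrC.
Qed.

(** On tensors with a step the operator acts on the l2 factor only ([tensor_opE]), hence it sends
    the lift of [w] to the lift of [A w]. *)
Lemma resid_tensor_op : resid tensor_op = A.
Proof.
apply/bopP => w; rewrite residE -[RHS]bidual_to_l2_lift; congr bidual_to_l2.
apply/bopP => phi; rewrite -[LHS]/(l2lift w (bop_comp phi tensor_op)).
apply: cvg_lim => //; have := @l2lift_cvg R (A w) phi.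
by under eq_cvg do rewrite -tensor_opE.
Qed.

End Construction.
End TensorOperator.

(** * Zigzags *)

Section Zigzag.
Context {R : realType}.

(* The idea: (1 - y t) (1 - y t') >= 0 gives y t + y t' <= 1 + rho. *)
Lemma sum_le_pairwise (y : nat -> R) (rho : R) n : 0 <= rho ->
  (forall t, 0 <= y t <= 1) -> (forall t t', (t < t')%N -> y t * y t' <= rho) ->
  \sum_(0 <= t < n) y t <= 1 + n%:R ^+ 2 * rho.
Proof.
move=> rho0 y01 yy; elim: n => [|n IH]; first by rewrite big_nil; nra.
rewrite big_nat_recr//=; set s := \sum_(_ <= _ < _) _ in IH *.
have sy : s * y n <= n%:R * rho.
  rewrite mulr_suml (@le_trans _ _ (\sum_(0 <= t < n) rho))//.
    by rewrite !big_nat; apply: ler_sum => t /andP[_ tn]; exact: yy.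
  by rewrite sumr_const_nat subn0 mulr_natl.
have /andP[y0 y1] := y01 n.
have n0 : 0 <= n%:R :> R by [].
have nr : 0 <= n%:R * rho by rewrite mulr_ge0.
have nnr : 0 <= n%:R ^+ 2 * rho by rewrite mulr_ge0// sqr_ge0.
rewrite -natr1; have [s1|s1] := lerP s 1.
  have : s + y n <= 1 + s * y n.
    have : 0 <= (1 - s) * (1 - y n) by rewrite mulr_ge0 ?subr_ge0.
    nra.
  nra.
have : y n <= s * y n by rewrite ler_peMl// ltW.
nra.
Qed.

(** The triangular wave of period [2 * l] and height [l], with slopes 1 and -1. *)
Definition tri (l p : nat) : nat := minn (p %% (2 * l)) (2 * l - p %% (2 * l)).

Lemma tri_le l p : (tri l p <= l)%N.
Proof. by rewrite /tri; lia. Qed.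

Lemma triS l p : (tri l p <= (tri l p.+1).+1)%N /\ (tri l p.+1 <= (tri l p).+1)%N.
Proof.
rewrite /tri; case: l => [|l]; first by rewrite muln0 !sub0n !minn0.
have := ltn_pmod p (isT : (0 < 2 * l.+1)%N).
have -> : (p.+1 %% (2 * l.+1) = (p %% (2 * l.+1)).+1 %% (2 * l.+1))%N.
  by rewrite -addn1 -modnDml addn1.
move: (p %% _)%N => r; rewrite leq_eqVlt => /orP[/eqP rl|rl]; last first.
  rewrite (modn_small rl). lia.
by rewrite rl modnn; lia.
Qed.

Lemma tri_lip l p d : `|(tri l (p + d))%:R - (tri l p)%:R : R| <= d%:R.
Proof.
elim: d => [|d IH]; first by rewrite addn0 subrr normr0.
have [h1 h2] := triS l (p + d); rewrite -(ler_nat R) -natr1 in h1.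
rewrite -(ler_nat R) -natr1 in h2.
rewrite addnS -natr1; move: IH; rewrite !ler_norml => /andP[a b].
by apply/andP; split; lra.
Qed.

Lemma tri_mul l k : tri l (k * l) = if odd k then l else 0%N.
Proof.
rewrite /tri; have -> : (k * l)%N = (k./2 * (2 * l) + odd k * l)%N.
  by rewrite mulnA muln2 addnC -mulnDl odd_double_half.
rewrite modnMDl; case: l => [|l]; first by rewrite !muln0 !minn0 if_same.
case: (odd k); last by rewrite mul0n mod0n min0n.
by rewrite mul1n modn_small; lia.
Qed.

Variables (m N : nat).
Hypotheses (m_gt0 : (0 < m)%N) (m_even : ~~ odd m).

(** Half period of the [t]-th zigzag. It equals the squared amplitude times the total length
    ([zz_len_amp]), which is the speed of a 1/2-Hoelder function; a larger [t] means a finer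
    scale. *)
Definition zz_len (t : nat) : nat := (m ^ (2 * (N - t.+1)))%N.
Definition zz_amp (t : nat) : R := (m%:R ^+ t.+1)^-1.
Definition zz_total : nat := (m ^ (2 * N))%N.
Definition zigzag t p : R := zz_amp t / (zz_len t)%:R * (tri (zz_len t) p)%:R.

Let mR_gt0 : 0 < m%:R :> R. Proof. by rewrite ltr0n. Qed.
Let len_gt0 t : 0 < (zz_len t)%:R :> R. Proof. by rewrite ltr0n expn_gt0 m_gt0. Qed.
Let amp_gt0 t : 0 < zz_amp t. Proof. by rewrite invr_gt0 exprn_gt0. Qed.
Let total_gt0 : 0 < zz_total%:R :> R. Proof. by rewrite ltr0n expn_gt0 m_gt0. Qed.

Lemma zz_len_total t : (t < N)%N -> zz_total = (m ^ (2 * t.+1) * zz_len t)%N.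
Proof. by move=> tN; rewrite /zz_total /zz_len -expnD -mulnDr subnKC. Qed.

Lemma zz_len_amp t : (t < N)%N -> (zz_len t)%:R = zz_amp t ^+ 2 * zz_total%:R :> R.
Proof.
move=> tN; rewrite (zz_len_total tN) natrM natrX mulrA /zz_amp exprVn -exprM mulnC.
by rewrite mulVf ?mul1r// expf_neq0 ?gt_eqF.
Qed.

Lemma zz_amp_ratio t t' : (t < t')%N -> zz_amp t' / zz_amp t <= m%:R^-1.
Proof.
move=> tt'; rewrite ler_pdivrMr//; have -> : m%:R^-1 * zz_amp t = zz_amp t.+1.
  by rewrite /zz_amp [in RHS]exprS invfM.
by rewrite lef_pV2 ?posrE ?exprn_gt0// ler_weXn2l// ler1n.
Qed.

Lemma zigzag_amp t p q : `|zigzag t q - zigzag t p| <= zz_amp t.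
Proof.
have H r : 0 <= zigzag t r <= zz_amp t.
  rewrite /zigzag mulr_ge0 ?divr_ge0 ?(ltW (amp_gt0 _)) ?(ltW (len_gt0 _))//=.
  rewrite mulrAC ler_pdivrMr// ler_wpM2l ?(ltW (amp_gt0 _))//.
  by rewrite ler_nat tri_le.
have /andP[a b] := H p; have /andP[c d] := H q.
by rewrite ler_norml; apply/andP; split; lra.
Qed.

Lemma zigzag_lip t p q : (p <= q)%N ->
  `|zigzag t q - zigzag t p| <= zz_amp t / (zz_len t)%:R * (q - p)%:R.
Proof.
move=> pq; rewrite -mulrBr normrM ger0_norm ?divr_ge0 ?(ltW (amp_gt0 _)) ?(ltW (len_gt0 _))//.
rewrite ler_wpM2l ?divr_ge0 ?(ltW (amp_gt0 _)) ?(ltW (len_gt0 _))//.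
by have := tri_lip (zz_len t) p (q - p); rewrite subnKC.
Qed.

(* All sign combinations of the zigzags are 1/2-Hoelder with constant close to 1,
   as each distance is resolved by essentially one of the scales. *)
Lemma zigzag_holder (e : nat -> R) p q : (forall t, `|e t| <= 1) -> (p < q)%N ->
  (\sum_(0 <= t < N) e t * zigzag t q - \sum_(0 <= t < N) e t * zigzag t p) ^+ 2 <=
  (1 + N%:R ^+ 2 / m%:R) ^+ 2 * ((q - p)%:R / zz_total%:R).
Proof.
move=> e1 pq.
have d0 : 0 < (q - p)%:R / zz_total%:R :> R by rewrite divr_gt0// ltr0n subn_gt0.
pose u : R := Num.sqrt ((q - p)%:R / zz_total%:R).
have uE : u ^+ 2 = (q - p)%:R / zz_total%:R by rewrite sqr_sqrtr// ltW.
have u0 : 0 < u by rewrite sqrtr_gt0.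
rewrite -uE -exprMn -sumrB.
rewrite -[leLHS]real_normK ?num_real// ler_sqr ?nnegrE//; last first.
  by rewrite mulr_ge0 ?(ltW u0)// addr_ge0// divr_ge0// sqr_ge0.
(* With [u] the root of the relative distance, the [t]-th increment is at most [y t * u]: the
   Lipschitz bound gives the first entry of the minimum and the amplitude bound the second. At two
   scales the product of one entry of each kind is a ratio of amplitudes, at most [1 / m]. *)
pose y t := Num.min (u / zz_amp t) (zz_amp t / u).
have y0 t : 0 <= y t by rewrite le_min !divr_ge0// ltW.
have y1 t : y t <= 1.
  rewrite ge_min; case: (lerP u (zz_amp t)) => ut; first by rewrite ler_pdivrMr// mul1r ut.
  by rewrite [X in _ || X]ler_pdivrMr// mul1r (ltW ut) orbT.
have yy t t' : (t < t')%N -> y t * y t' <= m%:R^-1.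
  move=> tt'; apply: (@le_trans _ _ ((u / zz_amp t) * (zz_amp t' / u))).
    by rewrite ler_pM// /y ge_min lexx ?orbT.
  have -> : u / zz_amp t * (zz_amp t' / u) = zz_amp t' / zz_amp t.
    by field; rewrite !gt_eqF.
  exact: zz_amp_ratio.
apply: (@le_trans _ _ (\sum_(0 <= t < N) y t * u)); last first.
  rewrite -mulr_suml ler_wpM2r ?(ltW u0)//.
  apply: sum_le_pairwise => //; first by rewrite invr_ge0.
  by move=> t; rewrite y0 y1.
rewrite (le_trans (ler_norm_sum _ _ _))// !big_nat; apply: ler_sum => t /andP[_ tN].
rewrite -mulrBr normrM (@le_trans _ _ (`|zigzag t q - zigzag t p|))//.
  by rewrite ler_piMl.
rewrite -ler_pdivrMr// /y le_min; apply/andP; split; last first.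
  by rewrite ler_pM2r ?invr_gt0// zigzag_amp.
rewrite ler_pdivrMr// (le_trans (zigzag_lip t (ltnW pq)))//.
rewrite zz_len_amp// [leRHS]mulrAC -expr2 uE.
rewrite le_eqVlt; apply/orP; left; apply/eqP; field.
by rewrite !gt_eqF.
Qed.

Lemma zigzag0 t : zigzag t 0 = 0.
Proof. by rewrite /zigzag -(mul0n (zz_len t)) tri_mul mulr0. Qed.

(** As [m] is even, the total length is an even number of half periods. *)
Lemma zigzag_total t : (t < N)%N -> zigzag t zz_total = 0.
Proof.
move=> tN; rewrite /zigzag (zz_len_total tN) tri_mul oddX (negbTE m_even).
by rewrite orbF muln_eq0 /= mulr0.
Qed.

Definition progression l M k := [seq (i * l)%N | i <- iota k.+1 M].

Lemma progression_path l M k : (0 < l)%N -> path ltn (k * l)%N (progression l M k).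
Proof.
move=> l0; elim: M k => //= M IH k.
by apply/andP; split; [rewrite ltn_pmul2r|exact: IH].
Qed.

Lemma progression_le l M k j : j \in progression l M k -> (j <= (k + M) * l)%N.
Proof.
move=> /mapP[i]; rewrite mem_iota => /andP[_ ik] ->.
by rewrite leq_mul2r; apply/orP; right; rewrite addSn in ik.
Qed.

Lemma qvar_progression (x : nat -> R) l M k (c : R) :
  (forall i, (x (i.+1 * l)%N - x (i * l)%N) ^+ 2 <= c) ->
  qvar x (k * l) (progression l M k) <= M%:R * c.
Proof.
move=> xc; elim: M k => [|M IH] k; first by rewrite /= mul0r.
by rewrite -nat1r mulrDl mul1r; exact: lerD (xc k) (IH k.+1).
Qed.

Lemma qvar_progression_ge (x : nat -> R) l M k (c : R) :
  (forall i, c <= (x (i.+1 * l)%N - x (i * l)%N) ^+ 2) ->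
  M%:R * c <= qvar x (k * l) (progression l M k).
Proof.
move=> xc; elim: M k => [|M IH] k; first by rewrite /= mul0r.
by rewrite -nat1r mulrDl mul1r; exact: lerD (xc k) (IH k.+1).
Qed.

(** The turning points of the [i]-th zigzag after 0. *)
Definition zz_path i := progression (zz_len i) (m ^ (2 * i.+1)) 0.

Let zz_count t : (m ^ (2 * t.+1))%:R = (zz_amp t ^+ 2)^-1 :> R.
Proof. by rewrite natrX mulnC exprM /zz_amp exprVn invrK. Qed.

(** Each increment between turning points has the size of the amplitude, and their number is the
    inverse square of the amplitude. *)
Lemma qvar_zigzag i : (i < N)%N -> 1 <= qvar (zigzag i) 0 (zz_path i).
Proof.
move=> iN; rewrite -[1](mulVf (_ : zz_amp i ^+ 2 != 0)); last first.
  by rewrite expf_neq0 ?gt_eqF.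
rewrite -zz_count -[X in qvar _ X _](mul0n (zz_len i)); apply: qvar_progression_ge => k.
rewrite /zigzag !tri_mul /=.
have -> : zz_amp i / (zz_len i)%:R * (if ~~ odd k then zz_len i else 0%N)%:R -
    zz_amp i / (zz_len i)%:R * (if odd k then zz_len i else 0%N)%:R =
    (-1) ^+ odd k * zz_amp i.
  by case: (odd k) => /=; field; rewrite gt_eqF.
by rewrite exprMn sqrr_sign mul1r.
Qed.

(** For [t < i] the zigzag is coarser, and its Lipschitz bound over each short half period gives at
    most the ratio of amplitudes in total. For [t > i] it is finer and vanishes at all the turning
    points, which are even multiples of its half period. *)
Lemma qvar_zigzag_neq i t : (i < N)%N -> (t < N)%N -> t != i ->
  Num.sqrt (qvar (zigzag t) 0 (zz_path i)) <= m%:R^-1.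
Proof.
move=> iN tN; rewrite neq_ltn => /orP[ti|it].
  rewrite -[leRHS]ger0_norm ?invr_ge0// -sqrtr_sqr ler_wsqrtr//.
  have H k : (zigzag t (k.+1 * zz_len i)%N - zigzag t (k * zz_len i)%N) ^+ 2 <=
      (zz_amp i ^+ 2 / zz_amp t) ^+ 2.
    have A0 : 0 <= zz_amp i ^+ 2 / zz_amp t.
      by apply: divr_ge0; [exact: sqr_ge0|exact: ltW].
    rewrite -[leLHS]real_normK ?num_real// ler_sqr ?nnegrE//.
    rewrite (le_trans (zigzag_lip t _))// ?leq_mul2r ?leqnSn ?orbT//.
    rewrite -mulnBl subSnn mul1n !zz_len_amp//.
    rewrite le_eqVlt; apply/orP; left; apply/eqP; field.
    by rewrite !gt_eqF.
  rewrite -[X in qvar _ X _](mul0n (zz_len i)) (le_trans (qvar_progression _ _ H))//.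
  rewrite zz_count; have -> : (zz_amp i ^+ 2)^-1 * (zz_amp i ^+ 2 / zz_amp t) ^+ 2 =
      (zz_amp i / zz_amp t) ^+ 2 by field; rewrite !gt_eqF.
  have A0 : 0 <= zz_amp i / zz_amp t by apply: divr_ge0; exact: ltW.
  by rewrite ler_sqr ?nnegrE ?invr_ge0//; exact: zz_amp_ratio.
have -> : qvar (zigzag t) 0 (zz_path i) = 0.
  apply: qvar_eq0 => j; rewrite inE => /orP[/eqP ->|/mapP[k _ ->]]; first exact: zigzag0.
  rewrite /zigzag; have -> : (k * zz_len i = k * m ^ (2 * (t - i)) * zz_len t)%N.
    by rewrite -mulnA /zz_len -expnD; congr (_ * m ^ _)%N; lia.
  rewrite tri_mul oddM oddX (negbTE m_even) orbF muln_eq0 subn_eq0 leqNgt it /=.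
  by rewrite andbF mulr0.
by rewrite sqrtr0 invr_ge0.
Qed.

End Zigzag.

Lemma near_forall_lt (T : Type) (F : set_system T) (FF : Filter F) N (P : nat -> T -> Prop) :
  (forall i, \forall x \near F, P i x) ->
  \forall x \near F, forall i, (i < N)%N -> P i x.
Proof.
move=> FP; elim: N => [|N IH]; first by apply: filterS filterT.
apply: filterS2 IH (FP N) => x H PN i; rewrite ltnS leq_eqVlt => /orP[/eqP ->//|].
exact: H.
Qed.

(** * Finite profiles spread over sparse indices of J *)

Section StepFunctions.
Context {R : realType}.

Lemma qvar_map (x : nat -> R) (f : nat -> nat) a s :
  qvar x (f a) (map f s) = qvar (x \o f) a s.
Proof. by elim: s a => //= b s IH a; rewrite IH. Qed.

Lemma telescope_ge (c : nat -> R) L p : (p <= L)%N ->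
  \sum_(0 <= q < L) (c q - c q.+1) * (p <= q)%:R = c p - c L.
Proof.
elim: L => [|L IH]; first by rewrite leqn0 => /eqP ->; rewrite big_nil subrr.
rewrite leq_eqVlt => /orP[/eqP ->|].
  rewrite subrr big_nat big1// => q /andP[_ qL].
  by rewrite leqNgt qL mulr0.
rewrite ltnS => pL; rewrite big_nat_recr//= IH// pL mulr1.
by rewrite addrA subrK.
Qed.

Variables (nu : nat -> nat) (c : nat -> R) (L : nat).
Hypothesis nu_inc : {homo nu : p q / (p < q)%N}.

Definition clip l := (\sum_(0 <= q < L) (nu q <= l))%N.

(** Takes the value [c p - c L] between [nu p.-1] and [nu p], and 0 at the end. It is built from
    [jstep] because the action of S is known on tensors with steps. *)
Definition james_step : james R :=
  \sum_(0 <= q < L) (c q - c q.+1) *: jstep (nu q).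

Let nu_mono p q : (p <= q)%N -> (nu p <= nu q)%N.
Proof. by rewrite leq_eqVlt => /orP[/eqP ->//|/nu_inc /ltnW]. Qed.

Lemma james_stepE l : james_step l = c (clip l) - c L.
Proof.
rewrite /james_step james_sumE.
under eq_bigr do rewrite jamesZE jstepE.
rewrite /clip; elim: L => [|K IH]; first by rewrite !big_nil subrr.
rewrite !big_nat_recr//= IH; case: (leqP (nu K) l) => nl; last first.
  by rewrite addn0 mulr1 addrA subrK.
rewrite mulr0 addr0.
have -> : (\sum_(0 <= i < K) (nu i <= l) = K)%N.
  rewrite -[RHS]muln1 -[X in (X * 1)%N]subn0 -sum_nat_const_nat !big_nat.
  apply: eq_bigr => q /andP[_ qK].
  by rewrite (leq_trans (nu_mono (ltnW qK)) nl).
by rewrite addn1 !subrr.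
Qed.

Lemma clip_le l : (clip l <= L)%N.
Proof.
rewrite -[leqRHS]muln1 -[X in (_ <= X * 1)%N]subn0 -sum_nat_const_nat.
by apply: leq_sum => q _; exact: leq_b1.
Qed.

Lemma clip_mono a b : (a <= b)%N -> (clip a <= clip b)%N.
Proof.
move=> ab; apply: leq_sum => q _; case: (leqP (nu q) a) => // qa.
by rewrite (leq_trans qa ab).
Qed.

(** The quotient of [clip] by [L] is a clock that runs for at most one unit of time, and in this
    clock the profile is 1/2-Hoelder. *)
Lemma james_step_le (K : R) : 0 <= K -> (forall p q, (p < q)%N ->
    (c q - c p) ^+ 2 <= K ^+ 2 * ((q - p)%:R / L%:R)) ->
  `|james_step| <= K.
Proof.
move=> K0 Hc; apply: norm_james_le => // a s as_.
pose tau l : R := (clip l)%:R / L%:R.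
apply: le_trans (@qvar_holder _ _ tau (K ^+ 2) _ a s as_) _ => [p q pq|].
  rewrite !james_stepE opprB addrA subrK /tau -mulrBl -natrB; last exact: clip_mono (ltnW pq).
  have := clip_mono (ltnW pq); rewrite leq_eqVlt => /orP[/eqP ->|]; last exact: Hc.
  by rewrite subrr subnn mul0r mulr0 expr0n.
rewrite ler_piMr ?sqr_ge0// /tau -mulrBl.
have [->|L0] := eqVneq L 0%N; first by rewrite invr0 mulr0.
rewrite ler_pdivrMr ?ltr0n ?lt0n// mul1r.
rewrite lerBlDr (@le_trans _ _ L%:R) ?lerDl// ler_nat clip_le//.
Qed.

End StepFunctions.

(** * Sparse indices on which S acts like a scalar matrix *)

Section SparseIndices.
Context {R : realType}.
Variable S : bop (ell2J R) (ell2J R).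

(** For fixed [n] this tends to 0 as [r] grows, whereas letting [n] and then [r] tend to infinity
    gives the matrix entry of [resid S]. *)
Definition step_entry i j r n : R := S (l2tensor (l2_unit j) (jstep n)) i r.
Definition bistep_entry i j r : R := bidual_entry (biadjoint S (l2lift (l2_unit j))) i r.

Lemma step_entry_cvg0 i j n : step_entry i j r n @[r --> \oo] --> (0 : R).
Proof. exact: james_cvg0. Qed.

Lemma step_entry_cvg i j r :
  step_entry i j r n @[n --> \oo] --> bistep_entry i j r.
Proof. exact: (@l2lift_cvg R (l2_unit j) (bop_comp (l2J_coord i r) S)). Qed.

Lemma bistep_entry_cvg i j :
  bistep_entry i j r @[r --> \oo] --> l2_entry (resid S) i j.
Proof. exact: bidual_entry_cvg. Qed.

(** Each index is taken large in terms of the earlier ones. An entry read before the position of the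
    step is then close to the matrix entry, and one read after it is close to 0. *)
Lemma sparse_indices N (eta : R) : 0 < eta -> exists mu : nat -> nat,
  {homo mu : p q / (p < q)%N} /\
  forall p q i j, (p < q)%N -> (i < N)%N -> (j < N)%N ->
    `|l2_entry (resid S) i j - step_entry i j (mu p) (mu q)| <= eta /\
    `|step_entry i j (mu q) (mu p)| <= eta.
Proof.
move=> eta0; have eta20 : 0 < eta / 2 by rewrite divr_gt0.
have [K0 _ HK0] : \forall r \near \oo, forall i, (i < N)%N -> forall j, (j < N)%N ->
    `|l2_entry (resid S) i j - bistep_entry i j r| < eta / 2.
  apply: near_forall_lt => i; apply: near_forall_lt => j.
  by move/cvgrPdist_lt: (@bistep_entry_cvg i j) => /(_ _ eta20).
have /choice[T HT] k : exists M, forall n, (M <= n)%N -> forall r, (r < k.+1)%N ->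
    forall i, (i < N)%N -> forall j, (j < N)%N ->
    `|bistep_entry i j r - step_entry i j r n| < eta / 2 /\
    `|step_entry i j n r| < eta.
  suff [M _ HM] : \forall n \near \oo, forall r, (r < k.+1)%N ->
    forall i, (i < N)%N -> forall j, (j < N)%N ->
    `|bistep_entry i j r - step_entry i j r n| < eta / 2 /\
    `|step_entry i j n r| < eta by exists M.
  apply: near_forall_lt => r; apply: near_forall_lt => i; apply: near_forall_lt => j.
  move/cvgrPdist_lt: (@step_entry_cvg i j r) => /(_ _ eta20) h1.
  move/cvgrPdist_lt: (@step_entry_cvg0 i j r) => /(_ _ eta0) h2.
  by apply: filterS2 h1 h2 => n -> ; rewrite sub0r normrN.
pose mu := fix mu p := if p is p'.+1 then maxn (T (mu p')) (mu p').+1 else K0.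
have muS p : mu p.+1 = maxn (T (mu p)) (mu p).+1 by [].
have mu_inc : {homo mu : p q / (p < q)%N}.
  by apply: homo_ltn => [y x z|p]; [exact: ltn_trans|rewrite muS leq_maxr].
have muK p : (K0 <= mu p)%N.
  elim: p => // p IH; rewrite muS (leq_trans IH)// (leq_trans _ (leq_maxr _ _))//.
exists mu; split=> // p [//|q] i j; rewrite ltnS => pq iN jN.
have mupq : (mu p < (mu q).+1)%N.
  by rewrite ltnS; move: pq; rewrite leq_eqVlt => /orP[/eqP ->//|/mu_inc/ltnW].
have [h1 h2] := HT (mu q) (mu q.+1) (leq_maxl _ _) (mu p) mupq i iN j jN.
split; last exact: ltW.
have h3 := HK0 (mu p) (muK p) i iN j jN.
rewrite (le_trans (ler_distD (bistep_entry i j (mu p)) _ _))//.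
by rewrite ltW// [ltRHS]splitr ltrD.
Qed.

End SparseIndices.

(** * Regularity of R(S) *)

Section Regularity.
Context {R : realType}.

(** A crude bound suffices, since [e] can be chosen small in terms of the length of the path. *)
Lemma qvar_bounded (x : nat -> R) a s e : {in a :: s, forall j, `|x j| <= e} ->
  Num.sqrt (qvar x a s) <= (size s)%:R * (2 * e).
Proof.
move=> xe; have e0 : 0 <= e by rewrite (le_trans _ (xe a _)) ?mem_head.
have H : qvar x a s <= (size s)%:R * (2 * e) ^+ 2.
  elim: s a xe => [|b s IH] a xe /=; first by rewrite mul0r.
  rewrite -nat1r mulrDl mul1r lerD//; last by apply: IH => j js; rewrite xe// inE js orbT.
  rewrite -[leLHS]real_normK ?num_real// ler_sqr ?nnegrE ?mulr_ge0//.
  have := xe a; rewrite mem_head => /(_ isT); have := xe b; rewrite !inE eqxx orbT => /(_ isT).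
  by have := ler_normB (x b) (x a); lra.
rewrite -[leRHS]ger0_norm ?mulr_ge0// -sqrtr_sqr ler_wsqrtr// (le_trans H)//.
rewrite [leRHS]exprMn ler_wpM2r ?sqr_ge0// -natrX ler_nat.
by rewrite -[leqLHS]expn1; case: (size s) => // n; rewrite leq_pexp2l.
Qed.

Variables (S : bop (ell2J R) (ell2J R)) (w : ell2 R) (N m : nat).
Hypotheses (m_gt0 : (0 < m)%N) (m_even : ~~ odd m).

Local Notation a := (l2_entry (resid S)).
Let L := zz_total m N.
Let K : R := 1 + N%:R ^+ 2 / m%:R.
Let h t p : R := zigzag m N t p.
Let beta i : R := \sum_(0 <= j < N) `|a i j| * `|w j|.

(* The sign pattern makes row i of the matrix see the profiles with coefficient
   [beta i] on the i-th zigzag; any signs are allowed by [zigzag_holder]. *)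
Definition test_profile j p : R := \sum_(0 <= t < N) Num.sg (a t j) * h t p.

Let K_ge0 : 0 <= K. Proof. by rewrite addr_ge0// divr_ge0// sqr_ge0. Qed.

Let profile_total j : test_profile j L = 0.
Proof.
rewrite /test_profile big_nat big1// => t /andP[_ tN].
by rewrite /h zigzag_total// mulr0.
Qed.

Let profile_le (nu : nat -> nat) j : {homo nu : p q / (p < q)%N} ->
  `|james_step nu (test_profile j) L| <= K.
Proof.
move=> nu_inc; apply: james_step_le => // p q pq; apply: zigzag_holder => // t.
by rewrite normr_sg; case: (_ != _).
Qed.

Definition test_seq (nu : nat -> nat) k : james R :=
  if (k < N)%N then (`|w k| : R) *: james_step nu (test_profile k) L else 0.

Lemma test_seq_dom (nu : nat -> nat) (nu_inc : {homo nu : p q / (p < q)%N}) k :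
  `|test_seq nu k| <= K * `|w k|.
Proof.
rewrite /test_seq; case: ifP => _; last by rewrite normr0 mulr_ge0.
by rewrite normrZ normr_id mulrC ler_wpM2r// profile_le.
Qed.

Definition test_vector nu (nu_inc : {homo nu : p q / (p < q)%N}) : ell2J R :=
  L2Sum (l2_dom_summable K_ge0 (test_seq_dom nu_inc)).

Lemma test_vector_le nu (nu_inc : {homo nu : p q / (p < q)%N}) :
  `|test_vector nu_inc| <= K * `|w|.
Proof. exact: (@l2_dom_le _ _ _ w (test_vector nu_inc) K K_ge0 (test_seq_dom nu_inc)). Qed.

Lemma test_vector_sum nu (nu_inc : {homo nu : p q / (p < q)%N}) :
  test_vector nu_inc = \sum_(0 <= j < N) \sum_(0 <= q < L)
    (`|w j| * (test_profile j q - test_profile j q.+1)) *: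
      l2tensor (l2_unit j) (jstep (nu q)).
Proof.
apply/l2sumP => k; rewrite l2sum_sumE; under eq_bigr do rewrite l2sum_sumE.
have E j : \sum_(0 <= q < L) ((`|w j| * (test_profile j q - test_profile j q.+1)) *:
      l2tensor (l2_unit j) (jstep (nu q))) k =
    (k == j)%:R *: (`|w j| *: james_step nu (test_profile j) L).
  rewrite /james_step !scaler_sumr; apply: eq_bigr => q _.
  by rewrite l2sumZE /= /unit_seq !scalerA; congr (_ *: _); rewrite mulrC mulrA.
under eq_bigr do rewrite E.
rewrite /= /test_seq; case: ifP => kN.
  rewrite (bigD1_seq k) ?mem_index_iota ?iota_uniq//= eqxx scale1r addrC big1 ?add0r//.
  by move=> j jk; rewrite eq_sym (negbTE jk) scale0r.
rewrite big_nat big1// => j /andP[_ jN].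
by case: eqP jN kN => [->->//|_ _ _]; rewrite scale0r.
Qed.

Let err : R := \sum_(0 <= j < N) \sum_(0 <= q < L)
  `|(`|w j| * (test_profile j q - test_profile j q.+1))|.

(** Steps sit at the odd places of [mu] and the image is read at the even ones. Place [2 * p]
    precedes [2 * q + 1] exactly when [p <= q], so S acts on these steps like the matrix times that
    indicator, and Abel summation ([telescope_ge]) restores the profile. *)
Lemma test_vector_approx (mu : nat -> nat) (eta : R) i p
    (nu := fun q => mu (2 * q).+1) (nu_inc : {homo nu : p q / (p < q)%N}) :
  (forall p q i j, (p < q)%N -> (i < N)%N -> (j < N)%N ->
    `|a i j - step_entry S i j (mu p) (mu q)| <= eta /\
    `|step_entry S i j (mu q) (mu p)| <= eta) ->
  (i < N)%N -> (p <= L)%N ->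
  `|\sum_(0 <= j < N) `|w j| * a i j * test_profile j p -
    (S (test_vector nu_inc) i (mu (2 * p)%N) : R)| <= err * eta.
Proof.
move=> Hmu iN pL.
have -> : (S (test_vector nu_inc) i (mu (2 * p)%N) : R) =
    \sum_(0 <= j < N) \sum_(0 <= q < L)
      (`|w j| * (test_profile j q - test_profile j q.+1)) *
      step_entry S i j (mu (2 * p)%N) (nu q).
  rewrite test_vector_sum bop_sum l2sum_sumE james_sumE; apply: eq_bigr => j _.
  rewrite bop_sum l2sum_sumE james_sumE; apply: eq_bigr => q _.
  by rewrite bopZ l2sumZE jamesZE.
have E j : `|w j| * a i j * test_profile j p = \sum_(0 <= q < L)
    (`|w j| * (test_profile j q - test_profile j q.+1)) * (a i j * (p <= q)%:R).
  have -> : test_profile j p =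
      \sum_(0 <= q < L) (test_profile j q - test_profile j q.+1) * (p <= q)%:R.
    by rewrite telescope_ge// profile_total subr0.
  rewrite mulr_sumr.
  by apply: eq_bigr => q _; ring.
under eq_bigr do rewrite E.
rewrite -sumrB (le_trans (ler_norm_sum _ _ _))// mulr_suml !big_nat.
apply: ler_sum => j /andP[_ jN].
rewrite -sumrB (le_trans (ler_norm_sum _ _ _))// mulr_suml !big_nat.
apply: ler_sum => q _; rewrite -mulrBr normrM ler_wpM2l//.
case: (leqP p q) => pq; rewrite ?mulr1 ?mulr0 ?sub0r ?normrN.
  by have [] := Hmu (2 * p)%N (2 * q).+1 i j _ iN jN; rewrite // ltnS leq_mul2l pq.
have qp : ((2 * q).+1 < 2 * p)%N by lia.
by have [_] := Hmu _ _ i j qp iN jN.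
Qed.

Lemma test_profile_row i p : \sum_(0 <= j < N) `|w j| * a i j * test_profile j p =
  \sum_(0 <= t < N) (\sum_(0 <= j < N) `|w j| * a i j * Num.sg (a t j)) * h t p.
Proof.
rewrite /test_profile; under eq_bigr do rewrite mulr_sumr.
rewrite exchange_big; apply: eq_bigr => t _; rewrite mulr_suml.
by apply: eq_bigr => j _; rewrite mulrA.
Qed.

(** Row [i] of the image is close to a combination of zigzags with coefficient [beta i] on the
    [i]-th one and at most [beta i] in absolute value on the others. Along the turning points of the
    [i]-th zigzag each of the others adds at most [beta i / m]. *)
Lemma regular_row_le (e : R) : 0 < e -> exists x : ell2J R, `|x| <= K * `|w| /\
  forall i, (i < N)%N -> beta i * (1 - N%:R / m%:R) <= `|S x i| + e.
Proof.
move=> e0.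
have err0 : 0 <= err by apply: sumr_ge0 => j _; apply: sumr_ge0.
(* The path has at most [L] steps, each disturbed by at most [2 * err * eta]; the value
   [eta = e / D] keeps the total below [e]. The added 1 makes [D] positive. *)
pose D := L%:R * (2 * err) + 1.
have D0 : 0 < D by rewrite ltr_wpDl// !mulr_ge0.
have eta0 : 0 < e / D by rewrite divr_gt0.
have [mu [mu_inc Hmu]] := sparse_indices S N eta0.
pose nu q := mu (2 * q).+1.
have nu_inc : {homo nu : p q / (p < q)%N} by move=> p q pq; apply: mu_inc; lia.
exists (test_vector nu_inc); split; first exact: test_vector_le.
move=> i iN; set x := test_vector nu_inc.
pose v p : R := S x i (mu (2 * p)%N).
pose b t : R := \sum_(0 <= j < N) `|w j| * a i j * Num.sg (a t j).
pose g p : R := \sum_(0 <= t < N) b t * h t p.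
pose s := zz_path m N i.
have s0 : path ltn 0%N s.
  by rewrite -(mul0n (zz_len m N i)); apply: progression_path; rewrite expn_gt0 m_gt0.
have sL : {in 0%N :: s, forall p, (p <= L)%N}.
  move=> p; rewrite inE => /orP[/eqP ->//|/progression_le].
  by rewrite add0n /L (zz_len_total m iN).
have gv : {in 0%N :: s, forall p, `|g p - v p| <= err * (e / D)}.
  by move=> p /sL pL; rewrite /g -test_profile_row; exact: test_vector_approx.
have vS : Num.sqrt (qvar v 0 s) <= `|S x i|.
  rewrite -[leRHS]ger0_norm// -sqrtr_sqr ler_wsqrtr//.
  rewrite -[qvar v _ _](@qvar_map _ (S x i) (fun p => mu (2 * p)%N)) qvar_le//.
  by apply: homo_path s0 => p q pq; apply: mu_inc; lia.
have bii : b i = beta i.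
  by apply: eq_bigr => j _; rewrite -mulrA -[a i j * _]mulrC -normrEsg mulrC.
have bt t : `|b t| <= beta i.
  rewrite (le_trans (ler_norm_sum _ _ _))//; apply: ler_sum => j _.
  rewrite !normrM normr_id [leRHS]mulrC ler_piMr ?mulr_ge0//.
  by rewrite normr_sg; case: (_ != _).
have beta0 : 0 <= beta i by rewrite (le_trans _ (bt i)).
(* The other zigzags with opposite sign, so that the [i]-th one is the sampled image plus two small
   terms and the triangle inequality bounds [beta i] from above. *)
pose b' t := if t == i then 0 else - b t.
have split_h p : b i * h i p = v p + ((g p - v p) + \sum_(0 <= t < N) b' t * h t p).
  rewrite addrA [v p + _]addrC subrK /g -big_split /=.
  rewrite (bigD1_seq i) ?mem_index_iota ?iota_uniq//= /b' eqxx mul0r addr0.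
  by rewrite big1 ?addr0// => t ti; rewrite (negbTE ti) mulNr subrr.
have low : beta i <= Num.sqrt (qvar (fun p => b i * h i p) 0 s).
  rewrite qvarZ sqrtrM ?sqr_ge0// sqrtr_sqr bii ger0_norm// ler_peMr//.
  by rewrite -[leLHS]sqrtr1 ler_wsqrtr// qvar_zigzag.
have err_le : Num.sqrt (qvar (g \- v) 0 s) <= e.
  rewrite (le_trans (qvar_bounded gv))// /s size_map size_iota.
  have X0 : 0 <= 2 * (err * (e / D)).
    by apply: mulr_ge0 => //; apply: mulr_ge0 => //; exact: ltW.
  apply: (@le_trans _ _ (L%:R * (2 * (err * (e / D))))).
    rewrite (ler_wpM2r X0)// ler_nat.
    by apply: leq_pexp2l => //; rewrite leq_mul2l.
  have -> : L%:R * (2 * (err * (e / D))) = L%:R * (2 * err) / D * e by ring.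
  by rewrite ler_piMl ?(ltW e0)// ler_pdivrMr// mul1r lerDl.
have rest : Num.sqrt (qvar (fun p => \sum_(0 <= t < N) b' t * h t p) 0 s) <=
    beta i * (N%:R / m%:R).
  rewrite (le_trans (qvar_sum_le _ _ _ _))//.
  apply: (@le_trans _ _ (\sum_(0 <= t < N) beta i / m%:R)); last first.
    by rewrite sumr_const_nat subn0 -[leLHS]mulr_natl mulrCA.
  rewrite !big_nat; apply: ler_sum => t /andP[_ tN].
  rewrite qvarZ sqrtrM ?sqr_ge0// sqrtr_sqr /b'; case: eqP => [_|/eqP ti].
    by rewrite normr0 mul0r divr_ge0.
  rewrite normrN ler_pM//; first exact: sqrtr_ge0.
  exact: qvar_zigzag_neq.
have : beta i <= `|S x i| + (e + beta i * (N%:R / m%:R)).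
  rewrite (le_trans low)// (@eq_qvar _ _ (v \+ ((g \- v) \+
    fun p => \sum_(0 <= t < N) b' t * h t p))) => [|p _]; last exact: split_h.
  rewrite (le_trans (qvar_triangle _ _ _ _))// lerD//.
  by rewrite (le_trans (qvar_triangle _ _ _ _))// lerD.
lra.
Qed.

End Regularity.

Section RegularBound.
Context {R : realType}.
Implicit Types (S : bop (ell2J R) (ell2J R)) (w : ell2 R).

(** Sum the row estimates for fixed [N] and let the even ratio [m] of consecutive amplitudes tend to
    infinity: both correction factors tend to 1. *)
Lemma regular_sum_le S w N :
  \sum_(0 <= i < N) (\sum_(0 <= j < N) `|l2_entry (resid S) i j| * `|w j|) ^+ 2 <=
  (`|S| * `|w|) ^+ 2.
Proof.
set beta := fun i => \sum_(0 <= j < N) `|l2_entry (resid S) i j| * `|w j|.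
have beta0 i : 0 <= beta i by apply: sumr_ge0 => j _; rewrite mulr_ge0.
pose P := Num.sqrt (\sum_(0 <= i < N) beta i ^+ 2).
pose Q := `|S| * `|w|.
have P0 : 0 <= P by exact: sqrtr_ge0.
have Q0 : 0 <= Q by rewrite mulr_ge0.
suff PQ : P <= Q by rewrite -[leLHS]sqr_sqrtr ?sqr_sum_ge0// ler_sqr.
have key m : (0 < m)%N -> ~~ odd m -> (N <= m)%N ->
    P * (1 - N%:R / m%:R) <= (1 + N%:R ^+ 2 / m%:R) * Q.
  move=> m0 me Nm; set kap := 1 - _; set K := 1 + _.
  have mR : 0 < m%:R :> R by rewrite ltr0n.
  have kap0 : 0 <= kap by rewrite subr_ge0 ler_pdivrMr// mul1r ler_nat.
  apply/ler_addgt0Pr => e e0.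
  have d0 : 0 < e / N.+1%:R by rewrite divr_gt0.
  have [x [xK Hx]] := regular_row_le S w N m0 me d0.
  have -> : P * kap = Num.sqrt (\sum_(0 <= i < N) (kap * beta i) ^+ 2).
    by rewrite sqrt_sumZ ger0_norm// mulrC.
  apply: (@le_trans _ _ (Num.sqrt (\sum_(0 <= i < N) (`|S x i| + e / N.+1%:R) ^+ 2))).
    rewrite ler_wsqrtr// !big_nat; apply: ler_sum => i /andP[_ iN].
    have h : kap * beta i <= `|S x i| + e / N.+1%:R by rewrite mulrC; exact: Hx.
    have h0 : 0 <= kap * beta i by rewrite mulr_ge0.
    by rewrite ler_sqr ?nnegrE// (le_trans h0).
  rewrite (le_trans (minkowski_sum _ _ _))// lerD//.
    rewrite (le_trans (partial_norm_le (S x) N))// (le_trans (bop_norm_le S x))//.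
    by rewrite /Q mulrCA ler_wpM2l.
  rewrite -[leRHS]ger0_norm ?(ltW e0)// -sqrtr_sqr ler_wsqrtr//.
  rewrite sumr_const_nat subn0 -[_ *+ N]mulr_natl.
  have -> : N%:R * (e / N.+1%:R) ^+ 2 = N%:R / N.+1%:R ^+ 2 * e ^+ 2 by rewrite exprMn exprVn; ring.
  rewrite ler_piMl ?sqr_ge0// ler_pdivrMr ?exprn_gt0// mul1r -natrX ler_nat.
  by rewrite expnS expn1 mulSn; lia.
rewrite leNgt; apply/negP => QP.
have PQ0 : 0 < P - Q by rewrite subr_gt0.
(* The inequality [key], multiplied by [m], reads [m * (P - Q) <= N * P + N ^ 2 * Q], which fails
   once [m > c]. *)
pose c := (N%:R * P + N%:R ^+ 2 * Q) / (P - Q).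
have [t ct] : exists t, c < t.+1%:R by exists (Num.truncn c); exact: truncnS_gt.
pose m := (2 * (maxn N t.+1))%N.
have m0 : (0 < m)%N by rewrite /m; lia.
have mR : 0 < m%:R :> R by rewrite ltr0n.
have := key m m0 _ _; rewrite oddM /= => /(_ isT).
have Nm : (N <= m)%N by rewrite /m; lia.
move=> /(_ Nm); rewrite leNgt => /negP; apply.
have cm : c < m%:R.
  by rewrite (lt_le_trans ct)// ler_nat /m; lia.
rewrite -(ltr_pM2r mR).
have -> : (1 + N%:R ^+ 2 / m%:R) * Q * m%:R = m%:R * Q + N%:R ^+ 2 * Q.
  by field; rewrite gt_eqF.
have -> : P * (1 - N%:R / m%:R) * m%:R = m%:R * P - N%:R * P.
  by field; rewrite gt_eqF.
rewrite /c ltr_pdivrMr// in cm; rewrite ltrBrDr -addrA [_ + N%:R * P]addrC.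
by rewrite -ltrBrDl -mulrBr.
Qed.

(** Square sections of the modulus are bounded by [regular_sum_le], rectangular ones by
    monotonicity, and [matrix_op] assembles the operator. *)
Lemma regular_resid S : exists B, is_modulus (resid S) B /\ `|B| <= `|S|.
Proof.
pose b i j := `|l2_entry (resid S) i j|.
have b0 i j : 0 <= b i j by exact: normr_ge0.
have bw w n p : \sum_(0 <= i < n) (\sum_(0 <= j < p) b i j * `|w j|) ^+ 2 <=
    (`|S| * `|w|) ^+ 2.
  pose N := maxn n p.
  rewrite (le_trans _ (regular_sum_le S w N))//.
  have ge0 q i : 0 <= \sum_(0 <= j < q) b i j * `|w j|.
    by apply: sumr_ge0 => j _; rewrite mulr_ge0.
  apply: (@le_trans _ _ (\sum_(0 <= i < n) (\sum_(0 <= j < N) b i j * `|w j|) ^+ 2)).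
    apply: ler_sum => i _; rewrite ler_sqr ?nnegrE//.
    rewrite [leRHS](big_cat_nat (n := p)) ?leq_maxr//= lerDl.
    by apply: sumr_ge0 => j _; rewrite mulr_ge0.
  rewrite [leRHS](big_cat_nat (n := n)) ?leq_maxl//= lerDl.
  by apply: sumr_ge0 => i _; rewrite sqr_ge0.
have [|w i|w n|B [BE BS]] := @matrix_op R b `|S| _ _ _.
- exact: normr_ge0.
- apply: (@normed_cvg _ _ (fun j => b i j * w j)).
  apply: nondecreasing_is_cvgn; first by apply: nondecreasing_series => k _ _; exact: normr_ge0.
  exists (`|S| * `|w|) => _ [p _ <-].
  have ge0 : 0 <= \sum_(0 <= j < p) b i j * `|w j|.
    by apply: sumr_ge0 => j _; rewrite mulr_ge0.
  apply: (@le_trans _ _ (\sum_(0 <= j < p) b i j * `|w j|)).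
    by apply: ler_sum => j _; rewrite /= normrM [`|b i j|]ger0_norm.
  rewrite -ler_sqr ?nnegrE ?mulr_ge0// (le_trans _ (bw w i.+1 p))//.
  by rewrite big_nat_recr//= lerDr sumr_ge0// => j _; rewrite sqr_ge0.
- apply: nearW => p; rewrite -exprMn (le_trans _ (bw w n p))//.
  apply: ler_sum => i _; rewrite -[leLHS]real_normK ?num_real// ler_sqr ?nnegrE//; last first.
    by apply: sumr_ge0 => j _; rewrite mulr_ge0.
  rewrite (le_trans (ler_norm_sum _ _ _))// ler_sum// => j _.
  by rewrite normrM [`|b i j|]ger0_norm.
by exists B; split.
Qed.

Lemma reg_norm_resid_le S : reg_norm (resid S) <= `|S|.
Proof. by have [B [BE BS]] := regular_resid S; rewrite /reg_norm (op_modulusE BE). Qed.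

Lemma resid_tensor_exists A : Reg A -> exists S, resid S = A /\ `|S| <= reg_norm A.
Proof.
move=> [B AB]; exists (tensor_op AB); rewrite resid_tensor_op; split=> //.
by rewrite /reg_norm (op_modulusE AB); exact: tensor_op_le.
Qed.

(** The matrix depends only on the class of S, so its regular norm is at most that of every [S - U].
    The tensor operator with the same matrix lies in this class and its norm does not exceed the
    regular norm. *)
Lemma w_norm_resid S : w_norm S = reg_norm (resid S).
Proof.
apply/eqP; rewrite eq_le; apply/andP; split.
  have [|T [TS TS_le]] := @resid_tensor_exists (resid S).
    by have [B []] := regular_resid S; exists B.
  apply: le_trans TS_le; apply: ge_inf; first by exists 0 => _ [U _ <-].
  exists (S - T); last by rewrite opprB addrC subrK.
  by rewrite /= -resid_eq TS.
apply: lb_le_inf; first by exists `|S - 0|, 0 => //=; rewrite rpred0.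
move=> _ [U /= UW <-]; suff -> : resid S = resid (S - U) by exact: reg_norm_resid_le.
by apply/eqP; rewrite resid_eq opprB addrC subrK.
Qed.

Lemma range_calkin_rep : range (@calkin_rep R) = Reg (R := R).
Proof.
apply/seteqP; split=> [_ [a _ <-]|A /resid_tensor_exists[S [SA _]]].
  by have [B []] := regular_resid (repr a); exists B.
by exists (weak_calkin_pi S) => //; rewrite calkin_rep_pi.
Qed.

Lemma calkin_rep_norm (a : weak_calkin (ell2J R)) : reg_norm (calkin_rep a) = quot_norm a.
Proof. by rewrite -[a]quot_piK quot_norm_pi calkin_rep_pi -w_norm_resid. Qed.

End RegularBound.

(** * Walsh blocks *)

Section DyadicBlocks.
Context {R : realType}.

Lemma sum_nat_split (V : nmodType) n k (F : nat -> V) :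
  \sum_(0 <= i < n + k) F i = \sum_(0 <= i < n) F i + \sum_(0 <= i < k) F (n + i)%N.
Proof.
elim: k => [|k IH]; first by rewrite addn0 [X in _ + X]big_nil addr0.
by rewrite addnS !big_nat_recr//= IH addrA.
Qed.

(* The k-th dyadic block of indices is [2 ^ k - 1, 2 ^ k.+1 - 1). *)
Definition offset k := (2 ^ k).-1.
Definition level i := trunc_log 2 i.+1.

Lemma offsetS k : offset k.+1 = (offset k + 2 ^ k)%N.
Proof. by rewrite /offset expnS; have := expn_gt0 2 k; lia. Qed.

Lemma level_offset k r : (r < 2 ^ k)%N -> level (offset k + r) = k.
Proof.
move=> rk; apply: trunc_log_eq => //.
by rewrite /offset expnS; have := expn_gt0 2 k; lia.
Qed.

Lemma sum_blocks (V : nmodType) q (F : nat -> V) : \sum_(0 <= i < offset q) F i =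
  \sum_(0 <= k < q) \sum_(0 <= r < 2 ^ k) F (offset k + r)%N.
Proof.
elim: q => [|q IH]; first by rewrite !big_nil.
by rewrite offsetS sum_nat_split IH big_nat_recr.
Qed.

Lemma leq_offset n : (n <= offset n)%N.
Proof. by have := ltn_expl n (isT : (1 < 2)%N); rewrite /offset; lia. Qed.

Lemma level_ge k j : (offset k <= j)%N -> (k <= level j)%N.
Proof.
move=> kj; rewrite /level -[leqLHS](@trunc_expnK 2)//; apply: leq_trunc_log.
by move: kj; rewrite /offset; have := expn_gt0 2 k; lia.
Qed.

Definition block_entry (V : nat -> nat -> nat -> R) i j : R :=
  if level i == level j then V (level i) (i - offset (level i))%N (j - offset (level i))%N
  else 0.

Lemma block_entryE V k r l s : (r < 2 ^ k)%N -> (s < 2 ^ l)%N ->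
  block_entry V (offset k + r) (offset l + s) = if k == l then V k r s else 0.
Proof.
move=> rk sl; rewrite /block_entry !level_offset//; case: eqP => // <-.
by rewrite !addKn.
Qed.

Lemma level_lt i q : (i < offset q)%N -> (level i < q)%N.
Proof.
move=> iq; rewrite ltnNge; apply/negP => qi.
have := @trunc_logP 2 i.+1 isT isT; rewrite -/(level i).
have := leq_pexp2l (isT : (0 < 2)%N) qi; move: iq; rewrite /offset.
by have := expn_gt0 2 q; lia.
Qed.

Lemma block_entry_row V q i m (w : nat -> R) : (i < offset q)%N -> (offset q <= m)%N ->
  \sum_(0 <= j < m) block_entry V i j * w j = \sum_(0 <= j < offset q) block_entry V i j * w j.
Proof.
move=> iq qm; rewrite (big_cat_nat (n := offset q))//=.
rewrite [X in _ + X]big_nat [X in _ + X]big1 ?addr0//.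
move=> j /andP[qj _]; rewrite /block_entry ifF ?mul0r//.
by apply/negbTE; rewrite neq_ltn (leq_trans (level_lt iq) (level_ge qj)).
Qed.

Lemma block_entry_sum V q k r (w : nat -> R) : (k < q)%N -> (r < 2 ^ k)%N ->
  \sum_(0 <= j < offset q) block_entry V (offset k + r) j * w j =
  \sum_(0 <= s < 2 ^ k) V k r s * w (offset k + s)%N.
Proof.
move=> kq rk; rewrite sum_blocks (bigD1_seq k) ?mem_index_iota ?iota_uniq//=.
rewrite [X in _ + X]big1 ?addr0 => [|l lk].
  by rewrite !big_nat; apply: eq_bigr => s /andP[_ sk]; rewrite block_entryE// eqxx.
rewrite big_nat big1// => s /andP[_ sl]; rewrite block_entryE//.
by rewrite eq_sym (negbTE lk) mul0r.
Qed.

(** The blocks act on disjoint sets of coordinates, so a common bound on them bounds the whole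
    operator. *)
Lemma block_op V (C : R) : 0 <= C ->
  (forall k (x : nat -> R), \sum_(0 <= r < 2 ^ k) (\sum_(0 <= s < 2 ^ k) V k r s * x s) ^+ 2 <=
    C ^+ 2 * \sum_(0 <= s < 2 ^ k) x s ^+ 2) ->
  exists B : bop (ell2 R) (ell2 R), (forall i j, l2_entry B i j = block_entry V i j) /\ `|B| <= C.
Proof.
move=> C0 VC; apply: matrix_op => // [w i|w n].
  apply/cvg_ex; exists (\sum_(0 <= j < offset i.+1) block_entry V i j * w j).
  apply: cvg_near_cst; near=> m; apply: block_entry_row; first exact: leq_offset.
  by near: m; exact: nbhs_infty_ge.
near=> m; have nm : (offset n <= m)%N by near: m; exact: nbhs_infty_ge.
apply: (@le_trans _ _ (\sum_(0 <= i < offset n) (\sum_(0 <= j < m) block_entry V i j * w j) ^+ 2)).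
  rewrite [leRHS](big_cat_nat (n := n)) ?leq_offset//= lerDl.
  by apply: sumr_ge0 => i _; rewrite sqr_ge0.
rewrite big_nat; under eq_bigr => i /andP[_ iq] do rewrite (block_entry_row _ _ iq nm).
rewrite -big_nat sum_blocks.
apply: (@le_trans _ _ (\sum_(0 <= k < n) (C ^+ 2 * \sum_(0 <= s < 2 ^ k) w (offset k + s)%N ^+ 2))).
  rewrite !big_nat; apply: ler_sum => k /andP[_ kn].
  rewrite big_nat; under eq_bigr => r /andP[_ rk] do rewrite (block_entry_sum _ _ kn rk).
  by rewrite -big_nat; exact: VC.
rewrite -mulr_sumr ler_wpM2l ?sqr_ge0// -(sum_blocks _ (fun j => w j ^+ 2)).
rewrite (le_trans _ (l2_sum_le w (offset n)))//.
by apply: ler_sum => j _; rewrite real_normK ?num_real.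
Unshelve. all: by end_near. Qed.

(** Sylvester's recursion for Hadamard matrices: three copies of the previous matrix and its
    negative in the last corner. *)
Fixpoint walsh k i j : R :=
  if k is k'.+1 then
    let n := (2 ^ k')%N in
    if (i < n)%N then (if (j < n)%N then walsh k' i j else walsh k' i (j - n)%N)
    else (if (j < n)%N then walsh k' (i - n)%N j else - walsh k' (i - n)%N (j - n)%N)
  else 1.

Lemma walsh_norm k i j : `|walsh k i j| = 1.
Proof.
elim: k i j => [|k IH] i j /=; first exact: normr1.
by case: ifP => _; case: ifP => _; rewrite ?normrN IH.
Qed.

(** With [a] and [b] the images of the two halves, the halves of the result are [a + b] and [a - b];
    the parallelogram identity doubles the constant. *)
Lemma walsh_isometry k (x : nat -> R) :
  \sum_(0 <= r < 2 ^ k) (\sum_(0 <= s < 2 ^ k) walsh k r s * x s) ^+ 2 =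
  2 ^+ k * \sum_(0 <= s < 2 ^ k) x s ^+ 2.
Proof.
elim: k x => [|k IH] x; first by rewrite !big_nat1 mul1r mul1r.
set n := (2 ^ k)%N; have -> : (2 ^ k.+1 = n + n)%N by rewrite expnS mul2n addnn.
pose a r := \sum_(0 <= s < n) walsh k r s * x s.
pose b r := \sum_(0 <= s < n) walsh k r s * x (n + s)%N.
rewrite !sum_nat_split.
have -> : \sum_(0 <= r < n) (\sum_(0 <= s < n + n) walsh k.+1 r s * x s) ^+ 2 =
    \sum_(0 <= r < n) (a r + b r) ^+ 2.
  rewrite !big_nat; apply: eq_bigr => r /andP[_ rn]; congr (_ ^+ 2).
  rewrite sum_nat_split /a /b; congr (_ + _); rewrite !big_nat; apply: eq_bigr => s /andP[_ sn].
    by rewrite /= -/n rn sn.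
  by rewrite /= -/n rn ltnNge leq_addr /= addKn.
have -> : \sum_(0 <= r < n) (\sum_(0 <= s < n + n) walsh k.+1 (n + r) s * x s) ^+ 2 =
    \sum_(0 <= r < n) (a r - b r) ^+ 2.
  rewrite !big_nat; apply: eq_bigr => r /andP[_ rn]; congr (_ ^+ 2).
  rewrite sum_nat_split /a /b -sumrN; congr (_ + _); rewrite !big_nat;
    apply: eq_bigr => s /andP[_ sn].
    by rewrite /= -/n [(n + r < n)%N]ltnNge leq_addr sn /= addKn.
  by rewrite /= -/n ![(n + _ < n)%N]ltnNge !leq_addr /= !addKn mulNr.
rewrite -big_split /=.
have -> : \sum_(0 <= r < n) ((a r + b r) ^+ 2 + (a r - b r) ^+ 2) =
    2 * (\sum_(0 <= r < n) a r ^+ 2 + \sum_(0 <= r < n) b r ^+ 2).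
  rewrite -big_split mulr_sumr; apply: eq_bigr => r _ /=; ring.
by rewrite (IH x) (IH (fun s => x (n + s)%N)) -mulrDr mulrA exprS.
Qed.

Definition walsh_kernel (c : nat -> R) k r s := c k * walsh k r s.

Lemma walsh_op (c : nat -> R) (C : R) : 0 <= C -> (forall k, c k ^+ 2 * 2 ^+ k <= C ^+ 2) ->
  exists B : bop (ell2 R) (ell2 R),
    (forall i j, l2_entry B i j = block_entry (walsh_kernel c) i j) /\ `|B| <= C.
Proof.
move=> C0 cC; apply: block_op => // k x.
have -> : \sum_(0 <= r < 2 ^ k) (\sum_(0 <= s < 2 ^ k) walsh_kernel c k r s * x s) ^+ 2 =
    c k ^+ 2 * \sum_(0 <= r < 2 ^ k) (\sum_(0 <= s < 2 ^ k) walsh k r s * x s) ^+ 2.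
  rewrite mulr_sumr; apply: eq_bigr => r _; rewrite -exprMn; congr (_ ^+ 2).
  by rewrite mulr_sumr; apply: eq_bigr => s _; rewrite mulrA.
by rewrite walsh_isometry mulrA ler_wpM2r// sqr_sum_ge0.
Qed.

(** In the modulus the [k]-th block is constant, and the all-ones matrix of size [2 ^ k] has norm at
    most [2 ^ k] by Cauchy-Schwarz. *)
Lemma walsh_modulus (c : nat -> R) (C : R) : 0 <= C -> (forall k, c k ^+ 2 * 4 ^+ k <= C ^+ 2) ->
  exists B : bop (ell2 R) (ell2 R),
    forall i j, l2_entry B i j = `|block_entry (walsh_kernel c) i j|.
Proof.
move=> C0 cC.
have [|B [BE _]] := @block_op (fun k _ _ => `|c k|) C C0.
  move=> k x; under eq_bigr do rewrite -mulr_sumr.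
  rewrite sumr_const_nat subn0 exprMn real_normK ?num_real//.
  apply: (@le_trans _ _ (c k ^+ 2 * 4 ^+ k * \sum_(0 <= s < 2 ^ k) x s ^+ 2)); last first.
    by rewrite ler_wpM2r// sqr_sum_ge0.
  rewrite -[leLHS]mulr_natl mulrCA -mulrA ler_wpM2l ?sqr_ge0//.
  have := cauchy_schwarz_sum (index_iota 0 (2 ^ k)) (fun=> 1) x.
  under eq_bigr do rewrite mul1r; rewrite sumr_const_nat subn0 expr1n => h.
  rewrite (_ : 4 ^+ k = (2 ^ k)%:R * (2 ^ k)%:R :> R); last by rewrite -natrM -expnMn natrX.
  by rewrite -mulrA ler_wpM2l.
exists B => i j; rewrite BE /block_entry; case: ifP => _; last by rewrite normr0.
by rewrite normrM walsh_norm mulr1.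
Qed.

End DyadicBlocks.

(** * A norm limit of regular operators that is not regular *)

Section NotClosed.
Context {R : realType}.
Local Notation c := (fun k => (2 / 3) ^+ k : R).

Lemma level_seq_sum k n : \sum_(0 <= i < n) (level i == k)%:R ^+ 2 <= 2 ^+ k :> R.
Proof.
apply: (@le_trans _ _ (\sum_(0 <= i < offset n) (level i == k)%:R ^+ 2)).
  rewrite [leRHS](big_cat_nat (n := n)) ?leq_offset//= lerDl.
  by apply: sumr_ge0 => i _; rewrite sqr_ge0.
rewrite sum_blocks; case: (ltnP k n) => kn; last first.
  rewrite big_nat big1 ?exprn_ge0// => l /andP[_ ln].
  rewrite big_nat big1// => r /andP[_ rl]; rewrite level_offset//.
  by rewrite (ltn_eqF (leq_trans ln kn)) expr0n.
rewrite (bigD1_seq k) ?mem_index_iota ?iota_uniq//= [X in _ + X]big1 ?addr0 => [|l lk].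
  rewrite big_nat (eq_bigr (fun=> 1)) => [|r /andP[_ rk]]; last first.
    by rewrite level_offset// eqxx expr1n.
  by rewrite -big_nat sumr_const_nat subn0 natrX.
rewrite big_nat big1// => r /andP[_ rl]; rewrite level_offset//.
by rewrite (negbTE lk) expr0n.
Qed.

Lemma level_seq_summable k : (fun i => (level i == k)%:R : R^o) \in square_summable R^o.
Proof.
apply/square_summableP; exists (Num.sqrt (2 ^+ k)) => n.
rewrite ler_wsqrtr// (le_trans _ (level_seq_sum k n))//.
by apply: ler_sum => i _; rewrite real_normK ?num_real.
Qed.

Definition level_seq k : ell2 R := L2Sum (level_seq_summable k).

(** A modulus would send the indicator of the [k]-th block to a vector with entries at least
    [(4 / 3) ^+ k] on that block, so its norm would be at least [(4 / 3) ^+ k] for every [k]. *)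
Lemma walsh_not_regular (A : bop (ell2 R) (ell2 R)) :
  (forall i j, l2_entry A i j = block_entry (walsh_kernel c) i j) -> ~ Reg A.
Proof.
move=> AE [B AB].
have c0 k : 0 <= c k by rewrite exprn_ge0// divr_ge0.
have ABE k r s : (r < 2 ^ k)%N -> (s < 2 ^ k)%N ->
    l2_entry B (offset k + r) (offset k + s) = c k.
  move=> rk sk; rewrite AB AE block_entryE// eqxx /walsh_kernel normrM walsh_norm mulr1.
  by rewrite ger0_norm.
have B0 i j : 0 <= l2_entry B i j by rewrite AB.
have Brow k r : (r < 2 ^ k)%N -> (4 / 3) ^+ k <= (B (level_seq k) (offset k + r)%N : R).
  move=> rk; apply: (cvgr_to_ge (@l2_entry_cvg R B (level_seq k) (offset k + r)%N)).
  near=> n; have kn : (offset k.+1 <= n)%N by near: n; exact: nbhs_infty_ge.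
  have pos a b : 0 <= \sum_(a <= j < b) l2_entry B (offset k + r)%N j * level_seq k j.
    by apply: sumr_ge0 => j _; rewrite mulr_ge0//= ler0n.
  rewrite (big_cat_nat (n := offset k.+1))//= ler_wpDr//.
  rewrite offsetS sum_nat_split ler_wpDl//.
  rewrite big_nat (eq_bigr (fun=> c k)) => [|s /andP[_ sk]]; last first.
    by rewrite ABE//= level_offset// eqxx mulr1.
  rewrite -big_nat sumr_const_nat subn0 -[leRHS]mulr_natr natrX -exprMn.
  by rewrite (_ : 4 / 3 = 2 / 3 * 2 :> R)//; lra.
have Bk k : (16 / 9) ^+ k <= `|B| ^+ 2.
  have lk : `|level_seq k| ^+ 2 <= 2 ^+ k.
    apply: l2_sqnorm_leP; first by rewrite exprn_ge0.
    move=> n; rewrite (le_trans _ (level_seq_sum k n))//.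
    by apply: ler_sum => i _; rewrite real_normK ?num_real.
  have h : `|B (level_seq k)| ^+ 2 <= `|B| ^+ 2 * 2 ^+ k.
    apply: (@le_trans _ _ (`|B| ^+ 2 * `|level_seq k| ^+ 2)); last by rewrite ler_wpM2l ?sqr_ge0.
    by rewrite -exprMn ler_sqr ?nnegrE ?mulr_ge0// bop_norm_le.
  rewrite -(ler_pM2r (_ : 0 < 2 ^+ k)) ?exprn_gt0// (le_trans _ h)//.
  rewrite (le_trans _ (l2_sum_le _ (offset k.+1)))// offsetS sum_nat_split.
  rewrite ler_wpDl//; first by apply: sumr_ge0 => i _; rewrite sqr_ge0.
  have -> : (16 / 9) ^+ k * 2 ^+ k = \sum_(0 <= r < 2 ^ k) ((4 / 3) ^+ k) ^+ 2 :> R.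
    rewrite sumr_const_nat subn0 -[RHS]mulr_natr natrX exprAC.
    by rewrite (_ : 16 / 9 = (4 / 3) ^+ 2 :> R)//; field.
  rewrite !big_nat; apply: ler_sum => r /andP[_ rk].
  have h0 : 0 <= (4 / 3) ^+ k :> R by rewrite exprn_ge0// divr_ge0.
  rewrite real_normK ?num_real// ler_sqr ?nnegrE//; first exact: Brow.
  exact: le_trans h0 (Brow k r rk).
have bern k : k%:R <= 2 * (16 / 9) ^+ k :> R.
  elim: k => [|k IH]; first by rewrite mulr_ge0// exprn_ge0// divr_ge0.
  have h1 : 1 <= (16 / 9) ^+ k :> R by rewrite exprn_ege1//; lra.
  by rewrite -natr1 exprS; lra.
have [t ht] : exists t : nat, 2 * `|B| ^+ 2 < t%:R.
  by exists (Num.truncn (2 * `|B| ^+ 2)).+1; exact: truncnS_gt.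
by have := bern t; have := Bk t; lra.
Unshelve. all: by end_near. Qed.

Lemma Reg_not_closed : ~ closed (Reg (R := R)).
Proof.
move=> Rcl.
have [|A [AE _]] := @walsh_op R c 1 ler01.
  move=> k; rewrite expr1n exprAC -exprMn exprn_ile1//; lra.
apply: (walsh_not_regular AE).
(* Keeps the first [n] blocks; the remaining operator has squared norm at most [(8 / 9) ^+ n]. *)
pose cn n k : R := if (k < n)%N then c k else 0.
pose rho : R := 8 / 9.
have rho01 : 0 <= rho < 1 by rewrite /rho; lra.
have An n : exists B : bop (ell2 R) (ell2 R), Reg B /\ `|A - B| ^+ 2 <= rho ^+ n.
  have [|B [BE _]] := @walsh_op R (cn n) 1 ler01.
    move=> k; rewrite /cn; case: ifP => _; last by rewrite expr0n mul0r expr1n.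
    rewrite expr1n exprAC -exprMn exprn_ile1//; lra.
  (* The bound [2 ^+ n] is crude: the kept blocks have moduli of norm at most [(4 / 3) ^+ k] with
     [k < n]. *)
  have [| |B' B'E] := @walsh_modulus R (cn n) (2 ^+ n).
    by rewrite exprn_ge0.
    move=> k; rewrite /cn; case: ifP => kn; last by rewrite expr0n mul0r sqr_ge0.
    rewrite [(2 ^+ n) ^+ 2]exprAC [_ ^+ k ^+ 2]exprAC -exprMn.
    apply: (@le_trans _ _ ((2 ^+ 2) ^+ k)); first by rewrite lerXn2r ?nnegrE//; lra.
    by rewrite ler_weXn2l ?(ltnW kn)//; lra.
  exists B; split; first by exists B' => i j; rewrite B'E BE.
  pose C : R := Num.sqrt (rho ^+ n).
  have rn0 : 0 <= rho ^+ n by rewrite exprn_ge0; have /andP[] := rho01.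
  have CE : C ^+ 2 = rho ^+ n by rewrite sqr_sqrtr.
  have [|D [DE DC]] := @walsh_op R (fun k => c k - cn n k) C (sqrtr_ge0 _).
    move=> k; rewrite CE /cn; case: ltnP => kn; first by rewrite subrr expr0n mul0r.
    rewrite subr0 exprAC -exprMn (_ : (2 / 3) ^+ 2 * 2 = rho); last by rewrite /rho; field.
    by rewrite ler_wiXn2l//; rewrite /rho; lra.
  have -> : A - B = D.
    apply: l2_entry_inj => i j; rewrite DE /l2_entry bop_subE l2sumBE.
    rewrite -!/(l2_entry _ _ _) AE BE /block_entry; case: ifP => _; last by rewrite subrr.
    by rewrite /walsh_kernel mulrBl.
  by rewrite -CE ler_sqr ?nnegrE ?sqrtr_ge0.
have /choice[B HB] := An.
apply: (@closed_cvg _ _ \oo _ B (@Reg R) Rcl _ A); first by apply: nearW => n; have [] := HB n.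
apply/cvgrPdist_lt => e e0.
have rho_cvg : rho ^+ n @[n --> \oo] --> (0 : R).
  by apply: cvg_expr; rewrite ger0_norm; have /andP[] := rho01.
have e20 : 0 < e ^+ 2 by rewrite exprn_gt0.
move/cvgrPdist_lt: rho_cvg => /(_ _ e20) h.
near=> n; rewrite -ltr_sqr ?nnegrE ?(ltW e0)//.
have [_ /le_lt_trans] := HB n; apply.
rewrite (le_lt_trans (ler_norm _))// -normrN -sub0r; near: n; exact: h.
Unshelve. all: by end_near. Qed.

End NotClosed.

Theorem theorem2p6 (R : realType) :
  (* the isometric identification of the quotient of the bidual with l2 *)
  (bijective (@l2_ident R) /\
   forall q : bidual_quot (ell2J R), `|l2_ident q| = quot_norm q) /\
  exists Theta : {linear weak_calkin (ell2J R) -> bop (ell2 R) (ell2 R)},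
    (* under it, Theta sends S + W(l2(J)) to R(S) *)
    [/\ forall (S : bop (ell2J R) (ell2J R)) (q : bidual_quot (ell2J R)),
          Theta (weak_calkin_pi S) (l2_ident q) = l2_ident (Rmap S q),
        [/\ forall a b, Theta (a * b) = Theta a * Theta b,
            Theta 1 = 1,
            injective Theta,
            range Theta = Reg (R := R) &
            forall a, reg_norm (Theta a) = quot_norm a],
        forall S : bop (ell2J R) (ell2J R),
          w_norm S = reg_norm (Theta (weak_calkin_pi S)) &
        ~ closed [set Theta (weak_calkin_pi S) |
                  S in [set: bop (ell2J R) (ell2J R)]]].
Proof.
split; first by split; [exact: l2_ident_bij|exact: l2_ident_norm].
exists (@calkin_rep R); split.
- exact: l2_ident_Rmap.
- split; [exact: calkin_rep_mul|exact: calkin_rep1|exact: calkin_rep_inj|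
    exact: range_calkin_rep|exact: calkin_rep_norm].
- by move=> S; rewrite w_norm_resid -calkin_rep_pi.
- rewrite (_ : [set _ | _ in _] = Reg (R := R)); first exact: Reg_not_closed.
  rewrite -range_calkin_rep; apply/seteqP; split=> _ [a _ <-]; first by exists (weak_calkin_pi a).
  by exists (repr a) => //; rewrite /weak_calkin_pi quot_piK.
Qed.
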